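(* Let $M:\mathbb{P}^n\to\mathbb{P}$ be an $n$-variable operator mean and $\sigma$ an operator mean with $\sigma\neq\mathfrak{l}$. For every $A_1,\dots,A_n\in\mathbb{P}$ and any $r\ge1$, $$\lambda_{\min}(M_\sigma(A_1,\dots,A_n))^{r-1}M_\sigma(A_1,\dots,A_n)\le M_{\sigma_{1/r}}(A_1^r,\dots,A_n^r)\le\|M_\sigma(A_1,\dots,A_n)\|_\infty^{r-1}M_\sigma(A_1,\dots,A_n),$$ where $\sigma_{1/r}$ is the operator mean with the representing function $x\mapsto f_\sigma(x^{1/r})$.
   Context: $\mathcal{H}$ is an infinite-dimensional Hilbert space, $B(\mathcal{H})$ the bounded linear operators on $\mathcal{H}$, $B(\mathcal{H})^+$ the positive (semidefinite) operators, $\mathbb{P}=\mathbb{P}(\mathcal{H})$ the positive invertible operators; $\le$ is the usual order on self-adjoint operators and SOT is the strong operator topology. $A_k\searrow A$ (resp. $A_k\nearrow A$) means that the sequence is decreasing (resp. increasing) and $A_k\to A$ in SOT. For $X\in\mathbb{P}$, $\|X\|_\infty$ is the operator norm and $\lambda_{\min}(X)$ is the minimum of the spectrum of $X$. Operator mean (Kubo–Ando): a map $\sigma:B(\mathcal{H})^+\times B(\mathcal{H})^+\to B(\mathcal{H})^+$ such that (i) $A\le C$, $B\le D$ imply $A\sigma B\le C\sigma D$; (ii) $C(A\sigma B)C\le(CAC)\sigma(CBC)$ for all $C\in B(\mathcal{H})^+$; (iii) $A_k\searrow A$, $B_k\searrow B$ imply $A_k\sigma B_k\searrow A\sigma B$;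 (iv) $I\sigma I=I$. By Kubo–Ando, operator means correspond bijectively to nonnegative operator monotone functions $f_\sigma$ on $(0,\infty)$ with $f_\sigma(1)=1$ (the representing function), via $f_\sigma(x)I=I\sigma(xI)$ and $A\sigma B=A^{1/2}f_\sigma(A^{-1/2}BA^{-1/2})A^{1/2}$ for $A,B\in\mathbb{P}$. The left trivial mean $\mathfrak{l}$ is $A\,\mathfrak{l}\,B=A$. $n$-variable operator mean: a map $M:\mathbb{P}^n\to\mathbb{P}$ such that (I) $A_j\le B_j$ for all $j$ implies $M(A_1,\dots,A_n)\le M(B_1,\dots,B_n)$; (II) $S^*M(A_1,\dots,A_n)S=M(S^*A_1S,\dots,S^*A_nS)$ for every invertible $S\in B(\mathcal{H})$; (III) for $A_j,A_{jk}\in\mathbb{P}$, if either $A_{jk}\searrow A_j$ as $k\to\infty$ for each $j$, or $A_{jk}\nearrow A_j$ as $k\to\infty$ for each $j$, then $M(A_{1k},\dots,A_{nk})\to M(A_1,\dots,A_n)$ in SOT; (IV) $M(I,\dots,I)=I$. Deformed mean: for an $n$-variable operator mean $M$ and an operator mean $\sigma\ne\mathfrak{l}$, $M_\sigma(A_1,\dots,A_n)$ is the unique $X\in\mathbb{P}$ (which exists) with $X=M(X\sigma A_1,\dots,X\sigma A_n)$; $M_\sigma$ is again an $n$-variable operator mean. *)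

(* Defs.v *)
From HB Require Import structures.
From mathcomp Require Import all_boot all_order all_algebra.
From mathcomp Require Import complex.
From mathcomp Require Import all_classical all_reals all_analysis.

Set Implicit Arguments.
Unset Strict Implicit.
Unset Printing Implicit Defensive.

Import Order.TTheory GRing.Theory Num.Theory.
Import numFieldNormedType.Exports.

Local Open Scope classical_set_scope.
Local Open Scope ring_scope.
Local Open Scope complex_scope.

(* The inner product is linear in its first argument and conjugate-linear in
   its second one. *)
Record hilbert (R : realType) := Hilbert {
  hspace :> completeNormedModType R[i];
  inner : {dot hspace for (@Num.conj R[i])};
  inner_norm : forall x : hspace, `|x| ^+ 2 = inner x x }.

Section Operators.
Variables (R : realType) (H : hilbert R).

(* Operators are functions carrying a predicate: B(H), B(H)^+ and P(H) are the
   predicates [bounded_op], [positive_op] and [posinv_op] below. *)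
Definition op := H -> H.
Implicit Types A B C S T X : op.

Definition infinite_dimensional : Prop :=
  forall (n : nat) (e : 'I_n -> H),
    exists x : H, forall c : 'I_n -> R[i], x != \sum_(i < n) c i *: e i.

Definition bounded_op A : Prop :=
  (forall (c : R[i]) (x y : H), A (c *: x + y) = c *: A x + A y) /\
  (exists K : R, forall x : H, `|A x| <= K%:C * `|x|).

Definition invertible_op A : Prop :=
  exists2 B, bounded_op B & A \o B = id /\ B \o A = id.

Definition adjoint_of S T : Prop :=
  forall x y : H, inner H (S x) y = inner H x (T y).

(* The order of R[i] compares complex numbers with equal imaginary parts, so
   [0 <= inner H (A x) x] also says that this number is real; for a bounded A
   this makes A self-adjoint. *)
Definition positive_op A : Prop :=
  bounded_op A /\ forall x : H, 0 <= inner H (A x) x.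

Definition posinv_op A : Prop := positive_op A /\ invertible_op A.

Definition le_op A B : Prop := forall x : H, 0 <= inner H ((B - A) x) x.

Definition scalar_op (c : R) : op := fun x => c%:C *: x.

Definition sot_cvg (A_ : nat -> op) A : Prop :=
  forall x : H, A_ k x @[k --> \oo] --> A x.

Definition decr_to (A_ : nat -> op) A : Prop :=
  (forall k, le_op (A_ k.+1) (A_ k)) /\ sot_cvg A_ A.

Definition incr_to (A_ : nat -> op) A : Prop :=
  (forall k, le_op (A_ k) (A_ k.+1)) /\ sot_cvg A_ A.

(* The supremum of |A x| over the unit ball; the norm of H takes its values in
   the nonnegative reals of R[i]. *)
Definition opnorm A : R :=
  sup [set t : R | exists2 x : H, `|x| <= 1 & `|A x| = t%:C].

Definition spectrum A : set R[i] :=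
  [set z | ~ invertible_op (fun x => A x - z *: x)].

(* For A in B(H)^+ the spectrum is a nonempty compact set of reals, and this
   infimum is its minimum. *)
Definition lambda_min A : R := inf [set t : R | spectrum A t%:C].

Definition poly_op (p : {poly R}) A : op :=
  fun x => \sum_(i < size p) (p`_i)%:C *: iter i A x.

(* Continuous functional calculus of a self-adjoint A: f(A) is the operator norm
   limit of p(A) for real polynomials p converging to f uniformly on the
   spectrum of A. *)
Definition is_funcalc (f : R -> R) A B : Prop :=
  bounded_op B /\
  forall e : R, 0 < e -> exists2 p : {poly R},
    (forall t : R, spectrum A t%:C -> `|p.[t] - f t| <= e) &
    opnorm (poly_op p A - B) <= e.

Definition funcalc (f : R -> R) A : op := xget (0 : op) [set B | is_funcalc f A B].

Definition power_op A (r : R) : op := funcalc (fun t => t `^ r) A.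

(* A mean is a total function on operators, of which only the values at
   positive (resp. positive invertible) arguments matter. *)
Record operator_mean (sigma : op -> op -> op) : Prop := OperatorMean {
  mean_positive : forall A B, positive_op A -> positive_op B ->
    positive_op (sigma A B);
  mean_monotone : forall A B C D, positive_op A -> positive_op B ->
    positive_op C -> positive_op D ->
    le_op A C -> le_op B D -> le_op (sigma A B) (sigma C D);
  mean_transformer : forall A B C,
    positive_op A -> positive_op B -> positive_op C ->
    le_op (C \o sigma A B \o C) (sigma (C \o A \o C) (C \o B \o C));
  mean_continuous : forall (A_ B_ : nat -> op) A B,
    (forall k, positive_op (A_ k)) -> (forall k, positive_op (B_ k)) ->
    positive_op A -> positive_op B ->
    decr_to A_ A -> decr_to B_ B ->
    decr_to (fun k => sigma (A_ k) (B_ k)) (sigma A B);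
  mean_normalized : sigma id id = id }.

Definition representing (sigma : op -> op -> op) (f : R -> R) : Prop :=
  forall x : R, 0 < x -> sigma id (scalar_op x) = scalar_op (f x).

Definition left_trivial (sigma : op -> op -> op) : Prop :=
  forall A B, positive_op A -> positive_op B -> sigma A B = A.

Record nvar_operator_mean (n : nat) (M : ('I_n -> op) -> op) : Prop :=
  NvarOperatorMean {
  nmean_posinv : forall A : 'I_n -> op, (forall j, posinv_op (A j)) ->
    posinv_op (M A);
  nmean_monotone : forall A B : 'I_n -> op,
    (forall j, posinv_op (A j)) -> (forall j, posinv_op (B j)) ->
    (forall j, le_op (A j) (B j)) -> le_op (M A) (M B);
  nmean_congruence : forall (A : 'I_n -> op) S T,
    (forall j, posinv_op (A j)) ->
    bounded_op S -> invertible_op S -> bounded_op T -> adjoint_of S T ->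
    T \o M A \o S = M (fun j => T \o A j \o S);
  nmean_continuous : forall (A_ : nat -> 'I_n -> op) (A : 'I_n -> op),
    (forall k j, posinv_op (A_ k j)) -> (forall j, posinv_op (A j)) ->
    (forall j, decr_to (fun k => A_ k j) (A j)) \/
    (forall j, incr_to (fun k => A_ k j) (A j)) ->
    sot_cvg (fun k => M (A_ k)) (M A);
  nmean_normalized : M (fun _ => id) = id }.

(* M_sigma (A_1, ..., A_n): the solution X in P(H) of
   X = M (X sigma A_1, ..., X sigma A_n), which is unique if sigma is not left
   trivial. *)
Definition deformed_mean (n : nat) (M : ('I_n -> op) -> op)
    (sigma : op -> op -> op) (A : 'I_n -> op) : op :=
  xget (0 : op) [set X | posinv_op X /\ X = M (fun j => sigma X (A j))].

End Operators.

Arguments scalar_op {R H} c _.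

(* Main.v *)
Require Import Defs.
From HB Require Import structures.
From mathcomp Require Import all_boot all_order all_algebra.
From mathcomp Require Import complex.
From mathcomp Require Import all_classical all_reals all_analysis.
From mathcomp Require Import ring lra.

Import Order.TTheory GRing.Theory Num.Theory.
Import numFieldNormedType.Exports.

Local Open Scope classical_set_scope.
Local Open Scope ring_scope.
Local Open Scope complex_scope.

(* Write K = X^(1/2), J = X^(-1/2), where X is the deformed mean of the A_j, so
   that X = M (K (I sigma J A_j J) K). For nu > 0 the operator nu X satisfies
   (nu X) sigma_r A_j^r = nu K (I sigma T_j^(1/r)) K with
   T_j = nu^-1 J A_j^r J. For nu = ||X||^(r-1) (resp. lambda_min(X)^(r-1)),
   Hansen's inequality C S^p C <= (C S C)^p for contractions C and 0 <= p <= 1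
   gives T_j^(1/r) <= J A_j J (resp. >=), hence nu X is a super- (resp. sub-)
   solution of the fixed point equation of sigma_r. A subsolution lies below
   every supersolution, since a -> a V sigma A grows strictly slower than
   linearly: the representing function of a mean other than the left trivial one
   is strictly increasing. Passing from representing functions to operators uses
   that I sigma S commutes with the spectral projections of S, on the ranges of
   which S is almost a scalar. *)

Set Implicit Arguments.
Unset Strict Implicit.
Unset Printing Implicit Defensive.

(** * Inner product and operator order *)

(** The exponent r - 1 in nu is the one for which nu^(-1/r), produced by the 1/r-th power of T_j,
    cancels the constant of Hansen's inequality for C = X^(1/2) or X^(-1/2), whose square is bounded
    by ||X|| or 1/lambda_min(X). Means are given by axioms, and [representing] fixes them on scalars
    only, so I sigma S = f(S) is not at hand. It is replaced by comparing quadratic forms on the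
    blocks of a geometric spectral grid of ratio c > 1. There S is a scalar up to a factor c, the
    bound f (c t) <= c f t controls the error, and either c tends to 1 or a strict inequality
    absorbs the error. Comparing sub- and supersolutions takes more than pointwise strict growth of
    f: the spectrum may be a continuum, and a factor k < 1 valid for all vectors is obtained because
    the grid is finite. Strictness of f itself comes from the order axioms: two nearly equal rank
    one projections transport a flat piece of f to the whole half-line. *)

Lemma Re_conj (R : realType) (z : R[i]) : complex.Re (Num.conj z) = complex.Re z.
Proof. by case: z => u v. Qed.

Lemma Re_mulr (R : realType) (a : R) (z : R[i]) :
  complex.Re (a%:C * z) = a * complex.Re z.
Proof. by case: z => u v /=; rewrite mul0r subr0. Qed.

Lemma Re_mulC (R : realType) (a : R) (z : R[i]) :
  complex.Re (z * a%:C) = complex.Re z * a.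
Proof. by rewrite mulrC Re_mulr mulrC. Qed.

Section RealInner.
Variables (R : realType) (H : hilbert R).
Implicit Types (x y z : H) (a b c : R).

(** The real part keeps all estimates in R, where [lra] and [nra] apply; the imaginary part is
    recovered by inserting 'i, as in [inner_Im]. *)
Definition ri x y : R := complex.Re (inner H x y).
Definition nn x : R := Num.sqrt (ri x x).

Lemma riC x y : ri x y = ri y x.
Proof. by rewrite /ri hermC expr0 mul1r /= Re_conj. Qed.

Lemma riDl x y z : ri (x + y) z = ri x z + ri y z.
Proof. by rewrite /ri linearDl raddfD. Qed.

Lemma riDr x y z : ri z (x + y) = ri z x + ri z y.
Proof. by rewrite riC riDl !(riC z). Qed.

Lemma riNl x y : ri (- x) y = - ri x y.
Proof. by rewrite /ri linearNl raddfN. Qed.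

Lemma riNr x y : ri x (- y) = - ri x y.
Proof. by rewrite riC riNl riC. Qed.

Lemma riZl a x y : ri (a%:C *: x) y = a * ri x y.
Proof. by rewrite /ri linearZl_LR Re_mulr. Qed.

Lemma riZr a x y : ri x (a%:C *: y) = a * ri x y.
Proof. by rewrite riC riZl riC. Qed.

Lemma ri0l x : ri 0 x = 0.
Proof. by rewrite /ri linear0l. Qed.

Lemma ri0r x : ri x 0 = 0.
Proof. by rewrite riC ri0l. Qed.

Definition riE := (riDl, riDr, riNl, riNr, riZl, riZr, ri0l, ri0r).

Lemma innerxx x : inner H x x = (ri x x)%:C.
Proof.
have := dnorm_ge0 (inner H) x; rewrite /ri.
by case: (inner H x x) => u v; rewrite lecE /= => /andP[/eqP -> _].
Qed.

Lemma ri_ge0 x : 0 <= ri x x.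
Proof. by have := dnorm_ge0 (inner H) x; rewrite innerxx ler0c. Qed.

Lemma ri_eq0 x : ri x x = 0 -> x = 0.
Proof. by move=> x0; apply/eqP; rewrite -(dnorm_eq0 (inner H)) innerxx x0. Qed.

Lemma normE x : `|x| = (nn x)%:C.
Proof.
apply/eqP; rewrite -(@eqrXn2 _ 2) ?ler0c ?sqrtr_ge0 //.
by rewrite inner_norm innerxx -rmorphXn /= /nn sqr_sqrtr ?ri_ge0.
Qed.

Lemma nn_ge0 x : 0 <= nn x.
Proof. exact: sqrtr_ge0. Qed.

Lemma nn_sqr x : nn x ^+ 2 = ri x x.
Proof. by rewrite sqr_sqrtr ?ri_ge0. Qed.

Lemma nn0 : nn 0 = 0.
Proof. by rewrite /nn ri0l sqrtr0. Qed.

Lemma nn_eq0 x : nn x = 0 -> x = 0.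
Proof. by move=> x0; apply: ri_eq0; rewrite -nn_sqr x0 expr0n. Qed.

Lemma nn_gt0 x : x != 0 -> 0 < nn x.
Proof.
by move=> x0; rewrite lt_def nn_ge0 andbT; apply: contra x0 => /eqP/nn_eq0 ->.
Qed.

Lemma nnD x y : nn (x + y) <= nn x + nn y.
Proof. by have := ler_normD x y; rewrite !normE -rmorphD lecR. Qed.

Lemma nnN x : nn (- x) = nn x.
Proof. by rewrite /nn riNl riNr opprK. Qed.

Lemma nnB x y : nn (x - y) <= nn x + nn y.
Proof. by rewrite -(nnN y) nnD. Qed.

Lemma nnBC x y : nn (x - y) = nn (y - x).
Proof. by rewrite -nnN opprB. Qed.

Lemma nnZ a x : nn (a%:C *: x) = `|a| * nn x.
Proof. by rewrite /nn riZl riZr mulrA -expr2 sqrtrM ?sqr_ge0 // sqrtr_sqr. Qed.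

Lemma nnZc (k : R[i]) x : nn (k *: x) = complex.Re `|k| * nn x.
Proof.
have := congr1 (@complex.Re R) (normrZ k x).
by rewrite !normE Re_mulC.
Qed.

Lemma ri_cs x y : `|ri x y| <= nn x * nn y.
Proof.
have [->|x0] := eqVneq x 0; first by rewrite ri0l normr0 nn0 mul0r.
have p0 : 0 < ri x x by rewrite -nn_sqr exprn_gt0 // nn_gt0.
rewrite -ler_sqr ?nnegrE ?normr_ge0 ?mulr_ge0 ?nn_ge0 //.
rewrite exprMn !nn_sqr real_normK ?num_real //.
have := ri_ge0 ((ri x x)%:C *: y - (ri x y)%:C *: x); rewrite !riE (riC y x).
set u := ri x x in p0 *; set v := ri x y; set w := ri y y => h.
rewrite -(ler_pM2l p0); nra.
Qed.

Lemma ri_le x y : ri x y <= nn x * nn y.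
Proof. exact: le_trans (ler_norm _) (ri_cs x y). Qed.

End RealInner.

Lemma discriminant_le (R : realType) (a b c : R) :
  (forall t, 0 <= a * t ^+ 2 + 2 * b * t + c) -> b ^+ 2 <= a * c.
Proof.
move=> h; have c0 : 0 <= c by have := h 0; nra.
have [a0|a0] := eqVneq a 0.
  have [->|b0] := eqVneq b 0; first by nra.
  have := h (- (c + 1) / (2 * b)).
  have -> : 2 * b * (- (c + 1) / (2 * b)) = - (c + 1) by field.
  by rewrite a0; lra.
set E := (a * c - b ^+ 2) / a.
have hE k : 0 <= E + a * k ^+ 2.
  have -> : E + a * k ^+ 2 = a * (- b / a + k) ^+ 2 + 2 * b * (- b / a + k) + c.
    by rewrite /E; field.
  exact: h.
have E0 := hE 0.
have [an|ap|] := ltrgtP a 0; last by move/eqP; rewrite (negPf a0).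
  have ai : a^-1 < 0 by rewrite invr_lt0.
  have k1 : 0 <= - E / a by nra.
  have : a * (- E / a) = - E by field.
  by move: (- E / a) k1 => k k1 ak; have := hE (1 + k); nra.
have : E * a = a * c - b ^+ 2 by rewrite /E; field.
by nra.
Qed.

Section Operators.
Variables (R : realType) (H : hilbert R).
Implicit Types (x y z : H) (a b c : R) (A B C S T : op H).

Section Linear.
Variables (A : op H).
Hypothesis bA : bounded_op A.

Lemma bopD x y : A (x + y) = A x + A y.
Proof. by case: bA => h _; have := h 1 x y; rewrite !scale1r. Qed.

Lemma bop0 : A 0 = 0.
Proof. by apply: (addrI (A 0)); rewrite -bopD !addr0. Qed.

Lemma bopZ (k : R[i]) x : A (k *: x) = k *: A x.
Proof. by case: bA => h _; have := h k x 0; rewrite bop0 !addr0. Qed.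

Lemma bopN x : A (- x) = - A x.
Proof. by rewrite -scaleN1r bopZ scaleN1r. Qed.

Lemma bopB x y : A (x - y) = A x - A y.
Proof. by rewrite bopD bopN. Qed.

Lemma bop_sum (I : Type) (r : seq I) (P : pred I) (F : I -> H) :
  A (\sum_(i <- r | P i) F i) = \sum_(i <- r | P i) A (F i).
Proof. by apply: (big_morph A bopD bop0). Qed.

Lemma bop_bound : exists2 K : R, 0 < K & forall x, nn (A x) <= K * nn x.
Proof.
case: bA => _ [K hK]; exists (`|K| + 1) => [|x]; first by rewrite ltr_wpDl.
have := hK x; rewrite !normE -rmorphM lecR => /le_trans; apply.
by rewrite ler_wpM2r ?nn_ge0 //; have := ler_norm K; lra.
Qed.

End Linear.

Lemma mk_bop A K : (forall (k : R[i]) x y, A (k *: x + y) = k *: A x + A y) ->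
  (forall x, nn (A x) <= K * nn x) -> bounded_op A.
Proof. by move=> h hK; split=> //; exists K => x; rewrite !normE -rmorphM lecR. Qed.

Lemma bop_id : bounded_op (id : op H).
Proof. by apply: (@mk_bop _ 1) => // x; rewrite mul1r. Qed.

Lemma bop_comp A B : bounded_op A -> bounded_op B -> bounded_op (A \o B).
Proof.
move=> bA bB; have [K K0 hK] := bop_bound bA; have [L L0 hL] := bop_bound bB.
apply: (@mk_bop _ (K * L)) => [k x y|x] /=; first by rewrite (bopD bB) bopZ // bopD // (bopZ bA).
by rewrite (le_trans (hK _)) // -mulrA ler_pM2l.
Qed.

Lemma bop_add A B : bounded_op A -> bounded_op B -> bounded_op (fun x => A x + B x).
Proof.
move=> bA bB; have [K K0 hK] := bop_bound bA; have [L L0 hL] := bop_bound bB.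
apply: (@mk_bop _ (K + L)) => [k x y|x] /=.
  by rewrite !(bopD bB, bopD bA, bopZ bA, bopZ bB) scalerDr addrACA.
by rewrite (le_trans (nnD _ _)) // mulrDl lerD.
Qed.

Lemma bop_scale (k : R[i]) A : bounded_op A -> bounded_op (fun x => k *: A x).
Proof.
move=> bA; have [K K0 hK] := bop_bound bA.
apply: (@mk_bop _ (complex.Re `|k| * K)) => [l x y|x] /=.
  by rewrite bopD // bopZ // scalerDr !scalerA mulrC.
by rewrite nnZc -mulrA ler_wpM2l // normc_def sqrtr_ge0.
Qed.

Lemma bop_sub A B : bounded_op A -> bounded_op B -> bounded_op (fun x => A x - B x).
Proof.
move=> bA bB; have -> : (fun x => A x - B x) = (fun x => A x + (-1) *: B x).
  by apply/funext => x; rewrite scaleN1r.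
exact: bop_add (bop_scale _ bB).
Qed.

(** For complex-linear A, symmetry of the real form amounts to self-adjointness, since replacing y
    by 'i y compares imaginary parts. *)
Definition sym A := forall x y, ri (A x) y = ri x (A y).
Definition sa A := bounded_op A /\ sym A.
Definition qle A B := forall x, ri (A x) x <= ri (B x) x.
Definition lbd A c := forall x, c * ri x x <= ri (A x) x.
Definition ubd A c := forall x, ri (A x) x <= c * ri x x.

Lemma sa_id : sa id.
Proof. by split => //; exact: bop_id. Qed.

Lemma sa_add A B : sa A -> sa B -> sa (fun x => A x + B x).
Proof.
move=> [bA sA] [bB sB]; split; first exact: bop_add.
by move=> x y; rewrite !riE sA sB.
Qed.

Lemma sa_scale c A : sa A -> sa (fun x => c%:C *: A x).
Proof.
move=> [bA sA]; split; first exact: bop_scale.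
by move=> x y; rewrite !riE sA.
Qed.

Lemma sa_sub A B : sa A -> sa B -> sa (fun x => A x - B x).
Proof.
move=> [bA sA] [bB sB]; split; first exact: bop_sub.
by move=> x y; rewrite !riE sA sB.
Qed.

Lemma sa_scalar c : sa (scalar_op c : op H).
Proof. exact: (sa_scale _ sa_id). Qed.

Lemma sa_congr A C : sa A -> sa C -> sa (C \o A \o C).
Proof.
move=> [bA sA] [bC sC]; split; first exact: bop_comp (bop_comp bC bA) bC.
by move=> x y /=; rewrite sC sA sC.
Qed.

Lemma sa_bound A : sa A -> exists2 c, 0 < c & ubd A c /\ lbd A (- c).
Proof.
move=> [bA sA]; have [K K0 hK] := bop_bound bA; exists K => //; split=> x;
  have := ri_cs (A x) x; rewrite ler_norml -nn_sqr => /andP[h1 h2];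
  have := ler_wpM2r (nn_ge0 x) (hK x); nra.
Qed.

Lemma inner_Im (x y : H) : complex.Im (inner H x y) = ri x ('i *: y).
Proof.
rewrite /ri linearZr_LR /=; case: (inner H x y) => u v.
by rewrite /GRing.mul /=; ring.
Qed.

Lemma inner_Im' (x y : H) : complex.Im (inner H x y) = - ri ('i *: x) y.
Proof.
rewrite /ri linearZl_LR /=; case: (inner H x y) => u v.
by rewrite /GRing.mul /=; ring.
Qed.

Lemma positive_op_ge0 A : positive_op A -> lbd A 0.
Proof. by move=> [_ h] x; have := h x; rewrite lecE mul0r => /andP[]. Qed.

(** Polarization: the imaginary part of <A z, z> vanishes at z = x, y and 'i x + y, and the three
    identities combine to the symmetry of [ri (A x) y]. *)
Lemma positive_op_sa A : positive_op A -> sa A.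
Proof.
move=> [bA h]; split=> // x y.
have im z : complex.Im (inner H (A z) z) = 0.
  by have := h z; rewrite lecE => /andP[/eqP].
have := im ('i *: x + y); rewrite inner_Im' bopD // bopZ //.
have := im x; rewrite inner_Im' => h1; have := im y; rewrite inner_Im' => h2.
have ii z : 'i *: ('i *: z) = - z :> H by rewrite scalerA -expr2 sqr_i scaleN1r.
have ir z w : ri ('i *: z) ('i *: w) = ri z w by rewrite -inner_Im inner_Im' ii riNl opprK.
rewrite scalerDr ii !riE; rewrite -(ir (A x)) ii !riE ir => h3.
by move: h1 h2; rewrite (riC x) ; lra.
Qed.

Lemma sa_positive A : sa A -> lbd A 0 -> positive_op A.
Proof.
move=> [bA sA] h; split=> // x; rewrite lecE /=; have := h x; rewrite mul0r => ->.
rewrite andbT; apply/eqP; have := inner_Im (A x) x.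
by rewrite sA bopZ // riC -[X in _ = X]opprK -inner_Im'; lra.
Qed.

Lemma positive_opP A : positive_op A <-> sa A /\ lbd A 0.
Proof.
split; last by case; exact: sa_positive.
by move=> h; split; [exact: positive_op_sa | exact: positive_op_ge0].
Qed.

Lemma le_opP A B : sa A -> sa B -> le_op A B <-> qle A B.
Proof.
move=> sA sB; have sBA := sa_sub sB sA; split=> h x.
  have := h x; rewrite lecE => /andP[_]; rewrite -/(ri _ _) /= => h0.
  by rewrite -subr_ge0 -riNl -riDl.
have : positive_op (fun x => B x - A x) by apply: sa_positive => // z; rewrite !riE mul0r subr_ge0.
by case=> _ /(_ x).
Qed.

Lemma pos_cs A x y : sa A -> lbd A 0 -> ri (A x) y ^+ 2 <= ri (A x) x * ri (A y) y.
Proof.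
move=> [bA sA] pA; apply: discriminant_le => t.
have := pA (y + t%:C *: x); rewrite mul0r bopD // bopZ // !riE.
by have := sA y x; rewrite (riC y) => ->; lra.
Qed.

End Operators.

(** * Strong limits *)

Section Limits.
Variables (R : realType) (H : hilbert R).
Implicit Types (x y z l : H) (a b c e : R) (A B C S T : op H) (u v : nat -> H).

Definition seqlim u l :=
  forall e, 0 < e -> exists N, forall k, (N <= k)%N -> nn (u k - l) <= e.

Lemma seqlimP u l : (u k @[k --> \oo] --> l) <-> seqlim u l.
Proof.
split=> [/cvgrPdist_le h e e0|h].
  have /h[N _ hN] : 0 < e%:C by rewrite ltcR.
  by exists N => k /hN /=; rewrite normE lecR nnBC.
apply/cvgrPdist_le => -[e f]; rewrite ltcE /= => /andP[/eqP -> e0].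
have [N hN] := h _ e0; exists N => // k /= Nk.
by rewrite normE lecR nnBC hN.
Qed.

Lemma seqlim_unique u l m : seqlim u l -> seqlim u m -> l = m.
Proof. by move=> /seqlimP hl /seqlimP hm; apply: (cvg_unique _ hl hm). Qed.

Lemma seqlim_cst l : seqlim (fun _ => l) l.
Proof. by move=> e e0; exists 0 => k _; rewrite subrr nn0 ltW. Qed.

Lemma seqlim_eq u v l : (exists N, forall k, (N <= k)%N -> u k = v k) ->
  seqlim u l -> seqlim v l.
Proof.
move=> [M hM] h e /h[N hN]; exists (maxn M N) => k.
by rewrite geq_max => /andP[Mk Nk]; rewrite -hM // hN.
Qed.

Lemma seqlimD u v l m : seqlim u l -> seqlim v m -> seqlim (fun k => u k + v k) (l + m).
Proof. by move=> /seqlimP hl /seqlimP hm; apply/seqlimP; apply: cvgD. Qed.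

Lemma seqlimB u v l m : seqlim u l -> seqlim v m -> seqlim (fun k => u k - v k) (l - m).
Proof. by move=> /seqlimP hl /seqlimP hm; apply/seqlimP; apply: cvgB. Qed.

Lemma seqlimZ (k : R[i]) u l : seqlim u l -> seqlim (fun n => k *: u n) (k *: l).
Proof. by move=> /seqlimP hl; apply/seqlimP; apply: cvgZr. Qed.

Lemma seqlim_dominated u l K v : 0 <= K -> seqlim v 0 ->
  (forall k, nn (u k - l) <= K * nn (v k)) -> seqlim u l.
Proof.
move=> K0 hv h e e0; have K1 : 0 < K + 1 by lra.
have [N hN] := hv (e / (K + 1)) (divr_gt0 e0 K1).
exists N => k /hN; rewrite subr0 ler_pdivlMr // => h2.
by have := h k; have := nn_ge0 (v k); nra.
Qed.

Lemma seqlim_bop A u l : bounded_op A -> seqlim u l -> seqlim (fun k => A (u k)) (A l).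
Proof.
move=> bA h; have [K K0 hK] := bop_bound bA.
apply: (seqlim_dominated (ltW K0) (v := fun k => u k - l)) => [|k].
  by have := seqlimB h (seqlim_cst l); rewrite subrr.
by rewrite -bopB.
Qed.

Lemma seqlim_shift u l : seqlim u l -> seqlim (fun k => u k.+1) l.
Proof.
by move=> h e /h[N hN]; exists N => k Nk; apply: hN; rewrite (leq_trans Nk).
Qed.

Lemma seqlim_ri u v l m c : seqlim u l -> seqlim v m ->
  (forall e, 0 < e -> exists N, forall k, (N <= k)%N -> c - e <= ri (u k) (v k)) ->
  c <= ri l m.
Proof.
move=> hu hv h; apply/ler_addgt0Pr => e e0.
set M := nn l + nn m + 2; have M0 : 0 < M.
  by rewrite /M; have := nn_ge0 l; have := nn_ge0 m; lra.
pose d := Num.min 1 (e / (2 * M)); have d0 : 0 < d.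
  by rewrite lt_min ltr01 /= divr_gt0 // mulr_gt0.
have dM : 2 * (d * M) <= e.
  have : d <= e / (2 * M) by rewrite ge_min lexx orbT.
  by rewrite ler_pdivlMr ?mulr_gt0 //; lra.
have d1 : d <= 1 by rewrite ge_min lexx.
have [N1 h1] := hu d d0; have [N2 h2] := hv d d0.
have [N3 h3] := h (e / 2) ltac:(lra).
pose k := maxn N1 (maxn N2 N3).
have {}h1 := h1 k (leq_maxl _ _).
have {}h2 := h2 k (leq_trans (leq_maxl _ _) (leq_maxr _ _)).
have {}h3 := h3 k (leq_trans (leq_maxr _ _) (leq_maxr _ _)).
have e1 : u k = (u k - l) + l by rewrite subrK.
have e2 : v k = (v k - m) + m by rewrite subrK.
move: h1 h2 h3; rewrite {2}e1 {2}e2.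
move: (u k - l) (v k - m) => s t hs ht; rewrite !riE.
have := ri_le s t; have := ri_le s m; have := ri_le l t.
have := nn_ge0 s; have := nn_ge0 t; have := nn_ge0 l; have := nn_ge0 m.
rewrite /M in dM; clear -d1 d0 dM hs ht.
move=> pm pl pt ps q1 q2 q3 q4.
have : nn s * nn t <= d by nra.
have : nn s * nn m <= d * nn m by nra.
have : nn l * nn t <= d * nn l by nra.
lra.
Qed.

Lemma seqlim_ri_ge u l z c : seqlim u l -> (forall k, c <= ri (u k) z) -> c <= ri l z.
Proof.
move=> hu h; apply: (seqlim_ri hu (seqlim_cst z)) => e e0; exists 0 => k _.
by have := h k; lra.
Qed.

Lemma seqlim_ri_le u l z c : seqlim u l -> (forall k, ri (u k) z <= c) -> ri l z <= c.
Proof.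
move=> hu h; rewrite -lerN2 -riNr; apply: (seqlim_ri_ge hu) => k.
by rewrite riNr lerN2.
Qed.

Lemma seqlim_nn_le u l c : 0 <= c -> seqlim u l -> (forall k, nn (u k) <= c) -> nn l <= c.
Proof.
move=> c0 hu h; apply/ler_addgt0Pr => e /hu[N /(_ N (leqnn _)) hN].
have -> : l = u N - (u N - l) by rewrite opprB addrCA subrr addr0.
by rewrite (le_trans (nnB _ _)) // lerD.
Qed.

Lemma cauchy_seqlim u :
  (forall e, 0 < e -> exists N, forall m n, (N <= m)%N -> (N <= n)%N -> nn (u m - u n) <= e) ->
  exists l, seqlim u l.
Proof.
move=> h; suff /cauchy_cvgP /cvg_ex[l hl] : cauchy (u k @[k --> \oo]).
  by exists l; apply/seqlimP.
apply/cauchy_ballP => -[e f]; rewrite ltcE /= => /andP[/eqP -> e0].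
have [N hN] := h (e / 2) ltac:(lra).
exists ([set u n | n in [set n | (N <= n)%N]], [set u n | n in [set n | (N <= n)%N]]) => /=.
  by split; exists N => // n Nn; exists n.
move=> [_ _] /= [[m Nm <-] [n Nn <-]].
by rewrite -ball_normE /ball_ /= normE ltcR (le_lt_trans (hN _ _ Nm Nn)) //; lra.
Qed.

(** Cauchy-Schwarz for the form of A at x and A x: |A x|^4 <= <A x, x> <A (A x), A x> <= <A x, x> b
    |A x|^2. *)
Lemma pos_nn_sqr A b x : sa A -> lbd A 0 -> ubd A b ->
  ri (A x) (A x) <= b * ri (A x) x.
Proof.
move=> sA pA hA.
have := pos_cs x (A x) sA pA; have := hA (A x); have := pA x; rewrite mul0r.
have := ri_ge0 (A x); set p := ri (A x) (A x); set q := ri _ x; set r := ri (A _) _ => p0 q0 hr h.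
have [->|pn0] := eqVneq p 0; last first.
  have pp : 0 < p by rewrite lt_def pn0.
  by rewrite -(ler_pM2l pp); nra.
have [b0|b0] := leP 0 b; first by rewrite mulr_ge0.
have := hA x; rewrite -/q; have := ri_ge0 x => x0 qb.
have -> : q = 0 by nra.
by rewrite mulr0.
Qed.

Lemma pos_nn A b x : 0 <= b -> sa A -> lbd A 0 -> ubd A b -> nn (A x) <= b * nn x.
Proof.
move=> b0 sA pA hA; have h1 := pos_nn_sqr x sA pA hA; have h2 := hA x.
rewrite -ler_sqr ?nnegrE ?mulr_ge0 ?nn_ge0 // exprMn !nn_sqr.
by rewrite (le_trans h1) // expr2 -mulrA ler_wpM2l.
Qed.

Lemma pos_eq0 A x : sa A -> lbd A 0 -> ri (A x) x = 0 -> A x = 0.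
Proof.
move=> sA pA h; have [c c0 [hc _]] := sa_bound sA.
by apply: ri_eq0; apply/le_anti; rewrite ri_ge0 (le_trans (pos_nn_sqr x sA pA hc)) // h mulr0.
Qed.

(** Decreasing forms converge, so the positive differences T_N - T_n have small forms at x;
    [pos_nn_sqr] turns a small form into a small norm. *)
Lemma monotone_limit (T : nat -> op H) : (forall k, sa (T k)) ->
  (forall k, qle (T k.+1) (T k)) -> (forall k, lbd (T k) 0) ->
  exists S, [/\ sa S, lbd S 0, forall x, seqlim (fun k => T k x) (S x)
              & forall k, qle S (T k)].
Proof.
move=> sT dT pT.
have dec m n : (m <= n)%N -> qle (T n) (T m).
  elim: n => [|n IH]; first by rewrite leqn0 => /eqP -> x.
  by rewrite leq_eqVlt => /predU1P[-> x //|/IH h x]; rewrite (le_trans (dT n x)).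
have [b b0 [hb _]] := sa_bound (sT 0).
have ub k : ubd (T k) b by move=> x; rewrite (le_trans (dec 0 k isT x)) ?hb.
have ex x : exists l, seqlim (fun k => T k x) l.
  apply: cauchy_seqlim => e e0.
  pose r := [set ri (T k x) x | k in [set: nat]].
  have rl : has_inf r.
    split; first by exists (ri (T 0 x) x); exists 0.
    by exists 0 => _ [k _ <-]; have := pT k x; rewrite mul0r.
  (* By [pos_nn_sqr] with bound b, a form of at most e^2 / (4 b) gives a norm of at most e / 2. *)
  have d0 : 0 < e ^+ 2 / (4 * b) by rewrite divr_gt0 ?exprn_gt0 ?mulr_gt0.
  have [_ [N _ <-] hN] := inf_adherent d0 rl.
  have key n : (N <= n)%N -> nn (T N x - T n x) <= e / 2.
    move=> Nn; rewrite -ler_sqr ?nnegrE ?nn_ge0 ?divr_ge0 ?(ltW e0) // nn_sqr.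
    have sD := sa_sub (sT N) (sT n).
    have pD : lbd (fun y => T N y - T n y) 0.
      by move=> y; rewrite !riE mul0r subr_ge0 dec.
    have uD : ubd (fun y => T N y - T n y) b.
      by move=> y; rewrite !riE; have := ub N y; have := pT n y; rewrite mul0r; lra.
    apply: le_trans (pos_nn_sqr x sD pD uD) _.
    have : inf r <= ri (T n x) x by apply: ge_inf; [case: rl | exists n].
    rewrite !riE => h; have h2 : ri (T N x) x - ri (T n x) x <= e ^+ 2 / (4 * b) by lra.
    have -> : (e / 2) ^+ 2 = b * (e ^+ 2 / (4 * b)) by field; lra.
    by rewrite ler_pM2l.
  exists N => m n Nm Nn; have -> : T m x - T n x = (T N x - T n x) - (T N x - T m x).
    by rewrite opprB [RHS]addrC addrA subrK.
  by rewrite (le_trans (nnB _ _)) //; have := key _ Nm; have := key _ Nn; lra.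
have [S hS] := choice ex; exists S.
have bS : bounded_op S.
  apply: (@mk_bop _ _ _ b) => [k x y|x].
    apply: seqlim_unique (hS _) _.
    apply: seqlim_eq (seqlimD (seqlimZ k (hS x)) (hS y)); exists 0 => j _.
    by case: (sT j) => bj _; rewrite bopD // bopZ.
  apply: (seqlim_nn_le _ (hS x)) => [|k]; first by rewrite mulr_ge0 ?nn_ge0 ?ltW.
  exact: pos_nn (ltW b0) (sT k) (pT k) (ub k).
have sS : sym S.
  move=> x y; apply/le_anti/andP; split.
    have h := seqlimB (hS x) (seqlim_cst (S x)).
    apply: (seqlim_ri (seqlim_cst x) (hS y)) => e e0.
    rewrite subrr in h; have y1 : 0 < nn y + 1 by have := nn_ge0 y; lra.
    have [N hN] := h (e / (nn y + 1)) (divr_gt0 e0 y1); exists N => k /hN.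
    rewrite subr0 ler_pdivlMr // => h2; case: (sT k) => _ <-.
    have := ri_le (S x - T k x) y; rewrite nnBC !riE.
    by have := nn_ge0 (T k x - S x); have := nn_ge0 y; nra.
  apply: (seqlim_ri (hS x) (seqlim_cst y)) => e e0.
  have h := seqlimB (hS y) (seqlim_cst (S y)).
  rewrite subrr in h; have y1 : 0 < nn x + 1 by have := nn_ge0 x; lra.
  have [N hN] := h (e / (nn x + 1)) (divr_gt0 e0 y1); exists N => k /hN.
  rewrite subr0 ler_pdivlMr // => h2; case: (sT k) => _ ->.
  have := ri_le x (S y - T k y); rewrite nnBC !riE.
  by have := nn_ge0 (T k y - S y); have := nn_ge0 x; nra.
split=> // [x|k x].
  by apply: (seqlim_ri_ge (hS x)) => k; exact: pT.
apply: (seqlim_ri_le (seqlim_eq _ (hS x)) (u := fun j => T (maxn k j) x)).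
  by exists k => j kj; rewrite (maxn_idPr kj).
by move=> j; apply: dec; rewrite leq_maxl.
Qed.

End Limits.

(** * Spectrum of self-adjoint operators *)

Section Spectrum.
Variables (R : realType) (H : hilbert R).
Implicit Types (x y z : H) (a b c d e : R) (A B C S T : op H) (p q : {poly R}).

Lemma expr_small (q e : R) : 0 <= q < 1 -> 0 < e ->
  exists N, forall k, (N <= k)%N -> q ^+ k <= e.
Proof.
move=> /andP[q0 q1] e0; have /cvgrPdist_le h : q ^+ k @[k --> \oo] --> (0 : R).
  by apply: cvg_expr; rewrite ger0_norm.
have [N _ hN] := h e e0; exists N => k /hN /=.
by rewrite sub0r normrN ger0_norm ?exprn_ge0.
Qed.

(** Its failure for A - z means that z is an approximate eigenvalue. It passes to products of
    factors and follows from invertibility, so spectral points are found by refuting it. *)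
Definition bounded_below A := exists2 d : R, 0 < d & forall x, d * nn x <= nn (A x).

Lemma bounded_below_comp A B :
  bounded_below A -> bounded_below B -> bounded_below (A \o B).
Proof.
move=> [d d0 hd] [e e0 he]; exists (d * e); first exact: mulr_gt0.
by move=> x; rewrite (le_trans _ (hd _)) // -mulrA ler_pM2l.
Qed.

Lemma invertible_bounded_below A : invertible_op A -> bounded_below A.
Proof.
move=> [B bB [_ BA]]; have [K K0 hK] := bop_bound bB; exists K^-1; rewrite ?invr_gt0 // => x.
by rewrite ler_pdivrMl //; have := hK (A x); rewrite -[B (A x)]/((B \o A) x) BA.
Qed.

Lemma lbd_bounded_below A d x : lbd A d -> d * nn x <= nn (A x).
Proof.
have [->|x0] := eqVneq x 0; first by rewrite nn0 mulr0 nn_ge0.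
move=> h; have := h x; rewrite -nn_sqr => h1; have h2 := ri_le (A x) x.
by rewrite -(ler_pM2r (nn_gt0 x0)); lra.
Qed.

(** Richardson iteration u <- u + (y - A u) / c for the equation A u = y: the residual is multiplied
    by 1 - A / c, a positive operator of norm at most 1 - d / c. *)
Lemma lbd_invertible A d : sa A -> 0 < d -> lbd A d ->
  exists B, [/\ sa B, forall x, A (B x) = x & forall x, B (A x) = x].
Proof.
move=> sA d0 hd; have [bA symA] := sA.
have bb x := @lbd_bounded_below A d x hd.
have [b b0 [hb _]] := sa_bound sA.
(* c >= b makes 1 - A / c positive, and c >= d makes the contraction factor 1 - d / c
   nonnegative. *)
pose c := b + d; have c0 : 0 < c by rewrite addr_gt0.
have sur y : exists u, A u = y.
  pose f := fun u => u + (c^-1)%:C *: (y - A u).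
  pose u := fun k => iter k f 0.
  pose v := fun k => y - A (u k).
  pose D := fun x => x - (c^-1)%:C *: A x.
  have vS k : v k.+1 = D (v k).
    by rewrite /v /u /= /f -/(u k) /D bopD // bopZ // opprD addrA.
  pose q := 1 - d / c.
  have q0 : 0 <= q by rewrite /q subr_ge0 ler_pdivrMr // mul1r /c lerDr ltW.
  have q1 : q < 1 by rewrite /q ltrBlDr ltrDl divr_gt0.
  have sD : sa D by apply: sa_sub; [exact: sa_id | exact: sa_scale].
  have Dq x : nn (D x) <= q * nn x.
    apply: pos_nn => // z; rewrite /D !riE.
      have ci : 0 < c^-1 by rewrite invr_gt0.
      have h1 : c^-1 * ri (A z) z <= c^-1 * (b * ri z z) by rewrite ler_pM2l.
      have h2 : c^-1 * (b * ri z z) + c^-1 * (d * ri z z) = ri z z.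
        by rewrite -mulrDr -mulrDl mulrA mulVf ?mul1r // gt_eqF.
      have h3 : 0 <= c^-1 * (d * ri z z) by rewrite !mulr_ge0 ?ri_ge0 ?ltW.
      by lra.
    rewrite /q mulrBl mul1r lerB // mulrC mulrA mulrC (mulrC _ d).
    by rewrite ler_pM2l ?invr_gt0.
  have vq k : nn (v k) <= q ^+ k * nn (v 0).
    elim: k => [|k IH]; first by rewrite expr0 mul1r.
    by rewrite vS (le_trans (Dq _)) // exprS -mulrA ler_wpM2l.
  have vlim : seqlim v 0.
    move=> e e0; have v1 : 0 < nn (v 0) + 1 by have := nn_ge0 (v 0); lra.
    have [N hN] := @expr_small q (e / (nn (v 0) + 1)) ltac:(by rewrite q0 q1) (divr_gt0 e0 v1).
    exists N => k /hN; rewrite ler_pdivlMr // subr0 => h.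
    by rewrite (le_trans (vq k)) //; have := exprn_ge0 k q0; nra.
  have [l hl] : exists l, seqlim u l.
    apply: cauchy_seqlim => e e0; have [N hN] := vlim (e * d / 2) ltac:(by rewrite divr_gt0 ?mulr_gt0).
    exists N => i j /hN hi /hN hj; rewrite -(ler_pM2l d0) (le_trans (bb _)) // bopB //.
    have -> : A (u i) - A (u j) = v j - v i by rewrite /v opprB [RHS]addrC addrA subrK.
    by move: hi hj; rewrite !subr0 => hi hj; rewrite (le_trans (nnB _ _)) //; lra.
  exists l; apply: (seqlim_unique (seqlim_bop bA hl)).
  have := seqlimB (seqlim_cst y) vlim; rewrite subr0.
  by apply: seqlim_eq; exists 0 => k _; rewrite /v opprB addrC subrK.
have [B hB] := choice sur.
have inj x y : A x = A y -> x = y.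
  move=> h; apply/eqP; rewrite -subr_eq0; apply/eqP/nn_eq0/le_anti; rewrite nn_ge0 andbT.
  by rewrite -(ler_pM2l d0) (le_trans (bb _)) // bopB // h subrr nn0 mulr0.
exists B; split=> // [|x]; last by apply: inj; rewrite hB.
split; last by move=> x y; rewrite -{2}(hB x) symA hB.
apply: (@mk_bop _ _ _ d^-1) => [k x y|x].
  by apply: inj; rewrite (bopD bA) (bopZ bA) !hB.
by rewrite ler_pdivlMl // (le_trans (bb _)) // hB.
Qed.

Lemma spectrum_le A b t : sa A -> ubd A b -> spectrum A t%:C -> t <= b.
Proof.
move=> sA hb; rewrite leNgt => st; apply/negP => bt; apply: st.
have s1 : sa (fun x => t%:C *: x - A x) by apply: sa_sub => //; exact: sa_scalar.
have [|z|B [[bB _] h1 h2]] := @lbd_invertible _ (t - b) s1; rewrite ?subr_gt0 //.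
  by rewrite !riE; have := hb z; nra.
exists (fun x => - B x); first by have := bop_scale (-1) bB; under eq_fun do rewrite scaleN1r.
split; apply/funext => x /=; last by rewrite -(bopN bB) opprB h2.
by rewrite (bopN (proj1 sA)) scalerN opprK addrC h1.
Qed.

Lemma spectrum_ge A a t : sa A -> lbd A a -> spectrum A t%:C -> a <= t.
Proof.
move=> sA hb; rewrite leNgt => st; apply/negP => bt; apply: st.
have s1 : sa (fun x => A x - t%:C *: x) by apply: sa_sub => //; exact: sa_scalar.
have [|z|B [[bB _] h1 h2]] := @lbd_invertible _ (a - t) s1; rewrite ?subr_gt0 //.
  by rewrite !riE; have := hb z; nra.
by exists B => //; split; apply/funext => x /=.
Qed.

Section CPoly.
Variable A : op H.
Hypothesis bA : bounded_op A.
Implicit Types P Q : {poly R[i]}.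

(** Complex coefficients allow the factorization into linear factors, where nonreal roots may
    occur. *)
Definition cpoly_op P : op H := fun x => \sum_(i < size P) P`_i *: iter i A x.

Lemma cpoly_opE n P x : (size P <= n)%N ->
  cpoly_op P x = \sum_(i < n) P`_i *: iter i A x.
Proof.
move=> le_n; rewrite /cpoly_op (big_ord_widen _ (fun i => P`_i *: iter i A x) le_n).
rewrite big_mkcond; apply: eq_bigr => i _; case: ltnP => // h.
by rewrite nth_default // scale0r.
Qed.

Lemma cpoly_opD P Q x : cpoly_op (P + Q) x = cpoly_op P x + cpoly_op Q x.
Proof.
have h := size_polyD P Q.
rewrite (cpoly_opE x h) (@cpoly_opE (maxn (size P) (size Q)) P) ?leq_maxl //.
rewrite (@cpoly_opE (maxn (size P) (size Q)) Q) ?leq_maxr // -big_split.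
by apply: eq_bigr => i _; rewrite coefD scalerDl.
Qed.

Lemma cpoly_opZ (k : R[i]) P x : cpoly_op (k *: P) x = k *: cpoly_op P x.
Proof.
rewrite (cpoly_opE x (size_scale_leq k P)) /cpoly_op scaler_sumr.
by apply: eq_bigr => i _; rewrite coefZ scalerA.
Qed.

Lemma cpoly_opC (k : R[i]) x : cpoly_op k%:P x = k *: x.
Proof. by rewrite (cpoly_opE x (size_polyC_leq1 k)) big_ord1 coefC. Qed.

Lemma cpoly_opMX P x : cpoly_op (P * 'X) x = cpoly_op P (A x).
Proof.
rewrite (@cpoly_opE (size P).+1) ?size_polyMXn_leq //; last first.
  by have := size_polyMleq P 'X; rewrite size_polyX addn2.
rewrite big_ord_recl coefMX /= scale0r add0r; apply: eq_bigr => i _.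
by rewrite coefMX /= /bump /= -iterSr.
Qed.

Lemma bop_cpoly P : bounded_op (cpoly_op P).
Proof.
elim/poly_ind: P => [|P k IH].
  have -> : cpoly_op 0 = (fun x => 0 *: x).
    by apply/funext => x; rewrite -[0]polyC0 cpoly_opC.
  exact: (bop_scale _ (@bop_id R H)).
have -> : cpoly_op (P * 'X + k%:P) = (fun x => cpoly_op P (A x) + k *: x).
  by apply/funext => x; rewrite cpoly_opD cpoly_opMX cpoly_opC.
by apply: bop_add; [exact: (bop_comp IH bA) | exact: (bop_scale _ (@bop_id R H))].
Qed.

Lemma cpoly_opM P Q x : cpoly_op (P * Q) x = cpoly_op P (cpoly_op Q x).
Proof.
elim/poly_ind: Q x => [|Q k IH] x.
  by rewrite mulr0 -[0]polyC0 !cpoly_opC !scale0r (bop0 (bop_cpoly P)).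
rewrite mulrDr cpoly_opD mulrA cpoly_opMX IH cpoly_opD cpoly_opMX cpoly_opC.
rewrite (bopD (bop_cpoly P)); congr (_ + _).
by rewrite mulrC mul_polyC cpoly_opZ (bopZ (bop_cpoly P)).
Qed.

Lemma bounded_below_cpoly (k : R[i]) (s : seq R[i]) : k != 0 ->
  (forall z : R[i], z \in s -> bounded_below (fun x => A x - z *: x)) ->
  bounded_below (cpoly_op (k *: \prod_(z <- s) ('X - z%:P))).
Proof.
move=> k0; elim: s => [|z s IH] h.
  exists (complex.Re `|k|) => [|x]; last by rewrite big_nil cpoly_opZ -[1]polyC1 cpoly_opC scale1r nnZc.
  by have := k0; rewrite -normr_gt0 ltcE => /andP[].
have -> : cpoly_op (k *: \prod_(z <- z :: s) ('X - z%:P)) =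
    (fun x => A x - z *: x) \o cpoly_op (k *: \prod_(z <- s) ('X - z%:P)).
  apply/funext => x; rewrite big_cons scalerAr cpoly_opM /=.
  set y := cpoly_op _ x; rewrite cpoly_opD -[X in cpoly_op X _]mul1r cpoly_opMX.
  by rewrite -[1]polyC1 -polyCN !cpoly_opC scale1r scaleNr.
apply: bounded_below_comp; first by apply: h; rewrite mem_head.
by apply: IH => w ws; apply: h; rewrite inE ws orbT.
Qed.

End CPoly.

Lemma poly_opE p A : poly_op p A = cpoly_op A (map_poly (real_complex R) p).
Proof.
apply/funext => x; rewrite /poly_op /cpoly_op size_map_poly.
by apply: eq_bigr => i _; rewrite coef_map.
Qed.

Lemma poly_opD p q A x : poly_op (p + q) A x = poly_op p A x + poly_op q A x.
Proof. by rewrite !poly_opE rmorphD cpoly_opD. Qed.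

Lemma poly_opZ a p A x : poly_op (a *: p) A x = a%:C *: poly_op p A x.
Proof. by rewrite !poly_opE map_polyZ cpoly_opZ. Qed.

Lemma poly_opN p A x : poly_op (- p) A x = - poly_op p A x.
Proof. by rewrite -scaleN1r poly_opZ rmorphN scaleN1r. Qed.

Lemma poly_opC a A x : poly_op a%:P A x = a%:C *: x.
Proof. by rewrite !poly_opE map_polyC cpoly_opC. Qed.

Lemma poly_opMX p A x : poly_op (p * 'X) A x = poly_op p A (A x).
Proof. by rewrite !poly_opE rmorphM /= map_polyX cpoly_opMX. Qed.

Lemma poly_opX A x : poly_op 'X A x = A x.
Proof. by rewrite -['X]mul1r poly_opMX -[1]polyC1 poly_opC scale1r. Qed.

Lemma bop_poly p A : bounded_op A -> bounded_op (poly_op p A).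
Proof. by move=> bA; rewrite poly_opE; apply: bop_cpoly. Qed.

Lemma poly_opM p q A x : bounded_op A ->
  poly_op (p * q) A x = poly_op p A (poly_op q A x).
Proof. by move=> bA; rewrite !poly_opE rmorphM cpoly_opM. Qed.

Lemma poly_op_comm p A B : bounded_op A -> bounded_op B ->
  (forall x, A (B x) = B (A x)) -> forall x, poly_op p A (B x) = B (poly_op p A x).
Proof.
move=> bA bB h; elim/poly_ind: p => [|p k IH] x.
  by rewrite -[0]polyC0 !poly_opC (bopZ bB).
by rewrite !poly_opD !poly_opMX !poly_opC (bopD bB) (bopZ bB) -IH h.
Qed.

Lemma sa_poly p A : sa A -> sa (poly_op p A).
Proof.
move=> [bA sA]; split; first exact: bop_poly.
elim/poly_ind: p => [|p k IH] x y.
  by rewrite -[0]polyC0 !poly_opC !riE.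
rewrite !poly_opD !poly_opMX !poly_opC !riE IH sA; congr (ri x _ + _).
by rewrite (poly_op_comm _ bA bA).
Qed.

(** With z = a + i b and A self-adjoint, A x - a x and i b x are orthogonal for [ri], so |A x - z
    x|^2 >= b^2 |x|^2. *)
Lemma bounded_below_nonreal A (z : R[i]) : sa A -> complex.Im z != 0 ->
  bounded_below (fun x => A x - z *: x).
Proof.
case: z => a b /= [bA sA] b0; exists `|b|; first by rewrite normr_gt0.
move=> x; rewrite -ler_sqr ?nnegrE ?mulr_ge0 ?nn_ge0 ?normr_ge0 //.
rewrite exprMn !nn_sqr real_normK ?num_real //.
have -> : (a +i* b) *: x = a%:C *: x + b%:C *: ('i *: x).
  rewrite scalerA -scalerDl; congr (_ *: _); apply/eqP.
  by rewrite eq_complex /= !(mul0r, mulr0, mulr1, subr0, addr0, add0r) !eqxx.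
have h y : ri (A y) ('i *: y) = 0.
  have := inner_Im' (A y) y; rewrite inner_Im.
  by rewrite -(bopZ bA) (sA ('i *: y) y) (riC ('i *: y)); lra.
have hx : ri x ('i *: x) = 0.
  by have := inner_Im' x x; rewrite inner_Im (riC _ x); lra.
have hi : ri ('i *: x) ('i *: x) = ri x x.
  by rewrite -inner_Im inner_Im' scalerA -expr2 sqr_i scaleN1r riNl opprK.
have h' : ri ('i *: x) (A x) = 0 by rewrite riC h.
have hx' : ri ('i *: x) x = 0 by rewrite riC hx.
have := ri_ge0 (A x - a%:C *: x); rewrite !riE h h' hx hx' hi.
by lra.
Qed.

Lemma opnorm_set A : bounded_op A ->
  has_sup [set t : R | exists2 x : H, `|x| <= 1 & `|A x| = t%:C].
Proof.
move=> bA; have [K K0 hK] := bop_bound bA; split.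
  by exists 0; exists 0; rewrite ?normr0 ?ler01 // bop0 // normr0.
exists K => t [x]; rewrite !normE => x1 -[<-]; rewrite (le_trans (hK _)) //.
by rewrite -[leRHS]mulr1 ler_pM2l // -lecR.
Qed.

Lemma opnorm_ge A x : bounded_op A -> nn (A x) <= opnorm A * nn x.
Proof.
move=> bA; have [->|x0] := eqVneq x 0; first by rewrite bop0 // nn0 mulr0.
rewrite -ler_pdivrMr ?nn_gt0 //; apply: sup_upper_bound; first exact: opnorm_set.
exists ((nn x)^-1%:C *: x).
  by rewrite normE nnZ ger0_norm ?invr_ge0 ?nn_ge0 // mulVf // gt_eqF // nn_gt0.
by rewrite bopZ // normE nnZ ger0_norm ?invr_ge0 ?nn_ge0 // mulrC.
Qed.

Lemma opnorm_ge0 A : bounded_op A -> 0 <= opnorm A.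
Proof.
move=> bA; apply: sup_upper_bound; first exact: opnorm_set.
by exists 0; rewrite ?normr0 ?ler01 // bop0 // normr0.
Qed.

Lemma opnorm_le A c : bounded_op A -> (forall x, nn (A x) <= c * nn x) -> 0 <= c ->
  opnorm A <= c.
Proof.
move=> bA h c0; apply: ge_sup; first by case: (opnorm_set bA).
move=> t [x]; rewrite !normE => x1 -[<-]; rewrite (le_trans (h _)) //.
by rewrite -[leRHS]mulr1 ler_wpM2l // -lecR.
Qed.

(** Vectors that nearly attain the norm N of B are approximate eigenvectors of B^2 at N^2: for |x|
    <= 1, |B^2 x - N^2 x|^2 <= N^2 (N^2 - |B x|^2). *)
Lemma opnorm_not_bounded_below B x0 : x0 != 0 -> sa B ->
  ~ bounded_below (fun x => B (B x) - (opnorm B ^+ 2)%:C *: x).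
Proof.
move=> x0n [bB sB] [d d0 hd]; set N := opnorm B in hd.
have N0 : 0 <= N := opnorm_ge0 bB.
have hB x : nn (B x) <= N * nn x := opnorm_ge x bB.
have [NE|Nn] := eqVneq N 0.
  have Bz x : B x = 0 by apply: nn_eq0; apply/le_anti; rewrite nn_ge0 (le_trans (hB x)) // NE mul0r.
  have := hd x0; rewrite !Bz NE expr0n scale0r subrr nn0.
  by rewrite leNgt mulr_gt0 // nn_gt0.
have Np : 0 < N by rewrite lt_def Nn.
(* The first bound forces |x| >= 1/2, the second makes 2 N^3 e smaller than d^2 / 4. *)
pose e := Num.min (N / 2) (d ^+ 2 / (16 * N ^+ 3)).
have e0 : 0 < e by rewrite lt_min !divr_gt0 ?exprn_gt0 ?mulr_gt0 ?exprn_gt0.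
have e1 : e <= N / 2 by rewrite ge_min lexx.
have e2 : e * (16 * N ^+ 3) <= d ^+ 2.
  by rewrite -ler_pdivlMr ?mulr_gt0 ?exprn_gt0 // ge_min lexx orbT.
have [t [x x1 hxe] hx] := sup_adherent e0 (opnorm_set bB).
move: x1 hxe hx; rewrite -/(opnorm B) -/N !normE => x1 [<-] hx.
move: x1; rewrite -[1]/(1%:C) lecR => x1.
have hBx := hB x; have xN : (1 / 2) <= nn x.
  by rewrite -(ler_pM2l Np); lra.
have n0 := nn_ge0 (B x).
have h1 : nn (B (B x) - (N ^+ 2)%:C *: x) ^+ 2 <= N ^+ 2 * (N ^+ 2 - nn (B x) ^+ 2).
  have h2 : nn (B (B x)) ^+ 2 <= N ^+ 2 * nn (B x) ^+ 2.
    by rewrite -exprMn ler_sqr ?nnegrE ?mulr_ge0 ?nn_ge0 // hB.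
  move: h2; rewrite !nn_sqr !riE (riC x) (sB (B x) x).
  have : ri x x <= 1 by rewrite -nn_sqr expr_le1 // nn_ge0.
  have N4 : 0 <= N ^+ 2 * N ^+ 2 by rewrite mulr_ge0 ?exprn_ge0.
  by move=> xx; nra.
have h3 : (d * nn x) ^+ 2 <= nn (B (B x) - (N ^+ 2)%:C *: x) ^+ 2.
  by rewrite ler_sqr ?nnegrE ?mulr_ge0 ?nn_ge0 ?(ltW d0) // hd.
have h4 : d ^+ 2 / 4 <= (d * nn x) ^+ 2.
  rewrite exprMn ler_pM2l ?exprn_gt0 //; nra.
have h5 : N ^+ 2 * (N ^+ 2 - nn (B x) ^+ 2) <= N ^+ 2 * (2 * N * e).
  by rewrite ler_pM2l ?exprn_gt0 //; nra.
have : 0 < d ^+ 2 by rewrite exprn_gt0.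
have e3 : N ^+ 2 * (2 * N * e) = (e * (16 * N ^+ 3)) / 8 by field.
by lra.
Qed.

Lemma spectrum_root q A : q != 0 -> sa A -> ~ bounded_below (poly_op q A) ->
  exists2 t : R, spectrum A t%:C & q.[t] = 0.
Proof.
move=> q0 sA; have [bA _] := sA; rewrite poly_opE.
set Q := map_poly _ q; have Q0 : Q != 0 by rewrite map_poly_eq0.
have [r Qr] := closed_field_poly_normal Q; rewrite Qr => nbb.
have [z zr nz] : exists2 z : R[i], z \in r & ~ bounded_below (fun x => A x - z *: x).
  apply: contrapT => h; apply: nbb; apply: bounded_below_cpoly => //.
    by rewrite lead_coef_eq0.
  by move=> z zr; apply: contrapT => nz; apply: h; exists z.
have zE : z = (complex.Re z)%:C.
  apply/eqP; rewrite eq_complex /= eqxx /=; apply: contrapT => /negP iz.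
  by apply: nz; apply: bounded_below_nonreal.
exists (complex.Re z).
  by rewrite -zE => /invertible_bounded_below.
have : root Q z by rewrite Qr rootZ ?lead_coef_eq0 // root_prod_XsubC.
rewrite /root zE horner_map fmorph_eq0 => /eqP; by [].
Qed.

(* With N the norm of p(A), the operator p(A)^2 - N^2 is not bounded below, so
   neither is some factor A - z of it; such a z is real, lies in the spectrum
   and satisfies p(z)^2 = N^2. *)
Lemma poly_op_bound p A e : sa A -> 0 <= e ->
  (forall t : R, spectrum A t%:C -> `|p.[t]| <= e) ->
  forall x, nn (poly_op p A x) <= e * nn x.
Proof.
move=> sA e0 hp x; have [->|x0] := eqVneq x 0.
  by rewrite nn0 mulr0 bop0 ?nn0 //; apply: bop_poly; case: sA.
have key q : exists2 t : R, spectrum A t%:C & q.[t] ^+ 2 = opnorm (poly_op q A) ^+ 2.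
  have nbb q' : ~ bounded_below (poly_op (q' ^+ 2 - (opnorm (poly_op q' A) ^+ 2)%:P) A).
    move=> h; apply: (opnorm_not_bounded_below x0 (sa_poly q' sA)).
    move: h; congr bounded_below; apply/funext => y.
    by rewrite poly_opD poly_opN poly_opC (expr2 q') poly_opM //; case: sA.
  (* Prepares the case where q^2 - N^2 is the zero polynomial: every spectral point then satisfies
     the equation, and ['X] provides one, because X^2 minus a constant is never zero. *)
  have [t st] : exists2 t : R, spectrum A t%:C & q.[t] ^+ 2 = opnorm (poly_op q A) ^+ 2 \/ True.
    have [|t st _] := spectrum_root _ sA (nbb 'X); last by exists t => //; right.
    rewrite subr_eq0; apply/eqP => /(congr1 (size : {poly R} -> nat)).
    by rewrite size_polyXn; move: (size_polyC_leq1 (opnorm (poly_op 'X A) ^+ 2)) => + h; rewrite -h.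
  have [/eqP q0 _|q0 _] := eqVneq (q ^+ 2 - (opnorm (poly_op q A) ^+ 2)%:P) 0.
    exists t => //; move: q0; rewrite subr_eq0 => /eqP /(congr1 (horner^~ t)).
    by rewrite hornerC horner_exp.
  have [s ss] := spectrum_root q0 sA (nbb q).
  by rewrite !hornerE => /eqP; rewrite subr_eq0 => /eqP hs; exists s.
have bp := bop_poly p (proj1 sA).
have [t st /eqP] := key p; rewrite eqf_sqr => ht.
apply: le_trans (opnorm_ge x bp) _; rewrite ler_wpM2r ?nn_ge0 //.
apply: le_trans (hp t st).
by case/orP: ht => /eqP ->; rewrite ?normrN ler_norm.
Qed.

(** With an empty spectrum, [poly_op_bound] with bound 0 would make the identity, the value of the
    polynomial 1, vanish. *)
Lemma spectrum_nonempty A : sa A -> (exists x : H, x != 0) -> exists t : R, spectrum A t%:C.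
Proof.
move=> sA [x x0]; apply: contrapT => h.
have := @poly_op_bound 1 A 0 sA (lexx 0) _ x; rewrite mul0r -[1]polyC1 poly_opC scale1r.
move=> /(_ (fun t st => False_ind _ (h (ex_intro _ t st)))) h0.
by move/negP: x0; apply; apply/eqP/nn_eq0/le_anti; rewrite nn_ge0 h0.
Qed.

End Spectrum.

(** * Bernstein polynomials *)

Section Bernstein.
Variable R : realType.
Implicit Types (a b e L x t : R) (f : R -> R) (phi psi : nat -> R) (p : {poly R}).

(* The value at x is the expectation of phi at a binomial(n, x) variable, so
   bernstein n (fun k => f (k / n)) is the n-th Bernstein polynomial of f. *)
Fixpoint bernstein n phi : {poly R} :=
  if n is n'.+1 then
    'X * bernstein n' (fun k => phi k.+1) + (1 - 'X) * bernstein n' phi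
  else (phi 0)%:P.

Lemma bernstein_le n phi psi x : 0 <= x <= 1 -> (forall k, (k <= n)%N -> phi k <= psi k) ->
  (bernstein n phi).[x] <= (bernstein n psi).[x].
Proof.
move=> /andP[x0 x1]; elim: n phi psi => [|n IH] phi psi h /=; first by rewrite !hornerC h.
rewrite !hornerE; apply: lerD; apply: ler_wpM2l; rewrite ?subr_ge0 //; apply: IH => k kn;
  apply: h => //; exact: leqW.
Qed.

(** For k binomial(n, x), the mean of (k - c)^2 is the variance n x (1 - x) plus the squared bias (n
    x - c)^2. *)
Lemma bernstein_quadratic n (a b c : R) x :
  (bernstein n (fun k => a + b * (k%:R - c) ^+ 2)).[x] =
  a + b * (n%:R * x * (1 - x) + (n%:R * x - c) ^+ 2).
Proof.
elim: n c => [|n IH] c /=; first by rewrite hornerC !mul0r; ring.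
have -> : (fun k => a + b * (k.+1%:R - c) ^+ 2) = (fun k => a + b * (k%:R - (c - 1)) ^+ 2).
  by apply/funext => k; rewrite -natr1; ring.
by rewrite !hornerE !IH -natr1; ring.
Qed.

Definition approx_on a b f := forall e, 0 < e ->
  exists p, forall t, a <= t <= b -> `|p.[t] - f t| <= e.

Definition lipschitz_on a b L f := forall s t, a <= s <= b -> a <= t <= b ->
  `|f s - f t| <= L * `|s - t|.

(** Chebyshev's argument: |u| <= d + u^2 / d replaces the Lipschitz bound by a quadratic function of
    k, whose Bernstein polynomial is known exactly. The choice n >= d^-2 makes both resulting terms
    at most L d. *)
Lemma lipschitz_approx01 L f : 0 <= L -> lipschitz_on 0 1 L f -> approx_on 0 1 f.
Proof.
move=> L0 hf e e0.
pose d := e / (2 * (L + 1)); have d0 : 0 < d by rewrite divr_gt0 // mulr_gt0 //; lra.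
pose n := (Num.truncn (d ^- 2)).+1; have nd : d ^- 2 <= n%:R.
  by rewrite ltW // truncnS_gt.
have n0 : 0 < n%:R :> R by rewrite ltr0n.
exists (bernstein n (fun k => f (k%:R / n%:R))) => t t01.
have [t0 t1] := andP t01.
pose B := L / (n%:R ^+ 2 * d).
have B0 : 0 <= B by rewrite /B divr_ge0 // mulr_ge0 ?exprn_ge0 ?ltW.
have key k : (k <= n)%N -> `|f (k%:R / n%:R) - f t| <= L * d + B * (k%:R - n%:R * t) ^+ 2.
  move=> kn; have h : 0 <= (k%:R : R) / n%:R <= 1.
    by rewrite divr_ge0 ?ler0n //= ler_pdivrMr // mul1r ler_nat.
  apply: le_trans (hf _ _ h t01) _.
  have -> : L * d + B * (k%:R - n%:R * t) ^+ 2 = L * (d + (k%:R / n%:R - t) ^+ 2 / d).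
    by rewrite /B; field; rewrite ?gt_eqF.
  apply: ler_wpM2l => //; rewrite -(ler_pM2r d0) mulrDl mulfVK ?gt_eqF //.
  set u := _ - t; rewrite -[u ^+ 2]real_normK ?num_real //; have := normr_ge0 u; nra.
have var : L * d + B * (n%:R * t * (1 - t) + (n%:R * t - n%:R * t) ^+ 2) <= e.
  have -> : L * d + B * (n%:R * t * (1 - t) + (n%:R * t - n%:R * t) ^+ 2) =
     L * (d + (t * (1 - t)) / (n%:R * d)) by rewrite /B; field; rewrite ?gt_eqF.
  have h : (t * (1 - t)) / (n%:R * d) <= d.
    rewrite ler_pdivrMr; last exact: mulr_gt0.
    have : 1 <= d * (n%:R * d).
      have : d ^- 2 * d ^+ 2 <= n%:R * d ^+ 2 by rewrite ler_pM2r ?exprn_gt0.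
      by rewrite mulVf ?expf_neq0 ?gt_eqF //; lra.
    nra.
  have : (L + 1) * (2 * d) = e by rewrite /d; field; lra.
  have := ler_wpM2l L0 h; rewrite [L * (_ + _)]mulrDr mulrDl mul1r.
  by move: (L * (_ / _)) => w; lra.
have up : (bernstein n (fun k => f (k%:R / n%:R))).[t] <=
    (bernstein n (fun k => (f t + L * d) + B * (k%:R - n%:R * t) ^+ 2)).[t].
  by apply: bernstein_le => // k /key; rewrite ler_norml => /andP[_]; lra.
have lo : (bernstein n (fun k => (f t - L * d) + (- B) * (k%:R - n%:R * t) ^+ 2)).[t] <=
   (bernstein n (fun k => f (k%:R / n%:R))).[t].
  by apply: bernstein_le => // k /key; rewrite ler_norml => /andP[]; lra.
rewrite !bernstein_quadratic in up lo.
by rewrite ler_norml; apply/andP; split; lra.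
Qed.

Lemma lipschitz_approx a b L f : a < b -> 0 <= L -> lipschitz_on a b L f ->
  approx_on a b f.
Proof.
move=> ab L0 hf e e0; have ba : 0 < b - a by rewrite subr_gt0.
have sc s : 0 <= s <= 1 -> a <= a + (b - a) * s <= b.
  by move=> /andP[s0 s1]; apply/andP; split; nra.
have hg : lipschitz_on 0 1 (L * (b - a)) (fun s => f (a + (b - a) * s)).
  move=> s t hs ht; apply: le_trans (hf _ _ (sc _ hs) (sc _ ht)) _.
  have -> : a + (b - a) * s - (a + (b - a) * t) = (b - a) * (s - t) by ring.
  by rewrite normrM (gtr0_norm ba) mulrA.
have [q hq] := lipschitz_approx01 (mulr_ge0 L0 (ltW ba)) hg e0.
exists (q \Po ((b - a)^-1 *: ('X - a%:P))) => t /andP[ta tb].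
rewrite horner_comp !hornerE.
have := hq ((b - a)^-1 * (t - a)).
have -> : a + (b - a) * ((b - a)^-1 * (t - a)) = t by field; rewrite gt_eqF.
apply; rewrite mulr_ge0 ?invr_ge0 ?(ltW ba) ?subr_ge0 //=.
by rewrite ler_pdivrMl // mulr1; lra.
Qed.

Lemma poly_bounded p a b : exists M : R, forall t, a <= t <= b -> `|p.[t]| <= M.
Proof.
elim/poly_ind: p => [|p c [M hM]]; first by exists 0 => t _; rewrite horner0 normr0.
exists (`|M| * (`|a| + `|b|) + `|c|) => t tab; rewrite !hornerE.
apply: le_trans (ler_normD _ _) _; rewrite lerD2r normrM ler_pM //.
  by rewrite (le_trans (hM t tab)) // ler_norm.
have /andP[ta tb] := tab; rewrite ler_norml.
have := ler_norm a; have := ler_norm (- a); have := ler_norm b; have := ler_norm (- b).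
by rewrite !normrN => *; apply/andP; split; have := normr_ge0 a; have := normr_ge0 b; lra.
Qed.

End Bernstein.

(** * Continuous functional calculus *)

Section FunctionalCalculus.
Variables (R : realType) (H : hilbert R).
Implicit Types (x y z : H) (a b c d e t : R) (A B C S T : op H) (p q : {poly R}) (f g : R -> R).

Lemma is_funcalcP f A B : bounded_op A -> is_funcalc f A B <->
  bounded_op B /\ forall e, 0 < e -> exists2 p,
    (forall t, spectrum A t%:C -> `|p.[t] - f t| <= e) &
    forall x, nn (poly_op p A x - B x) <= e * nn x.
Proof.
move=> bA; split=> -[bB h]; split=> // e e0; have [p h1 h2] := h e e0; exists p => //.
  move=> x; have bp := bop_sub (bop_poly p bA) bB.
  by apply: le_trans (opnorm_ge x bp) _; rewrite ler_wpM2r ?nn_ge0.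
by apply: opnorm_le (ltW e0) => //; exact: bop_sub (bop_poly p bA) bB.
Qed.

Section Fixed.
Variable A : op H.
Hypothesis sA : sa A.
Let bA : bounded_op A := proj1 sA.

Lemma spectrum_bound : exists2 K : R, 0 < K & forall t, spectrum A t%:C -> `|t| <= K.
Proof.
have [c c0 [h1 h2]] := sa_bound sA; exists c => // t st.
by rewrite ler_norml (spectrum_le sA h1 st) (spectrum_ge sA h2 st).
Qed.

Lemma funcalc_poly p : is_funcalc (horner p) A (poly_op p A).
Proof.
apply/(is_funcalcP _ _ bA); split; first exact: bop_poly.
move=> e e0; exists p => [t _|x]; first by rewrite subrr normr0 ltW.
by rewrite subrr nn0 mulr_ge0 ?nn_ge0 ?ltW.
Qed.

Lemma funcalc_ext f g B : (forall t, spectrum A t%:C -> f t = g t) ->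
  is_funcalc f A B -> is_funcalc g A B.
Proof.
move=> fg [bB h]; split=> // e /h[p h1 h2]; exists p => // t st.
by rewrite -fg // h1.
Qed.

Lemma funcalc_add f g B C : is_funcalc f A B -> is_funcalc g A C ->
  is_funcalc (fun t => f t + g t) A (fun x => B x + C x).
Proof.
move=> /(is_funcalcP _ _ bA)[bB hB] /(is_funcalcP _ _ bA)[bC hC].
apply/(is_funcalcP _ _ bA); split; first exact: bop_add.
move=> e e0; have e2 : 0 < e / 2 by lra.
have [p p1 p2] := hB _ e2; have [q q1 q2] := hC _ e2; exists (p + q) => [t st|x].
  rewrite hornerD opprD addrACA; apply: le_trans (ler_normD _ _) _.
  by have := p1 t st; have := q1 t st; lra.
rewrite poly_opD opprD addrACA; apply: le_trans (nnD _ _) _.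
by have := p2 x; have := q2 x; lra.
Qed.

Lemma funcalc_scale k f B : is_funcalc f A B ->
  is_funcalc (fun t => k * f t) A (fun x => k%:C *: B x).
Proof.
move=> /(is_funcalcP _ _ bA)[bB hB].
apply/(is_funcalcP _ _ bA); split; first exact: bop_scale.
move=> e e0; have k1 : 0 < `|k| + 1 by rewrite ltr_wpDl.
have [p p1 p2] := hB _ (divr_gt0 e0 k1); exists (k *: p) => [t st|x].
  rewrite hornerZ -mulrBr normrM; have := p1 t st; rewrite ler_pdivlMr //.
  by have := normr_ge0 (p.[t] - f t); lra.
rewrite poly_opZ -scalerBr nnZ; have := p2 x; rewrite mulrAC ler_pdivlMr //.
by have := nn_ge0 (poly_op p A x - B x); lra.
Qed.

Lemma funcalc_sub f g B C : is_funcalc f A B -> is_funcalc g A C ->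
  is_funcalc (fun t => f t - g t) A (fun x => B x - C x).
Proof.
move=> hf hg; have := funcalc_add hf (funcalc_scale (-1) hg).
have -> : (fun x => B x + (-1)%:C *: C x) = (fun x => B x - C x).
  by apply/funext => x; rewrite rmorphN scaleN1r.
by apply: funcalc_ext => t _; rewrite mulN1r.
Qed.

Lemma funcalc_bounded f B : is_funcalc f A B ->
  exists2 M : R, 0 < M & forall t, spectrum A t%:C -> `|f t| <= M.
Proof.
move=> /(is_funcalcP _ _ bA)[bB /(_ 1 ltr01)[p p1 _]].
have [K K0 hK] := spectrum_bound; have [M hM] := poly_bounded p (- K) K.
exists (`|M| + 1) => [|t st]; first by rewrite ltr_wpDl.
have -> : f t = p.[t] - (p.[t] - f t) by rewrite opprB addrCA subrr addr0.
apply: le_trans (ler_normB _ _) _; apply: lerD (p1 t st).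
by apply: le_trans (ler_norm _); apply: hM; rewrite -ler_norml hK.
Qed.

Lemma funcalc_mul f g B C : is_funcalc f A B -> is_funcalc g A C ->
  is_funcalc (fun t => f t * g t) A (fun x => B (C x)).
Proof.
move=> fB gC; have [M M0 hM] := funcalc_bounded fB; have [N N0 hN] := funcalc_bounded gC.
move: fB gC => /(is_funcalcP _ _ bA)[bB hB] /(is_funcalcP _ _ bA)[bC hC].
apply/(is_funcalcP _ _ bA); split; first exact: bop_comp bB bC.
have [K K0 hK] := bop_bound bB; have [L L0 hL] := bop_bound bC.
move=> e e0; pose W := 1 + M + N + K + L.
pose d := Num.min 1 (e / W); have W0 : 0 < W by rewrite /W; lra.
have d0 : 0 < d by rewrite lt_min ltr01 divr_gt0.
have d1 : d <= 1 by rewrite ge_min lexx.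
have dW : d * W <= e by rewrite -ler_pdivlMr // ge_min lexx orbT.
have [p p1 p2] := hB _ d0; have [q q1 q2] := hC _ d0; exists (p * q) => [t st|x].
  have -> : (p * q).[t] - f t * g t = (p.[t] - f t) * (q.[t] - g t) + f t * (q.[t] - g t)
     + (p.[t] - f t) * g t by rewrite hornerM; ring.
  apply: le_trans (ler_normD _ _) _; apply: le_trans (lerD (ler_normD _ _) (lexx _)) _.
  rewrite !normrM; have := p1 t st; have := q1 t st; have := hM t st; have := hN t st.
  have := normr_ge0 (p.[t] - f t); have := normr_ge0 (q.[t] - g t).
  have := normr_ge0 (f t); have := normr_ge0 (g t).
  move: (`|f t|) (`|g t|) (`|_ - _|) (`|_ - _|) => u v w s u0 v0 w0 s0 hu hv hw hs.
  apply: le_trans dW; rewrite /W.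
  have : s * w <= d by nra.
  have : v * w <= N * d by nra.
  have : s * u <= d * M by nra.
  have : 0 <= d * K by nra.
  have : 0 <= d * L by nra.
  by move=> *; nra.
rewrite poly_opM //.
have -> : poly_op p A (poly_op q A x) - B (C x) =
  (poly_op p A (poly_op q A x) - B (poly_op q A x)) + B (poly_op q A x - C x).
  by rewrite bopB // addrA subrK.
apply: le_trans (nnD _ _) _.
have := p2 (poly_op q A x); have := hK (poly_op q A x - C x); have := q2 x; have := hL x.
have : nn (poly_op q A x) <= nn (poly_op q A x - C x) + nn (C x).
  by rewrite -{1}(subrK (C x) (poly_op q A x)) nnD.
have := nn_ge0 x; have := nn_ge0 (C x).
move: (nn (poly_op p A (poly_op q A x) - B (poly_op q A x))) (nn (B (poly_op q A x - C x))).
move: (nn (poly_op q A x - C x)) (nn (poly_op q A x)) (nn (C x)) (nn x).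
move=> u s r n w v r0 n0 hs hr hu hv hw.
have : u <= n * d by nra.
have h1 : K * u <= K * (n * d) by nra.
have h2 : s <= n * (d + L) by nra.
have h3 : d * s <= d * (n * (1 + L)) by apply: ler_wpM2l; nra.
have h4 : n * (d * W) <= n * e by apply: ler_wpM2l.
have : 0 <= n * d by nra.
have : 0 <= n * d * M by rewrite !mulr_ge0 // ltW.
have : 0 <= n * d * N by rewrite !mulr_ge0 // ltW.
by move: h4; rewrite /W; lra.
Qed.

Lemma funcalc_norm f B c : is_funcalc f A B -> 0 <= c ->
  (forall t, spectrum A t%:C -> `|f t| <= c) -> forall x, nn (B x) <= c * nn x.
Proof.
move=> /(is_funcalcP _ _ bA)[bB hB] c0 hc x; apply/ler_addgt0Pr => e e0.
have x1 : 0 < 2 * (nn x + 1) by have := nn_ge0 x; lra.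
have d0 := divr_gt0 e0 x1; move: (e / _) (mulfVK (lt0r_neq0 x1) e) d0 => d de d0.
have [p p1 p2] := hB d d0.
have hp t : spectrum A t%:C -> `|p.[t]| <= c + d.
  move=> st; rewrite -(subrK (f t) p.[t]); apply: le_trans (ler_normD _ _) _.
  by have := p1 t st; have := hc t st; lra.
have cd0 : 0 <= c + d by rewrite addr_ge0 // ltW.
have := poly_op_bound sA cd0 hp x; have := p2 x.
have : nn (B x) <= nn (poly_op p A x) + nn (poly_op p A x - B x).
  have {1}-> : B x = poly_op p A x - (poly_op p A x - B x) by rewrite opprB addrCA subrr addr0.
  exact: nnB.
by have := nn_ge0 x; nra.
Qed.

Lemma funcalc_unique f B C : is_funcalc f A B -> is_funcalc f A C -> B = C.
Proof.
move=> hB hC; apply/funext => x; apply/eqP; rewrite -subr_eq0; apply/eqP/nn_eq0/le_anti.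
rewrite nn_ge0 andbT -(mul0r (nn x)).
by apply: (funcalc_norm (funcalc_sub hB hC)) => // t _; rewrite subrr normr0.
Qed.

Lemma funcalc_comm f B S : is_funcalc f A B -> bounded_op S ->
  (forall x, A (S x) = S (A x)) -> forall x, B (S x) = S (B x).
Proof.
move=> /(is_funcalcP _ _ bA)[bB hB] bS AS x; apply/eqP; rewrite -subr_eq0.
apply/eqP/nn_eq0/le_anti; rewrite nn_ge0 andbT; apply/ler_addgt0Pr => e e0; rewrite add0r.
have [K K0 hK] := bop_bound bS; pose W := 2 * (K * nn x + 1).
have W0 : 0 < W by have := nn_ge0 x; rewrite /W; nra.
have d0 := divr_gt0 e0 W0; move: (e / _) (mulfVK (lt0r_neq0 W0) e) d0 => d de d0.
have [p _ p2] := hB d d0.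
have -> : B (S x) - S (B x) = S (poly_op p A x - B x) - (poly_op p A (S x) - B (S x)).
  by rewrite bopB // (poly_op_comm p bA bS AS) opprB [RHS]addrC addrA subrK.
apply: le_trans (nnB _ _) _; have := hK (poly_op p A x - B x); have := p2 x.
have := p2 (S x); have := hK x; have := nn_ge0 x; rewrite -de /W.
move: (nn (poly_op p A x - B x)) (nn (poly_op p A (S x) - B (S x))) (nn (S x)) => u v w.
move: (nn x) => n n0 h1 h2 h3 h4.
have : K * u <= K * (d * n) by nra.
have : d * w <= d * (K * n) by nra.
by lra.
Qed.

Lemma funcalc_sa f B : is_funcalc f A B -> sa B.
Proof.
move=> /(is_funcalcP _ _ bA)[bB hB]; split=> // x y.
apply/eqP; rewrite -subr_eq0 -normr_eq0 eq_le normr_ge0 andbT.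
apply/ler_addgt0Pr => e e0; rewrite add0r.
pose W := 2 * (nn x * nn y + 1).
have W0 : 0 < W by have := nn_ge0 x; have := nn_ge0 y; rewrite /W; nra.
have d0 := divr_gt0 e0 W0; move: (e / _) (mulfVK (lt0r_neq0 W0) e) d0 => d de d0.
have [p _ p2] := hB d d0; have [_ sp] := sa_poly p sA.
have -> : ri (B x) y - ri x (B y) = ri x (poly_op p A y - B y) - ri (poly_op p A x - B x) y.
  by rewrite !riE sp; ring.
apply: le_trans (ler_normB _ _) _; have := ri_cs x (poly_op p A y - B y).
have := ri_cs (poly_op p A x - B x) y; have := p2 x; have := p2 y.
have := nn_ge0 x; have := nn_ge0 y; rewrite -de /W.
move: (nn (poly_op p A x - B x)) (nn (poly_op p A y - B y)) (nn x) (nn y).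
move=> u v n m m0 n0 h1 h2 h3 h4.
have : u * m <= d * n * m by nra.
have : n * v <= n * (d * m) by nra.
by lra.
Qed.

(** [funcalc_norm] is applied to M - f, where M bounds |f|: from 0 <= M - f <= M - c follows |M x -
    B x| <= (M - c) |x|. If M < c, the spectrum is empty and H is zero. *)
Lemma funcalc_ge f B c : is_funcalc f A B ->
  (forall t, spectrum A t%:C -> c <= f t) -> lbd B c.
Proof.
move=> hB hc x; have [M M0 hM] := funcalc_bounded hB.
have cM : is_funcalc (fun t => M - f t) A (fun x => M%:C *: x - B x).
  apply: funcalc_sub => //; have := funcalc_poly M%:P.
  have -> : poly_op M%:P A = (fun x => M%:C *: x) by apply/funext => y; rewrite poly_opC.
  by apply: funcalc_ext => t _; rewrite hornerC.
have [Mc|Mc] := leP 0 (M - c).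
  have := funcalc_norm cM Mc _ x.
  have h : forall t, spectrum A t%:C -> `|M - f t| <= M - c.
    move=> t st; have := hc t st; have := hM t st; rewrite !ler_norml => /andP[] *.
    by apply/andP; split; lra.
  move=> /(_ h) h1; have := ri_le (M%:C *: x - B x) x.
  have := ler_wpM2r (nn_ge0 x) h1; rewrite -mulrA -expr2 nn_sqr !riE; lra.
have [->|x0] := eqVneq x 0; first by rewrite !riE mulr0.
have [t st] := spectrum_nonempty sA (ex_intro _ x x0).
have := hM t st; have := hc t st; have := ler_norm (f t); lra.
Qed.

Lemma funcalc_le f B c : is_funcalc f A B ->
  (forall t, spectrum A t%:C -> f t <= c) -> ubd B c.
Proof.
move=> hB hc x; have := funcalc_ge (funcalc_scale (-1) hB) (c := - c) _ x.
by rewrite !riE => h; have := h ltac:(by move=> t /hc; lra); lra.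
Qed.

Lemma funcalc_exists a b f : lbd A a -> ubd A b -> approx_on a b f ->
  exists B, is_funcalc f A B.
Proof.
move=> hl hu hf.
pose eps (k : nat) : R := (k.+1%:R)^-1.
have eps0 k : 0 < eps k by rewrite invr_gt0 ltr0n.
have [p hp] := choice (fun k => hf _ (eps0 k)).
have st t : spectrum A t%:C -> a <= t <= b.
  by move=> st; rewrite (spectrum_ge sA hl st) (spectrum_le sA hu st).
have pp i j x : nn (poly_op (p i) A x - poly_op (p j) A x) <= (eps i + eps j) * nn x.
  rewrite -poly_opN -poly_opD; apply: poly_op_bound => //; first by rewrite addr_ge0 // ltW.
  move=> t /st ht; rewrite hornerD hornerN.
  have -> : (p i).[t] - (p j).[t] = ((p i).[t] - f t) - ((p j).[t] - f t) by ring.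
  by apply: le_trans (ler_normB _ _) _; apply: lerD; exact: hp.
have small e : 0 < e -> exists N, forall k, (N <= k)%N -> eps k <= e.
  move=> e0; exists (Num.truncn e^-1) => k Nk; rewrite /eps invf_ple ?posrE ?ltr0n //.
  by rewrite (le_trans (ltW (truncnS_gt _))) // ler_nat.
have ex x : exists l, seqlim (fun k => poly_op (p k) A x) l.
  apply: cauchy_seqlim => e e0.
  have x1 : 0 < 2 * (nn x + 1) by have := nn_ge0 x; lra.
  have d0 := divr_gt0 e0 x1; move: (e / _) (mulfVK (lt0r_neq0 x1) e) d0 => d de d0.
  have [N hN] := small d d0; exists N => i j /hN hi /hN hj.
  by apply: le_trans (pp i j x) _; have := nn_ge0 x; nra.
have [B hB] := choice ex; exists B; apply/(is_funcalcP _ _ bA).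
have lim k x : nn (poly_op (p k) A x - B x) <= eps k * nn x.
  apply/ler_addgt0Pr => e e0.
  have x1 : 0 < 2 * (nn x + 1) by have := nn_ge0 x; lra.
  have d0 := divr_gt0 e0 x1; move: (e / _) (mulfVK (lt0r_neq0 x1) e) d0 => d de d0.
  have [N1 h1] := small d d0; have [N2 h2] := hB x (e / 2) ltac:(lra).
  have {}h1 := h1 _ (leq_maxl N1 N2); have {}h2 := h2 _ (leq_maxr N1 N2).
  rewrite -(subrK (poly_op (p (maxn N1 N2)) A x) (poly_op (p k) A x)) -addrA.
  apply: le_trans (nnD _ _) _; have := pp k (maxn N1 N2) x.
  by have := nn_ge0 x; nra.
split.
  have [K K0 hK] := bop_bound (bop_poly (p 0) bA).
  apply: (@mk_bop _ _ _ (eps 0 + K)) => [k x y|x].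
    apply: seqlim_unique (hB _) _.
    apply: seqlim_eq (seqlimD (seqlimZ k (hB x)) (hB y)); exists 0 => j _.
    have bj := bop_poly (p j) bA.
    by rewrite (bopD bj) (bopZ bj).
  have {1}-> : B x = poly_op (p 0) A x - (poly_op (p 0) A x - B x) by rewrite opprB addrCA subrr addr0.
  by apply: le_trans (nnB _ _) _; rewrite mulrDl addrC; apply: lerD.
move=> e /small[N hN]; have {}hN := hN N (leqnn _); exists (p N) => [t /st ht|x].
  by apply: le_trans (hp _ _ ht) _.
by apply: le_trans (lim _ _) _; rewrite ler_wpM2r ?nn_ge0.
Qed.

Lemma funcalc_spec f B : is_funcalc f A B -> is_funcalc f A (funcalc f A).
Proof. by move=> h; exact: (@xgetPex _ (0 : op H) _ (ex_intro _ B h)). Qed.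

Lemma funcalcE f B : is_funcalc f A B -> funcalc f A = B.
Proof. by move=> h; exact: funcalc_unique (funcalc_spec h) h. Qed.

End Fixed.

Lemma funcalc_poly_comp f A B p : sa A -> is_funcalc f A B ->
  is_funcalc (fun t => p.[f t]) A (poly_op p B).
Proof.
move=> sA hB; elim/poly_ind: p => [|p c IH].
  have -> : poly_op 0 B = poly_op 0 A by apply/funext => x; rewrite -[0]polyC0 !poly_opC.
  by apply: funcalc_ext (funcalc_poly sA 0) => t _; rewrite !horner0.
have -> : poly_op (p * 'X + c%:P) B = (fun x => poly_op p B (B x) + poly_op c%:P A x).
  by apply/funext => x; rewrite poly_opD poly_opMX !poly_opC.
have := funcalc_add sA (funcalc_mul sA IH hB) (funcalc_poly sA c%:P).
by apply: funcalc_ext => t _; rewrite !hornerE.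
Qed.

(** A polynomial q close to g on [a, b] satisfies q(B) = (q o f)(A), which is close to (g o f)(A) =
    C. *)
Lemma funcalc_comp f g A B C a b : sa A -> is_funcalc f A B ->
  is_funcalc (fun t => g (f t)) A C -> approx_on a b g ->
  (forall t, spectrum A t%:C -> a <= f t <= b) -> is_funcalc g B C.
Proof.
move=> sA hB hC hg fab; have sB := funcalc_sa sA hB.
apply/(is_funcalcP _ _ (proj1 sB)); split; first by case: hC.
move=> e e0; have [q hq] := hg e e0; exists q.
  move=> t st; apply: hq; rewrite (spectrum_ge sB _ st) ?(spectrum_le sB _ st) //.
    by apply: (funcalc_le sA hB) => s /fab /andP[].
  by apply: (funcalc_ge sA hB) => s /fab /andP[].
move=> x; have := funcalc_sub sA (funcalc_poly_comp q sA hB) hC.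
move=> /(funcalc_norm sA) /(_ (ltW e0)); apply => t st.
by apply: hq; apply: fab.
Qed.

End FunctionalCalculus.

(** * Real powers *)

Section RealPowers.
Variable R : realType.
Implicit Types (a b s t u v p q : R).

Lemma expR_lip u v M : u <= M -> v <= M -> `|expR u - expR v| <= expR M * `|u - v|.
Proof.
wlog uv : u v / v <= u => [h|] uM vM.
  have [/h|/ltW /h] := leP v u; first exact.
  by rewrite distrC (distrC u); exact.
rewrite !ger0_norm ?subr_ge0 ?ler_expR //.
have -> : expR v = expR u * expR (v - u) by rewrite -expRD addrC subrK.
have h1 := expR_ge1Dx (v - u); have h2 : expR u <= expR M by rewrite ler_expR.
have h3 := expR_gt0 u; move: (expR u) (expR M) (expR _) h1 h2 h3 => x y z *.
have : x * (1 - z) <= x * (u - v) by rewrite ler_pM2l //; lra.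
have : x * (u - v) <= y * (u - v) by rewrite ler_wpM2r //; lra.
by lra.
Qed.

Lemma powR_expR t p : 0 < t -> t `^ p = expR (p * ln t).
Proof. by move=> t0; rewrite /powR gt_eqF. Qed.

Lemma ln_bound a b t : 0 < a -> a <= t <= b -> `|ln t| <= `|ln a| + `|ln b|.
Proof.
move=> a0 /andP[ta tb]; have t0 : 0 < t by lra.
have b0 : 0 < b by lra.
have h1 : ln a <= ln t by rewrite ler_ln ?posrE.
have h2 : ln t <= ln b by rewrite ler_ln ?posrE.
rewrite ler_norml; apply/andP; split.
  by have := ler_norm (- ln a); rewrite normrN; have := normr_ge0 (ln b); lra.
by have := ler_norm (ln b); have := normr_ge0 (ln a); lra.
Qed.

Lemma ln_lip a s t : 0 < a -> a <= s -> a <= t -> `|ln s - ln t| <= a^-1 * `|s - t|.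
Proof.
move=> a0; wlog st : s t / t <= s => [h|] sa ta.
  have [/h|/ltW /h] := leP t s; first exact.
  by rewrite distrC (distrC s); exact.
have s0 : 0 < s by lra. have t0 : 0 < t by lra.
rewrite !ger0_norm ?subr_ge0 ?ler_ln ?posrE // -ln_div ?posrE //.
have -> : s / t = 1 + (s - t) / t by field; rewrite gt_eqF.
apply: le_trans (le_ln1Dx _) _.
  by rewrite (@lt_le_trans _ _ 0) // divr_ge0 ?subr_ge0 // ltW.
rewrite mulrC ler_wpM2r ?subr_ge0 //.
by rewrite lef_pV2 ?posrE.
Qed.

Lemma powR_lipschitz a b p : 0 < a -> exists2 L, 0 <= L &
  lipschitz_on a b L (fun t => t `^ p).
Proof.
move=> a0; pose M := `|p| * (`|ln a| + `|ln b|).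
exists (expR M * (`|p| * a^-1)) => [|s t hs ht].
  by rewrite !mulr_ge0 ?expR_ge0 ?invr_ge0 // ltW.
have [/andP[s1 _] /andP[t1 _]] := (hs, ht).
have s0 : 0 < s by lra. have t0 : 0 < t by lra.
have hM r : a <= r <= b -> p * ln r <= M.
  move=> /(ln_bound a0) h; apply: le_trans (ler_norm _) _; rewrite normrM.
  by rewrite ler_wpM2l.
rewrite !powR_expR //; apply: le_trans (expR_lip (hM _ hs) (hM _ ht)) _.
rewrite -mulrA ler_wpM2l ?expR_ge0 // -mulrBr normrM -mulrA ler_wpM2l //.
exact: ln_lip.
Qed.

Lemma powR_approx a b p : 0 < a -> a < b -> approx_on a b (fun t => t `^ p).
Proof.
by move=> a0 ab; have [L L0 hL] := powR_lipschitz b p a0; apply: lipschitz_approx hL.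
Qed.

Lemma powR_exponent_lip a b p q t : 0 < a -> a <= t <= b -> `|q - p| <= 1 ->
  `|t `^ q - t `^ p| <=
    expR ((`|p| + 1) * (`|ln a| + `|ln b|)) * (`|ln a| + `|ln b|) * `|q - p|.
Proof.
move=> a0 tab qp; set L := `|ln a| + `|ln b|; have hL := ln_bound a0 tab.
have t0 : 0 < t by have /andP[] := tab; lra.
have L0 : 0 <= L by rewrite addr_ge0.
have hr r : `|r - p| <= 1 -> r * ln t <= (`|p| + 1) * L.
  move=> h; apply: le_trans (ler_norm _) _; rewrite normrM ler_pM //.
  by rewrite -(subrK p r); apply: le_trans (ler_normD _ _) _; lra.
rewrite !powR_expR //; apply: le_trans (expR_lip (hr _ qp) (hr p _)) _.
  by rewrite subrr normr0.
rewrite -mulrA ler_wpM2l ?expR_ge0 // -mulrBl normrM mulrC.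
by rewrite ler_wpM2r.
Qed.

End RealPowers.

(** * Powers of positive invertible operators *)

Section OperatorPowers.
Variables (R : realType) (H : hilbert R).
Implicit Types (x y z : H) (a b c d e t p q : R) (A B C S T : op H).

(** Invertibility gives c |x| <= |A x|, and A^2 <= b A then gives c^2 |x|^2 <= b <A x, x>. *)
Lemma posinvP A : posinv_op A <-> sa A /\ exists2 d, 0 < d & lbd A d.
Proof.
split=> [[/positive_opP[sA pA] /invertible_bounded_below [c c0 hc]]|[sA [d d0 hd]]].
  split=> //; have [b b0 [hb _]] := sa_bound sA.
  exists (c ^+ 2 / b) => [|x]; first by rewrite divr_gt0 // exprn_gt0.
  have := pos_nn_sqr x sA pA hb; rewrite mulrAC ler_pdivrMr // [ri _ x * b]mulrC.
  apply: le_trans; rewrite -!nn_sqr -exprMn ler_sqr ?nnegrE ?mulr_ge0 ?nn_ge0 ?(ltW c0) //.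
split.
  by apply/positive_opP; split=> // x; rewrite mul0r (le_trans _ (hd x)) // mulr_ge0 ?ri_ge0 ?ltW.
have [B [[bB _] h1 h2]] := lbd_invertible sA d0 hd.
by exists B => //; split; apply/funext => x /=.
Qed.

Lemma posinv_sa A : posinv_op A -> sa A.
Proof. by move=> /posinvP[]. Qed.

Lemma posinv_bop A : posinv_op A -> bounded_op A.
Proof. by case=> -[]. Qed.

Lemma posinv_interval A : posinv_op A ->
  exists a b, [/\ 0 < a, a < b, lbd A a & ubd A b].
Proof.
move=> /posinvP[sA [d d0 hd]]; have [b b0 [hb _]] := sa_bound sA.
(* Adding d keeps the interval nondegenerate, as polynomial approximation on it requires. *)
exists d, (b + d); split=> //; first by rewrite ltrDr.
by move=> x; apply: le_trans (hb x) _; rewrite ler_wpM2r ?ri_ge0 // lerDl ltW.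
Qed.

Lemma posinv_spectrum A : posinv_op A -> exists a b,
  [/\ 0 < a, a < b & forall t, spectrum A t%:C -> a <= t <= b].
Proof.
move=> pA; have [a [b [a0 ab ha hb]]] := posinv_interval pA; exists a, b; split=> // t st.
by rewrite (spectrum_ge (posinv_sa pA) ha st) (spectrum_le (posinv_sa pA) hb st).
Qed.

Lemma posinv_spectrum_gt0 A t : posinv_op A -> spectrum A t%:C -> 0 < t.
Proof.
move=> pA st; have [a [b [a0 _ h]]] := posinv_spectrum pA.
by have /andP[] := h t st; lra.
Qed.

Section Power.
Variable A : op H.
Hypothesis pA : posinv_op A.
Let sA : sa A := posinv_sa pA.

Lemma power_spec p : is_funcalc (fun t => t `^ p) A (power_op A p).
Proof.
have [a [b [a0 ab ha hb]]] := posinv_interval pA.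
have [B hB] := funcalc_exists sA ha hb (powR_approx p a0 ab).
exact: funcalc_spec hB.
Qed.

Lemma power_sa p : sa (power_op A p).
Proof. exact: (funcalc_sa sA (power_spec p)). Qed.

Lemma power_bop p : bounded_op (power_op A p).
Proof. by case: (power_sa p). Qed.

Lemma power_posinv p : posinv_op (power_op A p).
Proof.
apply/posinvP; split; first exact: power_sa.
have [a [b [a0 ab h]]] := posinv_spectrum pA.
pose L := `|p| * (`|ln a| + `|ln b|).
exists (expR (- L)); first exact: expR_gt0.
apply: (funcalc_ge sA (power_spec p)) => t /h tab.
have t0 : 0 < t by have /andP[] := tab; lra.
rewrite powR_expR // ler_expR lerNl; apply: le_trans (ler_norm _) _.
by rewrite normrN normrM ler_wpM2l // ln_bound.
Qed.

Lemma powerE p B : is_funcalc (fun t => t `^ p) A B -> power_op A p = B.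
Proof. exact: funcalcE. Qed.

Lemma powerD p q x : power_op A p (power_op A q x) = power_op A (p + q) x.
Proof.
suff -> : power_op A (p + q) = (fun x => power_op A p (power_op A q x)) by [].
apply: powerE; apply: funcalc_ext (funcalc_mul sA (power_spec p) (power_spec q)) => t st.
by rewrite powRD //; apply/implyP => _; rewrite gt_eqF // (posinv_spectrum_gt0 pA).
Qed.

Lemma power0 : power_op A 0 = id.
Proof.
apply: powerE; have := funcalc_poly sA 1%:P.
have -> : poly_op 1%:P A = id by apply/funext => x; rewrite poly_opC scale1r.
by apply: funcalc_ext => t _; rewrite hornerC powRr0.
Qed.

Lemma power1 : power_op A 1 = A.
Proof.
apply: powerE; have := funcalc_poly sA 'X.
have -> : poly_op 'X A = A by apply/funext => x; rewrite poly_opX.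
apply: funcalc_ext => t st; rewrite hornerX powRr1 //.
by rewrite ltW // (posinv_spectrum_gt0 pA).
Qed.

Lemma powerVK p x : power_op A p (power_op A (- p) x) = x.
Proof. by rewrite powerD subrr power0. Qed.

Lemma powerKV p x : power_op A (- p) (power_op A p x) = x.
Proof. by rewrite powerD addNr power0. Qed.

Lemma power_comm p S : bounded_op S -> (forall x, A (S x) = S (A x)) ->
  forall x, power_op A p (S x) = S (power_op A p x).
Proof. exact: (funcalc_comm sA (power_spec p)). Qed.

(** Lets an inequality known for a dense set of exponents pass to all of them. *)
Lemma power_cont p e : 0 < e -> exists2 d, 0 < d & forall q, `|q - p| <= d ->
  forall x, nn (power_op A q x - power_op A p x) <= e * nn x.
Proof.
move=> e0; have [a [b [a0 ab h]]] := posinv_spectrum pA.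
pose L := `|ln a| + `|ln b|; pose K := expR ((`|p| + 1) * L) * L.
have K0 : 0 <= K by rewrite mulr_ge0 ?expR_ge0 ?addr_ge0.
exists (Num.min 1 (e / (K + 1))) => [|q].
  by rewrite lt_min ltr01 divr_gt0 //; lra.
rewrite le_min => /andP[q1]; rewrite ler_pdivlMr; last by lra.
move=> q2; apply: (funcalc_norm sA (funcalc_sub sA (power_spec q) (power_spec p))) (ltW e0) _ => t st.
apply: le_trans (powR_exponent_lip a0 (h t st) q1) _; rewrite -/L -/K.
by have := normr_ge0 (q - p); lra.
Qed.

Lemma powerM p q : power_op (power_op A p) q = power_op A (p * q).
Proof.
have sB := power_sa p; have [a [b [a0 ab ha hb]]] := posinv_interval pA.
pose L := `|p| * (`|ln a| + `|ln b|).
(* The summand 1 keeps the interval nondegenerate when L = 0, for [powR_approx]. *)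
have hp t : spectrum A t%:C -> expR (- L) <= t `^ p <= expR L + 1.
  move=> st; have tab : a <= t <= b by rewrite (spectrum_ge sA ha st) (spectrum_le sA hb st).
  have t0 := posinv_spectrum_gt0 pA st.
  have : `|p * ln t| <= L by rewrite normrM ler_wpM2l // ln_bound.
  rewrite powR_expR // ler_norml => /andP[h1 h2]; rewrite ler_expR h1 /=.
  by apply: ler_wpDr => //; rewrite ler_expR.
apply: (funcalcE sB).
apply: (funcalc_comp sA (power_spec p) _ _ hp).
  by apply: funcalc_ext (power_spec (p * q)) => t _; rewrite powRrM.
apply: powR_approx; rewrite ?expR_gt0 //.
have L0 : 0 <= L by rewrite mulr_ge0 ?addr_ge0.
have : expR (- L) <= 1 by rewrite expR_le1; lra.
by have := expR_gt0 L; lra.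
Qed.

Lemma power_scale c p : 0 < c ->
  power_op (fun x => c%:C *: A x) p = (fun x => (c `^ p)%:C *: power_op A p x).
Proof.
move=> c0; have [a [b [a0 ab ha hb]]] := posinv_interval pA.
have sB := sa_scale c sA.
have hc : is_funcalc (fun t => c * t) A (fun x => c%:C *: A x).
  have h := funcalc_scale sA c (power_spec 1); rewrite power1 in h.
  apply: funcalc_ext h => t st; rewrite powRr1 //.
  by rewrite ltW // (posinv_spectrum_gt0 pA).
apply: (funcalcE sB).
apply: (@funcalc_comp _ _ _ _ _ _ _ (c * a) (c * b) sA hc).
- apply: funcalc_ext (funcalc_scale sA (c `^ p) (power_spec p)) => t st.
  by rewrite powRM ?ltW // (posinv_spectrum_gt0 pA).
- by apply: powR_approx; rewrite ?mulr_gt0 // ltr_pM2l.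
- move=> t st; rewrite !ler_pM2l //.
  by rewrite (spectrum_ge sA ha st) (spectrum_le sA hb st).
Qed.

End Power.

Lemma posinv_scalar c : 0 < c -> posinv_op (scalar_op c : op H).
Proof.
move=> c0; apply/posinvP; split; first exact: sa_scalar.
by exists c => // x; rewrite riZl.
Qed.

Lemma posinv_scale c A : 0 < c -> posinv_op A -> posinv_op (fun x => c%:C *: A x).
Proof.
move=> c0 /posinvP[sA [d d0 hd]]; apply/posinvP; split; first exact: sa_scale.
by exists (c * d) => [|x]; rewrite ?mulr_gt0 // riZl -mulrA ler_pM2l.
Qed.

Lemma posinv_congr A C : posinv_op A -> posinv_op C -> posinv_op (C \o A \o C).
Proof.
move=> /posinvP[sA [d d0 hd]] /posinvP[sC [c c0 hc]]; apply/posinvP; split.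
  exact: sa_congr.
exists (d * c ^+ 2) => [|x]; first by rewrite mulr_gt0 ?exprn_gt0.
have [_ symC] := sC; rewrite /= symC; apply: le_trans (hd (C x)).
rewrite -mulrA ler_pM2l // -!nn_sqr -exprMn ler_sqr ?nnegrE ?mulr_ge0 ?nn_ge0 ?(ltW c0) //.
exact: lbd_bounded_below.
Qed.

End OperatorPowers.

(** * Hansen's inequality *)

Section Hansen.
Variables (R : realType) (H : hilbert R).
Implicit Types (x y z : H) (a b c d e t p q : R) (A B C D S T W : op H).

Lemma sqr_le_norm (u v : R) : 0 <= v -> u ^+ 2 <= v ^+ 2 -> `|u| <= v.
Proof.
move=> v0; rewrite -(real_normK (num_real u)) ler_sqr ?nnegrE //.
Qed.

(* The geometric mean D^m, m = (p+q)/2, of D^p and D^q is the largest W for which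
   the Cauchy-Schwarz inequality below holds: if z is an approximate eigenvector
   of V = D^(-m/2) W D^(-m/2), test it on x = D^(-m/2) z and y = D^(-m/2) G z,
   where G = D^((p-q)/2). *)
Lemma mean_power_le D W c p q : posinv_op D -> sa W -> 0 <= c ->
  (forall x y, ri (W x) y ^+ 2 <=
     (c * ri (power_op D p x) x) * (c * ri (power_op D q y) y)) ->
  forall x, ri (W x) x <= c * ri (power_op D ((p + q) / 2) x) x.
Proof.
move=> pD sW c0 hW x; set m := (p + q) / 2.
have [bW symW] := sW.
pose k := power_op D (- (m / 2)); have pk := power_posinv pD (- (m / 2)).
have [bk symk] := power_sa pD (- (m / 2)).
pose V := k \o W \o k; have sV : sa V by apply: sa_congr => //; exact: power_sa.
have [bV symV] := sV.
pose G := power_op D ((p - q) / 2); have pG := power_posinv pD ((p - q) / 2).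
have hV z : `|ri (V z) (G z)| <= c * ri (G z) z.
  have pG0 : 0 <= ri (G z) z by have := positive_op_ge0 (proj1 pG) z; rewrite mul0r.
  apply: sqr_le_norm; first by rewrite mulr_ge0.
  rewrite /V /= /k symk; apply: le_trans (hW _ _) _.
  rewrite -!symk !(powerD pD) -/G.
  have -> : - (m / 2) + p + - (m / 2) = (p - q) / 2 by rewrite /m; field.
  have -> : - (m / 2) + q + - (m / 2) + (p - q) / 2 = 0 by rewrite /m; field.
  by rewrite power0 // -/(G z) (riC z) expr2.
have [->|x0] := eqVneq x 0; first by rewrite !ri0r mulr0.
suff N1 : opnorm V <= c.
  have hx : W x = power_op D (m / 2) (V (power_op D (m / 2) x)).
    by rewrite /V /= /k (powerKV pD) (powerVK pD).
  have [bh symh] := power_sa pD (m / 2).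
  rewrite {}hx symh; have mm : m / 2 + m / 2 = m by field.
  set u := power_op D (m / 2) x; apply: le_trans (ri_le _ _) _.
  have := ler_wpM2r (nn_ge0 u) (opnorm_ge u bV); rewrite -mulrA -expr2 nn_sqr.
  move=> /le_trans; apply; rewrite -[in leRHS]mm -(powerD pD) -/u symh -/u.
  by rewrite ler_wpM2r ?ri_ge0.
rewrite leNgt; apply/negP => cN; set N := opnorm V in cN.
have [a a0 ha] : exists2 a, 0 < a & lbd G a by case/posinvP: pG.
have [K K0 hK] := bop_bound (posinv_bop pG).
have key s : `|s| = N -> bounded_below (fun z => V z - s%:C *: z).
  (* If |V z - s z| < d |z|, testing against G z costs at most d K |z|^2 = (N - c) a |z|^2 / 2,
     which is at most half of the excess (N - c) <G z, z>. *)
  move=> sN; pose d := (N - c) * a / (K * 2).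
  exists d; first by rewrite !divr_gt0 ?mulr_gt0 ?subr_gt0.
  move=> z; rewrite leNgt; apply/negP => hz.
  have z0 : 0 < nn z.
    rewrite nn_gt0 //; apply/eqP => zE; move: hz.
    by rewrite zE bop0 // scaler0 subrr nn0 mulr0 ltxx.
  have e1 : s * ri (G z) z = ri (V z) (G z) - ri (V z - s%:C *: z) (G z).
    by rewrite !riE (riC z); ring.
  have Gz : 0 < ri (G z) z.
    by apply: lt_le_trans (ha z); rewrite mulr_gt0 // -nn_sqr exprn_gt0.
  have := congr1 Num.norm e1; rewrite normrM sN (gtr0_norm Gz) => e2.
  have := ler_normB (ri (V z) (G z)) (ri (V z - s%:C *: z) (G z)); rewrite -e2.
  have h1 := hV z; have h2 := ri_cs (V z - s%:C *: z) (G z); have h3 := hK z.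
  have h4 := ha z; rewrite -nn_sqr in h4.
  have h5 : nn (V z - s%:C *: z) * nn (G z) <= (d * nn z) * (K * nn z).
    by apply: ler_pM; rewrite ?nn_ge0 // ltW.
  have h6 : (d * nn z) * (K * nn z) = (N - c) * (a * nn z ^+ 2) / 2.
    by rewrite /d; field; rewrite gt_eqF.
  have h7 : (N - c) * (a * nn z ^+ 2) <= (N - c) * ri (G z) z.
    by rewrite ler_pM2l ?subr_gt0.
  have h8 : 0 < (N - c) * ri (G z) z by rewrite mulr_gt0 ?subr_gt0.
  by lra.
have N0 : 0 <= N by lra.
(* V^2 - N^2 is the product of V - N and V + N, both bounded below. *)
apply: (opnorm_not_bounded_below x0 sV).
have := bounded_below_comp (key N (ger0_norm N0)) (key (- N) _).
rewrite normrN => /(_ (ger0_norm N0)); congr bounded_below; apply/funext => z /=.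
rewrite bopB // (bopZ bV) rmorphN /= !scaleNr !opprK scalerDr scalerA opprD addrA addrK.
by rewrite -rmorphM -expr2.
Qed.

(** Splitting the exponent as q / 2 + p / 2 reduces this to Cauchy-Schwarz; it feeds the hypothesis
    of [mean_power_le]. *)
Lemma power_half A p q x y : posinv_op A ->
  ri (power_op A ((p + q) / 2) x) y ^+ 2 <= ri (power_op A p x) x * ri (power_op A q y) y.
Proof.
move=> pA; have -> : (p + q) / 2 = q / 2 + p / 2 by field.
have sp := power_sa pA (p / 2); have sq := power_sa pA (q / 2).
rewrite -(powerD pA) (proj2 sq).
have -> : ri (power_op A p x) x = nn (power_op A (p / 2) x) ^+ 2.
  by rewrite nn_sqr -(proj2 sp) (powerD pA); congr (ri (power_op _ _ _) _); field.
have -> : ri (power_op A q y) y = nn (power_op A (q / 2) y) ^+ 2.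
  by rewrite nn_sqr -(proj2 sq) (powerD pA); congr (ri (power_op _ _ _) _); field.
rewrite -exprMn -[leLHS]real_normK ?num_real //.
by rewrite ler_sqr ?nnegrE ?mulr_ge0 ?nn_ge0 // ri_cs.
Qed.

(* The set of exponents p for which the inequality holds contains 0 and 1 and is
   closed under midpoints, hence is dense in [0, 1]. *)
Lemma hansen T C b p : posinv_op T -> posinv_op C -> 0 < b ->
  (forall x, ri (C x) (C x) <= b * ri x x) -> 0 <= p <= 1 ->
  forall x, ri (power_op T p (C x)) (C x) <=
    b `^ (1 - p) * ri (power_op (C \o T \o C) p x) x.
Proof.
move=> pT pC b0 hC p01 x.
have pD := posinv_congr pT pC; have b1 : 0 < b^-1 by rewrite invr_gt0.
have pE := posinv_scale b1 pD; set E := (fun x => _) in pE.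
have [bC symC] := posinv_sa pC.
(* Rescaling by b^-1 gives all exponents the same constant b, as the midpoint step requires; b times
   b^(-p) then restores b^(1 - p). *)
pose holds q := forall y, ri (power_op T q (C y)) (C y) <= b * ri (power_op E q y) y.
suff hp : holds p.
  apply: le_trans (hp x) _; rewrite /E power_scale // riZl mulrA powRD; last first.
    by apply/implyP => _; rewrite gt_eqF.
  by rewrite powRr1 ?(ltW b0) // -powR_inv1 ?(ltW b0) // -powRrM mulN1r.
have h0 : holds 0 by move=> y; rewrite !power0.
have h1 : holds 1.
  move=> y; rewrite !power1 // /E riZl mulrA divff ?gt_eqF // mul1r /=.
  by rewrite symC.
have mid q s : holds q -> holds s -> holds ((q + s) / 2).
  move=> hq hs y; have := @mean_power_le E (C \o power_op T ((q + s) / 2) \o C) b q s pE _ (ltW b0) _ y.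
  rewrite /= symC; apply; first by apply: sa_congr; [exact: power_sa | exact: posinv_sa].
  move=> u v /=; rewrite symC; apply: le_trans (power_half _ _ _ _ pT) _.
  have ge0 r z : 0 <= ri (power_op T r z) z.
    by have := positive_op_ge0 (proj1 (power_posinv pT r)) z; rewrite mul0r.
  by apply: ler_pM.
have bis n : exists l u : R, [/\ holds l, holds u, l <= p <= u & u - l = 2^-1 ^+ n].
  elim: n => [|n [l [u [hl hu /andP[lp pu] lu]]]]; first by exists 0, 1; rewrite subr0 expr0.
  have [pm|/ltW pm] := leP p ((l + u) / 2).
    exists l, ((l + u) / 2); split=> //; [exact: mid | by rewrite lp | rewrite exprS -lu].
    by field.
  exists ((l + u) / 2), u; split=> //; [exact: mid | by rewrite pm | rewrite exprS -lu].
  by field.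
move=> y; apply/ler_addgt0Pr => e e0.
pose M := ri (C y) (C y) + b * ri y y + 1.
have M0 : 0 < M.
  by rewrite /M; have := ri_ge0 (C y); have := mulr_ge0 (ltW b0) (ri_ge0 y); lra.
have eM0 := divr_gt0 e0 M0; move: (e / _) (mulfVK (lt0r_neq0 M0) e) eM0 => f fe f0.
have [d1 d10 hd1] := power_cont pT p f0; have [d2 d20 hd2] := power_cont pE p f0.
have [n hn] := @expr_small R 2^-1 (Num.min d1 d2) ltac:(by apply/andP; split; lra)
  ltac:(by rewrite lt_min d10).
have {}hn := hn n (leqnn _); have [l [u [hl _ /andP[lp pu] lu]]] := bis n.
have lp1 : `|l - p| <= Num.min d1 d2.
  by rewrite ler_norml; apply/andP; split; lra.
move: lp1; rewrite le_min => /andP[/hd1 g1 /hd2 g2].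
have := hl y; have := ri_cs (power_op T l (C y) - power_op T p (C y)) (C y).
have := ri_cs (power_op E l y - power_op E p y) y.
rewrite !riE !ler_norml => /andP[_ k1] /andP[k2 _] k3.
have := ler_wpM2r (nn_ge0 (C y)) (g1 (C y)); have := ler_wpM2r (nn_ge0 y) (g2 y).
rewrite -!mulrA -!expr2 !nn_sqr => k4 k5.
have k6 : b * (ri (power_op E l y) y - ri (power_op E p y) y) <= b * (f * ri y y).
  by rewrite ler_pM2l //; lra.
by move: fe; rewrite /M; lra.
Qed.

End Hansen.

(** * Spectral projections *)

Section Ramp.
Variable R : realType.
Implicit Types (u v s t l m : R).

Definition clamp u : R := Num.max 0 (Num.min 1 u).

Lemma clamp_cases u : [\/ u <= 0 /\ clamp u = 0, 0 <= u <= 1 /\ clamp u = u | 1 <= u /\ clamp u = 1].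
Proof.
rewrite /clamp; have [u1|/ltW u1] := leP 1 u.
  by apply: Or33; split=> //; apply: max_r.
have [u0|/ltW u0] := leP 0 u; first by apply: Or32; split=> //; exact/andP.
by apply: Or31.
Qed.

(* As k grows, these functions decrease to the indicator of [l, +oo). *)
Definition ramp (k : nat) l t : R := clamp (1 - k.+1%:R * (l - t)).

Lemma clamp_lip u v : `|clamp u - clamp v| <= `|u - v|.
Proof.
have h1 := ler_norm (u - v); have := ler_norm (v - u); rewrite distrC => h2.
rewrite ler_norml.
by have [[u1 ->]|[/andP[u0 u1] ->]|[u1 ->]] := clamp_cases u;
  have [[v1 ->]|[/andP[v0 v1] ->]|[v1 ->]] := clamp_cases v;
  apply/andP; split; lra.
Qed.

Lemma ramp_lip a b k l : lipschitz_on a b k.+1%:R (ramp k l).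
Proof.
move=> s t _ _; apply: le_trans (clamp_lip _ _) _.
have -> : 1 - k.+1%:R * (l - s) - (1 - k.+1%:R * (l - t)) = k.+1%:R * (s - t) by ring.
by rewrite normrM ger0_norm ?ler0n.
Qed.

Lemma ramp01 k l t : 0 <= ramp k l t <= 1.
Proof. by rewrite /ramp; have [[u1 ->]|[/andP[u0 u1] ->]|[u1 ->]] := clamp_cases (1 - k.+1%:R * (l - t)); apply/andP; split. Qed.

Lemma ramp1 k l t : l <= t -> ramp k l t = 1.
Proof.
move=> lt; have k0 : 0 <= k.+1%:R :> R := ler0n _ _.
by rewrite /ramp; have [[u1 ->]|[/andP[u0 u1] ->]|[u1 ->]] := clamp_cases (1 - k.+1%:R * (l - t)); nra.
Qed.

Lemma ramp_lt k l t : t < l -> ramp k l t != 0 -> k.+1%:R * (l - t) <= 1.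
Proof.
rewrite /ramp; have [[u1 ->]|[/andP[u0 u1] ->]|[u1 ->]] := clamp_cases (1 - k.+1%:R * (l - t)); first by rewrite eqxx.
  by lra.
by lra.
Qed.

Lemma ramp_complement k l t : 1 - ramp k l t <= k.+1%:R * `|l - t|.
Proof.
have k0 : 0 <= k.+1%:R :> R := ler0n _ _; have := ler_norm (l - t); have := normr_ge0 (l - t).
by rewrite /ramp; have [[u1 ->]|[/andP[u0 u1] ->]|[u1 ->]] := clamp_cases (1 - k.+1%:R * (l - t)); nra.
Qed.

Lemma ramp_decr k l t : ramp k.+1 l t <= ramp k l t.
Proof.
have [lt|tl] := leP l t; first by rewrite !ramp1.
have k0 : 0 <= k.+1%:R :> R := ler0n _ _; rewrite /ramp -[k.+2%:R]natr1.
have [[u1 ->]|[/andP[u0 u1] ->]|[u1 ->]] := clamp_cases (1 - k.+1%:R * (l - t));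
 have [[v1 ->]|[/andP[v0 v1] ->]|[v1 ->]] := clamp_cases (1 - (k.+1%:R + 1) * (l - t)); nra.
Qed.

End Ramp.

Section SpectralProjections.
Variables (R : realType) (H : hilbert R).
Implicit Types (x y z : H) (c d e t l m p : R) (A B C E F S T : op H).

Definition projection E := sa E /\ forall x, E (E x) = E x.

Section Fixed.
Variables (A : op H) (a b : R).
Hypotheses (sA : sa A) (ab : a < b) (hA : lbd A a) (hA' : ubd A b).

Let hk k l := funcalc (ramp k l) A.

Lemma spectrum_itv t : spectrum A t%:C -> a <= t <= b.
Proof. by move=> st; rewrite (spectrum_ge sA hA st) (spectrum_le sA hA' st). Qed.

Lemma ramp_spec k l : is_funcalc (ramp k l) A (hk k l).
Proof.
have [B hB] := funcalc_exists sA hA hA' (lipschitz_approx ab (ler0n _ k.+1) (ramp_lip k l)).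
exact: funcalc_spec hB.
Qed.

(** The spectral projection of A for [l, +oo), reached as a strong limit because the indicator is
    not continuous. *)
Definition spectral_proj l E := sa E /\ forall x, seqlim (fun k => hk k l x) (E x).

Lemma spectral_proj_exists l : exists E, spectral_proj l E.
Proof.
have [|||E [sE _ hE _]] := @monotone_limit R H (fun k => hk k l); last by exists E.
- by move=> k; exact: (funcalc_sa sA (ramp_spec k l)).
- move=> k x; have h := funcalc_sub sA (ramp_spec k l) (ramp_spec k.+1 l).
  have := @funcalc_ge _ _ _ sA _ _ 0 h ltac:(by move=> t _; rewrite subr_ge0 ramp_decr) x.
  by rewrite !riE mul0r subr_ge0.
- by move=> k; apply: (funcalc_ge sA (ramp_spec k l)) => t _; have /andP[] := ramp01 k l t.
Qed.

Lemma inv_nat_small (K e : R) : 0 <= K -> 0 < e ->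
  exists N, forall k, (N <= k)%N -> K / k.+1%:R <= e.
Proof.
move=> K0 e0; exists (Num.truncn (K / e)) => k Nk.
rewrite ler_pdivrMr ?ltr0n // mulrC -ler_pdivrMr //.
by rewrite (le_trans (ltW (truncnS_gt _))) // ler_nat.
Qed.

(** On the spectrum, the j-th ramp at m times (1 - the k-th ramp at l) is at most (k + 1) / (j + 1).
    Letting j grow, F absorbs every ramp at l, and then their limit E. *)
Lemma spectral_proj_comp l m E F x : l <= m -> spectral_proj l E -> spectral_proj m F ->
  F (E x) = F x.
Proof.
move=> lm [sE hE] [sF hF].
have key k : F (hk k l x) = F x.
  apply: seqlim_unique (hF _) _.
  have lim0 : seqlim (fun j => hk j m x - hk j m (hk k l x)) 0.
    move=> e e0; have kx0 : 0 <= k.+1%:R * nn x by rewrite mulr_ge0 ?ler0n ?nn_ge0.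
    have [N hN] := inv_nat_small kx0 e0.
    exists N => j /hN h; rewrite subr0; apply: le_trans h; rewrite mulrAC.
    have h1 := ramp_spec j m; have h2 := ramp_spec k l.
    apply: (funcalc_norm sA (funcalc_sub sA h1 (funcalc_mul sA h1 h2))) => [|t st].
      by rewrite divr_ge0 ?ler0n.
    have [lt|tl] := leP l t; first by rewrite (ramp1 k lt) mulr1 subrr normr0 divr_ge0.
    have [->|r0] := eqVneq (ramp j m t) 0; first by rewrite mul0r subrr normr0 divr_ge0.
    have := ramp_lt (lt_le_trans tl lm) r0; have := ramp_complement k l t.
    rewrite gtr0_norm ?subr_gt0 // => g1 g2.
    have /andP[a1 a2] := ramp01 j m t; have /andP[b1 b2] := ramp01 k l t.
    have -> : ramp j m t - ramp j m t * ramp k l t = ramp j m t * (1 - ramp k l t) by ring.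
    rewrite ger0_norm ?mulr_ge0 ?subr_ge0 // ler_pdivlMr ?ltr0n //.
    have k0 : 0 <= k.+1%:R :> R := ler0n _ _; have j0 : 0 <= j.+1%:R :> R := ler0n _ _.
    have h3 : ramp j m t * (1 - ramp k l t) <= k.+1%:R * (l - t) by nra.
    have h4 : j.+1%:R * (l - t) <= 1 by nra.
    have h5 : ramp j m t * (1 - ramp k l t) * j.+1%:R <= k.+1%:R * (l - t) * j.+1%:R.
      by rewrite ler_wpM2r.
    by nra.
  have := seqlimB (hF x) lim0; rewrite subr0; apply: seqlim_eq; exists 0 => j _.
  by rewrite opprB addrCA subrr addr0.
apply: seqlim_unique (seqlim_bop (proj1 sF) (hE x)) _.
by apply: seqlim_eq (seqlim_cst (F x)); exists 0 => k _; rewrite key.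
Qed.

Lemma spectral_proj_compr l m E F x : l <= m -> spectral_proj l E -> spectral_proj m F ->
  E (F x) = F x.
Proof.
move=> lm hE hF; have h y := spectral_proj_comp y lm hE hF.
have [[_ sE] _] := hE; have [[_ sF] _] := hF.
have key y : ri (E (F x) - F x) y = 0 by rewrite !riE sE sF h sF subrr.
by apply/eqP; rewrite -subr_eq0; apply/eqP/ri_eq0/key.
Qed.

Lemma spectral_proj_comm l E S : spectral_proj l E -> bounded_op S ->
  (forall x, A (S x) = S (A x)) -> forall x, E (S x) = S (E x).
Proof.
move=> [sE hE] bS AS x; apply: seqlim_unique (hE _) _.
apply: seqlim_eq (seqlim_bop bS (hE x)); exists 0 => k _.
by rewrite (funcalc_comm sA (ramp_spec k l) bS AS).
Qed.

Lemma spectral_proj_id l E : l <= a -> spectral_proj l E -> E = id.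
Proof.
move=> la [_ hE]; apply/funext => x; apply: seqlim_unique (hE x) _.
apply: seqlim_eq (seqlim_cst x); exists 0 => k _.
have h := funcalc_poly sA 1%:P.
rewrite -[LHS](scale1r x) -[1](rmorph1 (real_complex R)) -(poly_opC 1 A).
rewrite (funcalc_unique sA (ramp_spec k l) (C := poly_op 1%:P A)) //.
apply: funcalc_ext h => t /spectrum_itv /andP[ta _]; rewrite hornerC ramp1 //.
exact: le_trans ta.
Qed.

Lemma spectral_proj_0 l E : b < l -> spectral_proj l E -> forall x, E x = 0.
Proof.
move=> bl [_ hE] x; apply: seqlim_unique (hE x) _.
apply: seqlim_eq (seqlim_cst 0).
have lb0 : 0 < l - b by rewrite subr_gt0.
have [N hN] := inv_nat_small ler01 lb0.
exists N => k /hN h; apply/esym/nn_eq0/le_anti; rewrite nn_ge0 andbT -(mul0r (nn x)).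
apply: (funcalc_norm sA (ramp_spec k l)) => // t /spectrum_itv /andP[_ tb].
suff -> : ramp k l t = 0 by rewrite normr0.
move: h; rewrite ler_pdivrMr ?ltr0n // mulrC => h; have k0 := ltr0Sn R k.
have u0 : 1 - k.+1%:R * (l - t) <= 0 by nra.
by rewrite /ramp; have [[_ ->]|[/andP[? ?] ->]|[? ->]] := clamp_cases (1 - k.+1%:R * (l - t)); lra.
Qed.

(** The ramps reach below l on an interval of length 1 / (k + 1), where f may fall L / (k + 1) under
    c; the Lipschitz-type hypothesis makes this loss vanish in the limit. *)
Lemma spectral_proj_ge l E f F c L : spectral_proj l E -> is_funcalc f A F -> 0 <= L ->
  (forall t, spectrum A t%:C -> l <= t -> c <= f t) ->
  (forall t, spectrum A t%:C -> t < l -> c - L * (l - t) <= f t) ->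
  forall x, c * ri (E x) (E x) <= ri (F (E x)) (E x).
Proof.
move=> [sE hE] hF L0 h1 h2 x.
have [bF _] := funcalc_sa sA hF.
have bG : bounded_op (fun y => F y - c%:C *: y).
  by apply: bop_sub => //; exact: (bop_scale _ (@bop_id R H)).
rewrite -subr_ge0 -riZl -riNl -riDl.
apply: (seqlim_ri (seqlim_bop bG (hE x)) (hE x)) => e e0; rewrite add0r.
have [N hN] := inv_nat_small (mulr_ge0 L0 (ri_ge0 x)) e0; exists N => k /hN h.
have hr := ramp_spec k l; have [_ symr] := funcalc_sa sA hr.
have hc : is_funcalc (fun t => f t - c) A (fun y => F y - c%:C *: y).
  apply: funcalc_sub => //; have := funcalc_poly sA c%:P.
  have -> : poly_op c%:P A = (fun y => c%:C *: y) by apply/funext => y; rewrite poly_opC.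
  by apply: funcalc_ext => t _; rewrite hornerC.
have := @funcalc_ge _ _ _ sA _ _ (- (L / k.+1%:R)) (funcalc_mul sA hr (funcalc_mul sA hc hr)).
have k0 := ltr0Sn R k.
have Lk : 0 <= L / k.+1%:R by rewrite divr_ge0 // ltW.
move=> /(_ _ x) /=; rewrite symr => hg; apply: (le_trans _ (hg _)); first by move: h; rewrite mulrAC mulNr lerN2.
move=> t st; have /andP[a1 a2] := ramp01 k l t.
rewrite mulrCA -expr2; have r2 : 0 <= ramp k l t ^+ 2 <= 1 by apply/andP; split; nra.
have [lt|tl] := leP l t; first by apply: (@le_trans _ _ 0); rewrite ?oppr_le0 // mulr_ge0 ?sqr_ge0 // subr_ge0 h1.
have [->|r0] := eqVneq (ramp k l t) 0; first by rewrite expr0n mulr0 oppr_le0.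
have := h2 t st tl; have := ramp_lt tl r0 => g1 g2.
have g3 : L * (l - t) <= L / k.+1%:R.
  by rewrite ler_wpM2l // -div1r ler_pdivlMr // mulrC.
have /andP[q0 q1] := r2; move: (ramp k l t ^+ 2) q0 q1 => q q0 q1.
move: (L / k.+1%:R) Lk g3 => w w0 g3.
have : (- w) * q <= (f t - c) * q by rewrite ler_wpM2r //; lra.
have : w * q <= w by rewrite ler_piMr.
by lra.
Qed.

(** The functions 1 - ramp vanish on [l, +oo), so only the values of f below l enter, already before
    the limit. *)
Lemma spectral_proj_le l E f F c : spectral_proj l E -> is_funcalc f A F ->
  (forall t, spectrum A t%:C -> t < l -> f t <= c) ->
  forall x, ri (F (x - E x)) (x - E x) <= c * ri (x - E x) (x - E x).
Proof.
move=> [sE hE] hF h1 x; have [bF _] := funcalc_sa sA hF.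
have bG : bounded_op (fun y => c%:C *: y - F y).
  by apply: bop_sub => //; exact: (bop_scale _ (@bop_id R H)).
have lim := seqlimB (seqlim_cst x) (hE x).
rewrite -subr_ge0 -riZl -riNl -riDl.
apply: (seqlim_ri (seqlim_bop bG lim) lim) => e e0; exists 0 => k _.
have h1c := funcalc_poly sA 1%:P.
have hr : is_funcalc (fun t => 1 - ramp k l t) A (fun y => y - hk k l y).
  have := funcalc_sub sA h1c (ramp_spec k l).
  have -> : (fun y => poly_op 1%:P A y - hk k l y) = (fun y => y - hk k l y).
    by apply/funext => y; rewrite poly_opC scale1r.
  by apply: funcalc_ext => t _; rewrite hornerC.
have hc : is_funcalc (fun t => c - f t) A (fun y => c%:C *: y - F y).
  apply: funcalc_sub => //; have := funcalc_poly sA c%:P.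
  have -> : poly_op c%:P A = (fun y => c%:C *: y) by apply/funext => y; rewrite poly_opC.
  by apply: funcalc_ext => t _; rewrite hornerC.
have [_ symr] := funcalc_sa sA hr.
have := @funcalc_ge _ _ _ sA _ _ 0 (funcalc_mul sA hr (funcalc_mul sA hc hr)).
move=> /(_ _ x) /=; rewrite symr mul0r => hg; apply: (le_trans _ (hg _)); first by lra.
move=> t st; have /andP[a1 a2] := ramp01 k l t; rewrite mulrCA -expr2.
have [lt|tl] := leP l t; first by rewrite ramp1 // subrr expr0n mulr0.
by rewrite mulr_ge0 ?sqr_ge0 // subr_ge0 h1.
Qed.

End Fixed.

(** The blocks are the spectral subspaces of the grid a c^i, on each of which T is a scalar up to a
    factor c. A geometric grid suits the estimate g (c l) <= c g l of representing functions. *)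
Lemma spectral_partition T c : posinv_op T -> 1 < c ->
  exists (m : nat) (P : nat -> op H) (l : nat -> R),
  [/\ forall i, projection (P i) /\ forall x, T (P i x) = P i (T x),
      forall i, 0 < l i, forall x, \sum_(i < m) P i x = x &
      forall i p x, (i < m)%N -> 0 <= p ->
        l i `^ p * ri (P i x) (P i x) <= ri (power_op T p (P i x)) (P i x) /\
        ri (power_op T p (P i x)) (P i x) <= (c * l i) `^ p * ri (P i x) (P i x)].
Proof.
move=> pT c1; have sT := posinv_sa pT; have [bT symT] := sT.
have [a [b [a0 ab ha hb]]] := posinv_interval pT.
have c0 : 0 < c by lra.
(* The strict inequality makes the last projection vanish even when b lies in the spectrum. *)
have [m hm] : exists m : nat, b < a * c ^+ m.
  have ci : 0 <= c^-1 < 1 by rewrite invr_ge0 ltW //= invf_lt1.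
  have e0 : 0 < a / (2 * b) by rewrite divr_gt0 // mulr_gt0 //; lra.
  have [N /(_ N (leqnn _)) hN] := expr_small ci e0; exists N.
  have cN : 0 < c ^+ N by rewrite exprn_gt0.
  have b2 : 0 < 2 * b by lra.
  by move: hN; rewrite exprVn ler_pdivlMr // ler_pdivrMl //; lra.
pose l i := a * c ^+ i; have l0 i : 0 < l i by rewrite mulr_gt0 ?exprn_gt0.
have lS i : l i.+1 = c * l i by rewrite /l exprS mulrCA.
have lmono i : l i <= l i.+1 by rewrite lS ler_peMl // ltW.
have [E hE] := choice (fun i => spectral_proj_exists sT ab ha hb (l i)).
have EE i x : E i (E i x) = E i x by exact: (spectral_proj_comp sT ab ha hb x (lexx _) (hE i) (hE i)).
have ES i x : E i.+1 (E i x) = E i.+1 x by exact: (spectral_proj_comp sT ab ha hb x (lmono i) (hE i) (hE i.+1)).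
have ES' i x : E i (E i.+1 x) = E i.+1 x by exact: (spectral_proj_compr sT ab ha hb x (lmono i) (hE i) (hE i.+1)).
have sE i : sa (E i) by case: (hE i).
have bE i : bounded_op (E i) by case: (sE i).
have ET i x : E i (T x) = T (E i x) by exact: (spectral_proj_comm sT ab ha hb (hE i) bT (fun=> erefl)).
pose P i := fun x => E i x - E i.+1 x.
(* As a value of E_i, the vector P_i x admits the lower bound with l_i; as a value of 1 - E_(i+1),
   it admits the upper bound with l_(i+1) = c l_i. *)
have P1 i x : P i x = E i (x - E i.+1 x) by rewrite (bopB (bE i)) ES'.
have P2 i x : P i x = E i x - E i.+1 (E i x) by rewrite ES.
exists m, P, l; split=> //.
- move=> i; split; last by move=> x; rewrite /P !ET bopB.
  split; first exact: sa_sub.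
  by move=> x; rewrite /P !(bopB (bE _)) !EE ES ES' subrr subr0.
- move=> x; have : \sum_(i < m) P i x = E 0 x - E m x.
    elim: (m) => [|n IH]; first by rewrite big_ord0 subrr.
    by rewrite big_ord_recr /= IH /P addrA subrK.
  move=> ->; rewrite (spectral_proj_0 sT ab ha hb hm (hE m)) subr0.
  by rewrite (spectral_proj_id sT ab ha hb _ (hE 0)) // /l expr0 mulr1.
move=> i p x im p0; have hp := power_spec pT p; split.
  have [L L0 hL] := powR_lipschitz (Num.max b (l i)) p a0.
  rewrite P1; apply: (spectral_proj_ge sT ab ha hb (hE i) hp L0) => t st.
    by move=> lt; apply: ge0_ler_powR => //; rewrite nnegrE ?(ltW (posinv_spectrum_gt0 pT st)) ?(ltW (l0 i)).
  move=> tl; have /andP[ta tb] := spectrum_itv sT ha hb st.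
  have ht : a <= t <= Num.max b (l i) by rewrite ta le_max tb.
  have hl : a <= l i <= Num.max b (l i).
    by rewrite le_max lexx orbT andbT /l ler_peMr ?(ltW a0) // exprn_ege1 // ltW.
  have := hL _ _ hl ht; rewrite [`|l i - t|]gtr0_norm ?subr_gt0 //.
  by rewrite ler_norml => /andP[]; lra.
rewrite P2; have -> : (c * l i) `^ p = l i.+1 `^ p by rewrite lS.
apply: (spectral_proj_le sT ab ha hb (hE i.+1) hp) => t st tl.
by apply: ge0_ler_powR => //; rewrite ?nnegrE ?(ltW (posinv_spectrum_gt0 pT st)) ?(ltW (l0 _)) ?(ltW tl).
Qed.

End SpectralProjections.

(** * Means and projections *)

Section OperatorOrder.
Variables (R : realType) (H : hilbert R).
Implicit Types (x y z : H) (A B C S T P : op H).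

Lemma qle_anti A B : sa A -> sa B -> qle A B -> qle B A -> A = B.
Proof.
move=> sA sB h1 h2; have sD := sa_sub sA sB; apply/funext => x; apply/eqP; rewrite -subr_eq0.
apply/eqP; apply: (pos_eq0 sD) => [y|]; rewrite !riE; first by rewrite mul0r subr_ge0.
by apply/eqP; rewrite subr_eq0 eq_le h1 h2.
Qed.

Lemma qle_trans A B C : qle A B -> qle B C -> qle A C.
Proof. by move=> h1 h2 x; exact: le_trans (h1 x) (h2 x). Qed.

Lemma projection_complement P : projection P -> projection (fun x => x - P x).
Proof.
move=> [sP PP]; split; first by apply: sa_sub sP; exact: sa_id.
by move=> x; rewrite (bopB (proj1 sP)) PP subrr subr0.
Qed.

Lemma projection_ri P x : projection P -> ri (P x) (P x) = ri (P x) x.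
Proof. by move=> [[_ sP] PP]; rewrite -sP PP. Qed.

Lemma projection_positive P : projection P -> positive_op P.
Proof.
move=> hP; apply/positive_opP; split; first by case: hP.
by move=> x; rewrite mul0r -projection_ri // ri_ge0.
Qed.

Lemma positive_congr A C : positive_op A -> sa C -> positive_op (C \o A \o C).
Proof.
move=> /positive_opP[sA pA] sC; apply/positive_opP; split; first exact: sa_congr.
by move=> x /=; rewrite (proj2 sC) mul0r; have := pA (C x); rewrite mul0r.
Qed.

Lemma qle_congr A B C : sa C -> qle A B -> qle (C \o A \o C) (C \o B \o C).
Proof. by move=> sC h x /=; rewrite !(proj2 sC). Qed.

Lemma positive_id : positive_op (id : op H).
Proof.
by apply/positive_opP; split=> [|x]; [exact: sa_id | rewrite mul0r ri_ge0].
Qed.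

Lemma positive_zero : positive_op (fun _ => 0 : H).
Proof.
have -> : (fun _ => 0) = (scalar_op 0 : op H).
  by apply/funext => x; rewrite /scalar_op rmorph0 scale0r.
by apply/positive_opP; split=> [|x]; [exact: sa_scalar | rewrite riZl].
Qed.

Lemma scalar_op1 : scalar_op 1 = id :> op H.
Proof. by apply/funext => x; rewrite /scalar_op scale1r. Qed.

Lemma power_invK C x : posinv_op C -> power_op C (-1) (C x) = x.
Proof. by move=> pC; have := powerKV pC 1 x; rewrite power1. Qed.

Lemma power_invVK C x : posinv_op C -> C (power_op C (-1) x) = x.
Proof. by move=> pC; have := powerVK pC 1 x; rewrite power1. Qed.

End OperatorOrder.

(** * Consequences of the mean axioms: congruences, scalars, reducing projections *)

Section KuboAndo.
Variables (R : realType) (H : hilbert R).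
Variables (tau : op H -> op H -> op H) (g : R -> R).
Hypotheses (mtau : operator_mean tau) (tau_g : representing tau g).
Hypothesis H_neq0 : exists v : H, v != 0.
Implicit Types (x y z : H) (c d e t l u : R) (A B C S T P : op H).

Lemma mean_pos A B : positive_op A -> positive_op B -> positive_op (tau A B).
Proof. exact: (mean_positive mtau). Qed.

Lemma mean_le A B C D : positive_op A -> positive_op B -> positive_op C -> positive_op D ->
  qle A C -> qle B D -> qle (tau A B) (tau C D).
Proof.
move=> pA pB pC pD h1 h2.
apply/le_opP; try by apply: positive_op_sa; exact: mean_pos.
by apply: (mean_monotone mtau) => //; apply/le_opP => //; exact: positive_op_sa.
Qed.

Lemma mean_transf A B C : positive_op A -> positive_op B -> positive_op C ->
  qle (C \o tau A B \o C) (tau (C \o A \o C) (C \o B \o C)).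
Proof.
move=> pA pB pC; have sC := positive_op_sa pC.
have sAB := positive_op_sa (mean_pos pA pB).
apply/le_opP; first exact: sa_congr.
  by apply: positive_op_sa; apply: mean_pos; exact: positive_congr.
exact: (mean_transformer mtau).
Qed.

(** The transformer inequality for C gives one direction, the one for the inverse of C the other. *)
Lemma mean_congr A B C : positive_op A -> positive_op B -> posinv_op C ->
  tau (C \o A \o C) (C \o B \o C) = C \o tau A B \o C.
Proof.
move=> pA pB qC; have pC := proj1 qC; have sC := posinv_sa qC.
have qV := power_posinv qC (-1); have pV := proj1 qV; have sV := posinv_sa qV.
have pCA := positive_congr pA sC; have pCB := positive_congr pB sC.
have cong S : power_op C (-1) \o (C \o S \o C) \o power_op C (-1) = S.
  by apply/funext => x /=; rewrite power_invVK // power_invK.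
have cong' S : C \o (power_op C (-1) \o S \o power_op C (-1)) \o C = S.
  by apply/funext => x /=; rewrite power_invK // power_invVK.
apply: qle_anti.
- by apply: positive_op_sa; exact: mean_pos.
- by apply: sa_congr => //; apply: positive_op_sa; exact: mean_pos.
- by have := qle_congr sC (mean_transf pCA pCB pV); rewrite !cong cong'.
- exact: mean_transf.
Qed.

Lemma mean_scale c A B : 0 < c -> positive_op A -> positive_op B ->
  tau (fun x => c%:C *: A x) (fun x => c%:C *: B x) = (fun x => c%:C *: tau A B x).
Proof.
move=> c0 pA pB.
have key S : bounded_op S ->
    scalar_op (Num.sqrt c) \o S \o scalar_op (Num.sqrt c) = (fun x => c%:C *: S x).
  move=> bS; apply/funext => x; rewrite /= /scalar_op (bopZ bS) scalerA -rmorphM.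
  by rewrite -expr2 sqr_sqrtr // ltW.
have [[bA _] [bB _] [bAB _]] := And3 pA pB (mean_pos pA pB).
rewrite -(key _ bA) -(key _ bB) -(key _ bAB).
by apply: mean_congr => //; apply: posinv_scalar; rewrite sqrtr_gt0.
Qed.

Lemma mean_scalar l : 0 < l -> tau id (scalar_op l) = scalar_op (g l).
Proof. exact: tau_g. Qed.

Lemma scalar_qle c d : qle (scalar_op c : op H) (scalar_op d) <-> c <= d.
Proof.
split=> [h|cd x]; last by rewrite !riZl ler_wpM2r ?ri_ge0.
have [v v0] := H_neq0; have := h v; rewrite !riZl ler_pM2r // -nn_sqr.
by rewrite exprn_gt0 // nn_gt0.
Qed.

Lemma scalar_pos c : 0 < c -> positive_op (scalar_op c : op H).
Proof. by move=> /(posinv_scalar H)[]. Qed.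

Lemma rep_le l u : 0 < l -> l <= u -> g l <= g u.
Proof.
move=> l0 lu; have u0 : 0 < u by lra.
rewrite -scalar_qle -!mean_scalar //; apply: mean_le; rewrite ?scalar_qle //;
  solve [exact: positive_id | exact: scalar_pos | by move=> x].
Qed.

(** By homogeneity c g(l) I = (c I) tau (c l I), and I <= c I. This growth bound serves in place of
    continuity of g. *)
Lemma rep_scale c l : 1 <= c -> 0 < l -> g (c * l) <= c * g l.
Proof.
move=> c1 l0; have c0 : 0 < c by lra.
rewrite -scalar_qle; have -> : scalar_op (c * g l) = tau (scalar_op c : op H) (scalar_op (c * l)).
  have := mean_scale c0 (@positive_id R H) (scalar_pos l0); rewrite mean_scalar //.
  rewrite /scalar_op => h; apply/funext => x; have := congr1 (fun F => F x) h.
  have -> : (fun y : H => c%:C *: (l%:C *: y)) = (fun y => (c * l)%:C *: y).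
    by apply/funext => y; rewrite scalerA -rmorphM.
  by move=> ->; rewrite scalerA -rmorphM.
rewrite -mean_scalar ?mulr_gt0 //; apply: mean_le => //.
- exact: positive_id.
- by apply: scalar_pos; rewrite mulr_gt0.
- exact: scalar_pos.
- by apply: scalar_pos; rewrite mulr_gt0.
- by rewrite -scalar_op1 scalar_qle.
Qed.

Lemma rep1 : g 1 = 1.
Proof.
have := mean_scalar ltr01; rewrite scalar_op1 (mean_normalized mtau) => h.
by apply/le_anti/andP; split; apply/scalar_qle; rewrite -h scalar_op1.
Qed.

Lemma rep_gt0 l : 0 < l -> 0 < g l.
Proof.
move=> l0; have [l1|/ltW l1] := leP 1 l.
  by apply: lt_le_trans (rep_le ltr01 l1); rewrite rep1.
have li : 1 <= l^-1 by rewrite invf_ge1.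
have := rep_scale li l0; rewrite mulVf ?gt_eqF // rep1.
by rewrite ler_pdivlMl // mulr1; exact: lt_le_trans.
Qed.

(** Homogeneity is available for positive factors, so zero is approached from above: 0 tau 0 <= (d
    I) tau (d I) = d I. *)
Lemma mean_zero x : ri (tau (fun _ => 0) (fun _ => 0) x) x <= 0.
Proof.
apply/ler_addgt0Pr => e e0; rewrite add0r.
pose d := e / (ri x x + 1); have x1 : 0 < ri x x + 1 by have := ri_ge0 x; lra.
have d0 : 0 < d by rewrite divr_gt0.
have pz := @positive_zero R H; have ps := scalar_pos d0.
have zs : qle (fun _ => 0 : H) (scalar_op d) by move=> y; rewrite ri0l riZl mulr_ge0 ?ri_ge0 ?ltW.
have h0 := mean_le pz pz ps ps zs zs.
have h := h0 x; apply: le_trans h _.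
have := mean_scale d0 (@positive_id R H) (@positive_id R H).
rewrite (mean_normalized mtau) -/(scalar_op d) => ->; rewrite riZl.
have de : d * (ri x x + 1) = e by rewrite /d mulfVK // gt_eqF.
by lra.
Qed.

Section Projection.
Variables (P T : op H).
Hypotheses (hP : projection P) (pT : posinv_op T) (PT : forall x, T (P x) = P (T x)).
Let G := tau id T.
Let W := tau P (P \o T \o P).

(** On the range of P, the operator I tau T depends on P T P alone: the transformer inequality for P
    gives P G P <= W, monotonicity gives W <= G from P <= I and P T P <= T, and W vanishes on the
    range of Q = I - P. *)
Lemma mean_projection_aux :
  (forall x, ri (W x) x = ri (G (P x)) (P x)) /\ qle W G.
Proof.
have [sP PP] := hP; have [bP symP] := sP.
have pP := projection_positive hP; have pId := @positive_id R H.
have pPTP := positive_congr (proj1 pT) sP.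
have pW : positive_op W by exact: mean_pos.
have PidP : P \o id \o P = P by apply/funext => x /=; rewrite PP.
have h1 : qle (P \o G \o P) W by have := mean_transf pId (proj1 pT) pP; rewrite PidP.
have h2 : qle W G.
  apply: mean_le => // [|x|x]; first exact: (proj1 pT).
    rewrite -projection_ri //; have := ri_ge0 (x - P x); rewrite !riE (riC x).
    by rewrite projection_ri //; lra.
  have hQ := projection_complement hP; rewrite /= symP.
  have pos : 0 <= ri (T (x - P x)) (x - P x).
    by have := positive_op_ge0 (proj1 pT) (x - P x); rewrite mul0r.
  have [bT symT] := posinv_sa pT.
  move: pos; rewrite bopB // !riE.
  have e1 : ri (T (P x)) x = ri (T (P x)) (P x) by rewrite {1}PT -{1}PP symP -PT.
  have e2 : ri (T x) (P x) = ri (T (P x)) (P x) by rewrite symT riC e1.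
  by rewrite e1 e2; lra.
split=> // x; have [sW pW0] := (positive_op_sa pW, positive_op_ge0 pW).
have [bW symW] := sW.
pose Q := fun y => y - P y.
have [sQ QQ] : projection Q by exact: projection_complement.
have pQ := projection_positive (projection_complement hP).
(* Q W Q <= (Q P Q) tau (Q P T P Q) = 0 tau 0 <= 0. *)
have WQ y : W (Q y) = 0.
  apply: pos_eq0 => //; apply/le_anti/andP; split; last by have := pW0 (Q y); rewrite mul0r.
  have := mean_transf pP pPTP pQ y.
  have -> : (fun z => z - P z) \o P \o (fun z => z - P z) = (fun _ => 0).
    by apply/funext => z /=; rewrite PP subrr.
  have -> : (fun z => z - P z) \o (P \o T \o P) \o (fun z => z - P z) = (fun _ => 0).
    by apply/funext => z /=; rewrite PP subrr.
  by move=> /le_trans /(_ (mean_zero y)); rewrite /= (proj2 sQ).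
have WP y : W y = W (P y) by rewrite -{1}(subrK (P y) y) bopD // -/(Q y) WQ add0r.
apply/le_anti/andP; split.
  rewrite WP symW WP -symW; exact: h2.
by have := h1 x; rewrite /= symP.
Qed.

(** G - P G P is positive by [mean_projection_aux], and its form vanishes on the range of P; hence G
    P = P G P, and symmetry gives the commutation. *)
Lemma mean_comm_projection x : G (P x) = P (G x).
Proof.
have [eqW WG] := mean_projection_aux; have [sP PP] := hP; have [bP symP] := sP.
have sG : sa G by apply: positive_op_sa; apply: mean_pos; [exact: positive_id | exact: (proj1 pT)].
have [bG symG] := sG.
have sD := sa_sub sG (sa_congr sG sP).
have D0 y : G (P y) - P (G (P (P y))) = 0.
  apply: (pos_eq0 sD) => [z|]; rewrite !riE /= !symP.
    by rewrite mul0r -eqW subr_ge0.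
  by rewrite !PP subrr.
have GP y : G (P y) = P (G (P y)) by apply/eqP; rewrite -subr_eq0 -{2}PP D0.
apply/eqP; rewrite -subr_eq0; apply/eqP/ri_eq0.
have key z : ri (G (P x) - P (G x)) z = 0.
  by rewrite !riE GP !symP !symG !symP -!GP subrr.
exact: key.
Qed.

End Projection.

(** By [mean_projection_aux] the two sides are forms of P tau (P T P) and P tau (P S P), so it
    suffices to compare T and S on the range of P. *)
Lemma mean_projection_le P T S : projection P -> posinv_op T -> posinv_op S ->
  (forall x, T (P x) = P (T x)) -> (forall x, S (P x) = P (S x)) ->
  (forall x, ri (T (P x)) (P x) <= ri (S (P x)) (P x)) ->
  forall x, ri (tau id T (P x)) (P x) <= ri (tau id S (P x)) (P x).
Proof.
move=> hP pT pS PT PS h x.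
rewrite -!(proj1 (mean_projection_aux hP _ _)) //.
have [sP _] := hP; have pP := projection_positive hP.
have pcT := positive_congr (proj1 pT) sP; have pcS := positive_congr (proj1 pS) sP.
apply: mean_le => //.
by move=> y /=; rewrite !(proj2 sP).
Qed.

Lemma mean_projection_ge_rep P T l : projection P -> posinv_op T ->
  (forall x, T (P x) = P (T x)) -> 0 < l ->
  (forall x, l * ri (P x) (P x) <= ri (T (P x)) (P x)) ->
  forall x, g l * ri (P x) (P x) <= ri (tau id T (P x)) (P x).
Proof.
move=> hP pT PT l0 h x; have := @mean_projection_le P (scalar_op l) T hP (posinv_scalar H l0) pT.
rewrite mean_scalar // => h1; have := h1 _ PT _ x; rewrite riZl; apply=> y; last by rewrite riZl.
by rewrite /scalar_op (bopZ (proj1 (proj1 hP))).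
Qed.

Lemma mean_projection_le_rep P T l : projection P -> posinv_op T ->
  (forall x, T (P x) = P (T x)) -> 0 < l ->
  (forall x, ri (T (P x)) (P x) <= l * ri (P x) (P x)) ->
  forall x, ri (tau id T (P x)) (P x) <= g l * ri (P x) (P x).
Proof.
move=> hP pT PT l0 h x; have := @mean_projection_le P T (scalar_op l) hP pT (posinv_scalar H l0).
rewrite mean_scalar // => h1; have := h1 PT _ _ x; rewrite riZl; apply=> y; last by rewrite riZl.
by rewrite /scalar_op (bopZ (proj1 (proj1 hP))).
Qed.

End KuboAndo.

(** * Representing functions *)

Section Comparison.
Variables (R : realType) (H : hilbert R).
Hypothesis H_neq0 : exists v : H, v != 0.
Implicit Types (x y z : H) (c d e t l u p : R) (A B C G S T P : op H).

Lemma mean_id_sa sigma T : operator_mean sigma -> posinv_op T -> sa (sigma id T).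
Proof.
move=> hs pT; apply: positive_op_sa; apply: mean_pos => //; first exact: positive_id.
by case: pT.
Qed.

Lemma ri_partition (m : nat) (P : nat -> op H) G x : sa G ->
  (forall i, projection (P i) /\ forall y, G (P i y) = P i (G y)) ->
  \sum_(i < m) P i x = x -> ri (G x) x = \sum_(i < m) ri (G (P i x)) (P i x).
Proof.
move=> [bG symG] hP hx; rewrite -{1}hx (bop_sum bG).
rewrite (big_morph (fun y => ri y x) (fun y z => riDl y z x) (ri0l x)); apply: eq_bigr => i _.
by have [[[_ sP] PP] GP] := hP i; rewrite -{1}(PP x) GP sP.
Qed.

(** The projections commute with both means, so both forms split into blocks; on a block, I tau S is
    at most g (u i) and I sigma T at least f (v i). *)
Lemma mean_partition_le sigma tau f g (m : nat) (P : nat -> op H) (u v : nat -> R) S T k :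
  operator_mean sigma -> representing sigma f ->
  operator_mean tau -> representing tau g ->
  posinv_op S -> posinv_op T -> 0 <= k ->
  (forall i, [/\ projection (P i), forall x, S (P i x) = P i (S x) &
                 forall x, T (P i x) = P i (T x)]) ->
  (forall x, \sum_(i < m) P i x = x) ->
  (forall i, (i < m)%N -> [/\ 0 < u i, 0 < v i, g (u i) <= k * f (v i),
     forall x, ri (S (P i x)) (P i x) <= u i * ri (P i x) (P i x) &
     forall x, v i * ri (P i x) (P i x) <= ri (T (P i x)) (P i x)]) ->
  forall x, ri (tau id S x) x <= k * ri (sigma id T x) x.
Proof.
move=> ms rs mt rt pS pT k0 hP hsum huv x.
have h1 i : projection (P i) /\ forall y, tau id S (P i y) = P i (tau id S y).
  by have [p1 p2 p3] := hP i; split=> // y; exact: (mean_comm_projection mt p1 pS p2).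
have h2 i : projection (P i) /\ forall y, sigma id T (P i y) = P i (sigma id T y).
  by have [p1 p2 p3] := hP i; split=> // y; exact: (mean_comm_projection ms p1 pT p3).
rewrite (ri_partition (mean_id_sa mt pS) h1 (hsum x)).
rewrite (ri_partition (mean_id_sa ms pT) h2 (hsum x)) mulr_sumr.
apply: ler_sum => i _; have [u0 v0 guv hS hT] := huv i (ltn_ord i); have [p1 p2 p3] := hP i.
apply: le_trans (mean_projection_le_rep mt rt p1 pS p2 u0 hS x) _.
apply: le_trans (ler_wpM2r (ri_ge0 _) guv) _; rewrite -mulrA ler_wpM2l //.
exact: (mean_projection_ge_rep ms rs p1 pT p3 v0 hT x).
Qed.

Lemma ler_mul_gt1 (r s : R) : 0 <= s -> (forall c, 1 < c -> r <= c * s) -> r <= s.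
Proof.
move=> s0 h; apply/ler_addgt0Pr => e e0; have s1 : 0 < s + 1 by lra.
have := h (1 + e / (s + 1)) ltac:(by rewrite ltrDl divr_gt0).
have : e / (s + 1) * (s + 1) = e by rewrite mulfVK // gt_eqF.
have : 0 < e / (s + 1) by rewrite divr_gt0.
by move: (e / _) => d; nra.
Qed.

(** Both sides stand for f (T^p). On each block of a grid of ratio c, their forms agree up to a
    factor c because f ((c l)^p) <= c f (l^p), and c tends to 1. *)
Lemma mean_id_power sigma sigma_p f p T : operator_mean sigma -> representing sigma f ->
  operator_mean sigma_p -> representing sigma_p (fun t => f (t `^ p)) ->
  0 < p -> posinv_op T -> sigma_p id T = sigma id (power_op T p).
Proof.
move=> ms rs mp rp p0 pT; have pTp := power_posinv pT p; have p0' := ltW p0.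
have sG := mean_id_sa mp pT; have sG' := mean_id_sa ms pTp.
have pos (tau : op H -> op H -> op H) S x : operator_mean tau -> posinv_op S -> 0 <= ri (tau id S x) x.
  move=> mt pS; have := positive_op_ge0 (mean_pos mt (@positive_id R H) (proj1 pS)) x.
  by rewrite mul0r.
have fle c l : 1 < c -> 0 < l -> f ((c * l) `^ p) <= c * f (l `^ p).
  by move=> c1 l0; apply: (rep_scale mp rp H_neq0 (ltW c1) l0).
have part c : 1 < c -> exists (m : nat) (P : nat -> op H) (l : nat -> R),
  [/\ forall i, [/\ projection (P i), forall x, T (P i x) = P i (T x) &
                 forall x, power_op T p (P i x) = P i (power_op T p x)],
      forall i, 0 < l i, forall x, \sum_(i < m) P i x = x &
      forall i q x, (i < m)%N -> 0 <= q ->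
        l i `^ q * ri (P i x) (P i x) <= ri (power_op T q (P i x)) (P i x) /\
        ri (power_op T q (P i x)) (P i x) <= (c * l i) `^ q * ri (P i x) (P i x)].
  move=> c1; have [m [P [l [hP l0 hs hb]]]] := spectral_partition pT c1.
  exists m, P, l; split=> // i; have [hp PT] := hP i; split=> //.
  by apply: power_comm => //; case: hp => -[].
apply: qle_anti => // x; apply: ler_mul_gt1 => [|c c1]; try exact: pos.
- have [m [P [l [hP l0 hs hb]]]] := part c c1.
  apply: (@mean_partition_le _ _ _ _ m P (fun i => c * l i) (fun i => l i `^ p) _ _ _ ms rs mp rp) => //; first by lra.
  move=> i im; have cl0 : 0 < c * l i by rewrite mulr_gt0 //; lra.
  split=> // [||y|y]; [exact: powR_gt0 | exact: fle | | by case: (hb i p y im p0')].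
  by have [_] := hb i 1 y im ler01; rewrite powRr1 ?power1 // ltW.
- have [m [P [l [hP l0 hs hb]]]] := part c c1.
  apply: (@mean_partition_le _ _ _ _ m P (fun i => (c * l i) `^ p) (fun i => l i) _ _ _ mp rp ms rs) => //; first by lra.
    by move=> i; have [] := hP i.
  move=> i im; have cl0 : 0 < c * l i by rewrite mulr_gt0 //; lra.
  split=> // [||y|y]; [exact: powR_gt0 | exact: fle | by case: (hb i p y im p0') | ].
  by have [+ _] := hb i 1 y im ler01; rewrite powRr1 ?power1 // ltW.
Qed.

Lemma finite_gap (m : nat) (u v : nat -> R) : (forall i, 0 < v i) -> (forall i, u i < v i) ->
  exists2 k, 0 < k < 1 & forall i, (i < m)%N -> u i <= k * v i.
Proof.
move=> v0 uv; elim: m => [|m [k /andP[k0 k1] hk]].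
  by exists 2^-1 => //; rewrite invr_gt0 invf_lt1 ?ltr0n ?ltr1n.
exists (Num.max k (u m / v m)).
  by rewrite lt_max k0 gt_max k1 ltr_pdivrMr // mul1r uv.
move=> i; rewrite ltnS leq_eqVlt => /predU1P[->|/hk h].
  by rewrite -ler_pdivrMr // le_max lexx orbT.
by apply: le_trans h _; rewrite ler_pM2r // le_max lexx.
Qed.

Lemma mean_id_gap sigma f T a : operator_mean sigma -> representing sigma f ->
  (forall s t, 0 < s -> s < t -> f s < f t) -> posinv_op T -> 1 < a ->
  exists2 k, 0 < k < 1 & forall x,
    ri (sigma id (fun y => (a^-1)%:C *: T y) x) x <= k * ri (sigma id T x) x.
Proof.
move=> ms rs fincr pT a1; have a0 : 0 < a by lra.
(* With c < a, the upper bound a^-1 (c l_i) of a^-1 T on a block stays strictly below the lower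
   bound l_i of T, so strictness of f applies on each of the finitely many blocks. *)
pose c := (1 + a) / 2; have c1 : 1 < c by rewrite /c; lra.
have ca : a^-1 * c < 1 by rewrite ltr_pdivrMl //; rewrite /c; lra.
have [m [P [l [hP l0 hs hb]]]] := spectral_partition pT c1.
have ai : 0 < a^-1 by rewrite invr_gt0.
have u0 i : 0 < a^-1 * (c * l i) by rewrite !mulr_gt0 //; lra.
have ul i : a^-1 * (c * l i) < l i by rewrite mulrA gtr_pMl.
have [k /andP[k0 k1] hk] := finite_gap m (fun i => rep_gt0 ms rs H_neq0 (l0 i))
  (fun i => fincr _ _ (u0 i) (ul i)).
exists k; first by rewrite k0.
apply: (@mean_partition_le _ _ _ _ m P _ l _ _ _ ms rs ms rs) => //.
- exact: posinv_scale.
- exact: ltW.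
- move=> i; have [hp PT] := hP i; split=> // x.
  by rewrite PT (bopZ (proj1 (proj1 hp))).
move=> i im; split; [exact: u0 | by [] | exact: hk | |] => x.
  rewrite riZl -mulrA ler_pM2l //; have [_] := hb i 1 x im ler01.
  by rewrite power1 // powRr1 // mulr_ge0 ?ltW //; lra.
by have [+ _] := hb i 1 x im ler01; rewrite power1 // powRr1 // ltW.
Qed.

End Comparison.

(** * Strict monotonicity of representing functions *)

Section Strictness.
Variables (R : realType) (H : hilbert R).
Implicit Types (x y z e : H) (c d s t l u : R) (A B C G S T P E : op H).

Definition rank_one e : op H := fun x => inner H x e *: e.

(** The complex line of e is spanned over R by e and 'i e, whence two real coordinates. *)
Lemma rank_oneE e x : rank_one e x = (ri x e)%:C *: e + (ri x ('i *: e))%:C *: ('i *: e).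
Proof.
rewrite /rank_one -inner_Im scalerA -scalerDl; congr (_ *: _).
by rewrite [LHS]complexE mulrC.
Qed.

Lemma ri_ii x y : ri ('i *: x) ('i *: y) = ri x y.
Proof. by rewrite -inner_Im inner_Im' scalerA -expr2 sqr_i scaleN1r riNl opprK. Qed.

Lemma ri_xi x : ri x ('i *: x) = 0.
Proof. by have := inner_Im' x x; rewrite inner_Im (riC _ x); lra. Qed.

Lemma ri_i x y : ri ('i *: x) y = - ri x ('i *: y).
Proof. by have := inner_Im' x y; rewrite inner_Im; lra. Qed.

Lemma rank_one_ri e x : ri (rank_one e x) x = ri x e ^+ 2 + ri x ('i *: e) ^+ 2.
Proof. by rewrite rank_oneE !riE (riC e) (riC ('i *: e)); ring. Qed.

Lemma rank_one_projection e : ri e e = 1 -> projection (rank_one e).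
Proof.
move=> e1; split; last first.
  by move=> x; rewrite /rank_one linearZl_LR /= innerxx e1 mulr1.
split; last by move=> x y; rewrite !rank_oneE !riE (riC e) (riC ('i *: e)); ring.
apply: (@mk_bop _ _ _ 2) => [k x y|x].
  by rewrite /rank_one linearPl scalerDl scalerA.
have n1 z : ri z z = 1 -> nn z = 1 by move=> z1; rewrite /nn z1 sqrtr1.
rewrite rank_oneE; apply: le_trans (nnD _ _) _; rewrite !nnZ.
have := ri_cs x e; have := ri_cs x ('i *: e).
by rewrite (n1 e) // (n1 ('i *: e)) ?ri_ii // !mulr1; lra.
Qed.

(** For a unit vector e, this is u on the complex line of e and c on its orthogonal complement. *)
Definition rank_one_op u c e : op H := fun x => c%:C *: x + (u - c)%:C *: rank_one e x.

Lemma rank_one_op_ri u c e x : ri (rank_one_op u c e x) x =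
  c * ri x x + (u - c) * ri (rank_one e x) x.
Proof. by rewrite /rank_one_op !riE. Qed.

Lemma rank_one_ge0 e x : 0 <= ri (rank_one e x) x.
Proof. by rewrite rank_one_ri addr_ge0 ?sqr_ge0. Qed.

Lemma rank_one_le e x : ri e e = 1 -> ri (rank_one e x) x <= ri x x.
Proof.
move=> /rank_one_projection hE; have hQ := projection_complement hE.
by rewrite -subr_ge0 -riNl -riDl -(projection_ri _ hQ) ri_ge0.
Qed.

Lemma rank_one_op_posinv u c e : 0 < u -> 0 < c -> ri e e = 1 -> posinv_op (rank_one_op u c e).
Proof.
move=> u0 c0 e1; apply/posinvP; split.
  apply: sa_add; first exact: sa_scalar.
  by apply: sa_scale; case: (rank_one_projection e1).
exists (Num.min u c) => [|x]; first by rewrite lt_min u0.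
rewrite rank_one_op_ri; have := rank_one_le x e1; have := rank_one_ge0 e x.
have : Num.min u c <= u by rewrite ge_min lexx.
have : Num.min u c <= c by rewrite ge_min lexx orbT.
by move: (Num.min _ _) (ri x x) (ri _ x) => *; nra.
Qed.

Section Mean.
Variables (sigma : op H -> op H -> op H) (f : R -> R).
Hypotheses (ms : operator_mean sigma) (rs : representing sigma f).

(** [rank_one_op] is exactly scalar on the line of e and on its complement, so the upper and lower
    block estimates coincide. *)
Lemma mean_rank_one u c e x : 0 < u -> 0 < c -> ri e e = 1 ->
  ri (sigma id (rank_one_op u c e) x) x =
  f c * ri x x + (f u - f c) * ri (rank_one e x) x.
Proof.
move=> u0 c0 e1; have pT := rank_one_op_posinv u0 c0 e1; set T := rank_one_op u c e in pT *.
have hE := rank_one_projection e1; have hQ := projection_complement hE.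
have [[bE symE] EE] := hE; have [[bQ symQ] QQ] := hQ.
have TE y : T (rank_one e y) = rank_one e (T y).
  by rewrite /T /rank_one_op (bopD bE) !(bopZ bE).
have TQ y : T (y - rank_one e y) = T y - rank_one e (T y).
  by rewrite (bopB (posinv_bop pT)) TE.
have TE' y : T (rank_one e y) = u%:C *: rank_one e y.
  by rewrite /T /rank_one_op EE -scalerDl -rmorphD addrC subrK.
have TQ' y : T (y - rank_one e y) = c%:C *: (y - rank_one e y).
  by rewrite /T /rank_one_op (bopB bE) EE subrr scaler0 addr0.
have G1 : ri (sigma id T (rank_one e x)) (rank_one e x) = f u * ri (rank_one e x) (rank_one e x).
  apply/le_anti/andP; split.
    by apply: (mean_projection_le_rep ms rs hE pT TE u0) => y; rewrite TE' riZl.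
  by apply: (mean_projection_ge_rep ms rs hE pT TE u0) => y; rewrite TE' riZl.
have G2 : ri (sigma id T (x - rank_one e x)) (x - rank_one e x) = f c * ri (x - rank_one e x) (x - rank_one e x).
  apply/le_anti/andP; split.
    by apply: (mean_projection_le_rep ms rs hQ pT TQ c0) => y; rewrite TQ' riZl.
  by apply: (mean_projection_ge_rep ms rs hQ pT TQ c0) => y; rewrite TQ' riZl.
have [bG symG] := mean_id_sa ms pT.
have GE y : sigma id T (rank_one e y) = rank_one e (sigma id T y).
  exact: (mean_comm_projection ms hE pT TE).
have -> : ri (sigma id T x) x = ri (sigma id T (rank_one e x)) (rank_one e x)
    + ri (sigma id T (x - rank_one e x)) (x - rank_one e x).
  rewrite (bopB bG) GE !riE (symE _ (rank_one e x)) EE -!(symE (sigma id T x)).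
  by ring.
rewrite G1 G2 !riE (riC x) (projection_ri _ hE); ring.
Qed.

Section TwoVectors.
Variables (e e' : H).
Hypotheses (e1 : ri e e = 1) (e1' : ri e' e' = 1) (ee : ri e e' = 0) (eie : ri e ('i *: e') = 0).

Let bessel x : ri x e ^+ 2 + ri x ('i *: e) ^+ 2 + (ri x e' ^+ 2 + ri x ('i *: e') ^+ 2) <= ri x x.
Proof.
rewrite -!rank_one_ri.
have hE := rank_one_projection e1; have hE' := rank_one_projection e1'.
have h : ri (rank_one e x) (rank_one e' x) = 0.
  by rewrite !rank_oneE !riE ri_ii ri_i ee eie; ring.
have := ri_ge0 (x - rank_one e x - rank_one e' x); rewrite !riE (riC x (rank_one e x)) (riC x (rank_one e' x)).
rewrite (riC (rank_one e' x) (rank_one e x)) h !(projection_ri _ hE) !(projection_ri _ hE').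
by lra.
Qed.

(** Rotating e towards e' by an angle of sine s moves the projection onto its line by O(s); Bessel's
    inequality for e, e' turns the coordinatewise estimate into one against |x|^2. *)
Let rank_one_close s c x : 0 <= s -> 0 <= c -> c ^+ 2 + s ^+ 2 = 1 ->
  `|ri (rank_one (c%:C *: e + s%:C *: e') x) x - ri (rank_one e x) x| <= 2 * s * ri x x.
Proof.
move=> s0 c0 cs; rewrite !rank_one_ri; have := bessel x.
have -> : 'i *: (c%:C *: e + s%:C *: e') = c%:C *: ('i *: e) + s%:C *: ('i *: e') :> H.
  by rewrite scalerDr !scalerA !(mulrC 'i).
rewrite !riE; move: (ri x e) (ri x e') (ri x ('i *: e)) (ri x ('i *: e')) (ri x x).
move=> a b a' b' n bes; have s1 : s <= 1 by nra.
have c1 : c <= 1 by nra.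
have key (p q : R) : `|(c * p + s * q) ^+ 2 - p ^+ 2| <= 2 * s * (p ^+ 2 + q ^+ 2).
  have -> : (c * p + s * q) ^+ 2 - p ^+ 2 = s ^+ 2 * (q ^+ 2 - p ^+ 2) + s * (2 * c * p * q).
    have cE : c ^+ 2 = 1 - s ^+ 2 by lra.
    by rewrite !sqrrD !exprMn cE; ring.
  have h1 : `|2 * c * p * q| <= p ^+ 2 + q ^+ 2.
    have := sqr_ge0 (p - q); have := sqr_ge0 (p + q).
    rewrite ler_norml => h2 h3; apply/andP; split; nra.
  have h2 : `|q ^+ 2 - p ^+ 2| <= p ^+ 2 + q ^+ 2.
    by rewrite ler_norml; have := sqr_ge0 p; have := sqr_ge0 q => *; apply/andP; split; lra.
  apply: le_trans (ler_normD _ _) _; rewrite (normrM (s ^+ 2)) (ger0_norm (exprn_ge0 2 s0)) (normrM s) (ger0_norm s0).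
  have ss : s ^+ 2 <= s by nra.
  have pq : 0 <= p ^+ 2 + q ^+ 2 by rewrite addr_ge0 ?sqr_ge0.
  move: h1 h2; move: (`|2 * c * p * q|) (`|q ^+ 2 - p ^+ 2|) (p ^+ 2 + q ^+ 2) pq => u v w w0 h1 h2.
  have : s ^+ 2 * v <= s * w by apply: le_trans (ler_wpM2l (exprn_ge0 2 s0) h2) _; rewrite ler_wpM2r.
  have : s * u <= s * w by rewrite ler_wpM2l.
  by lra.
have -> : (c * a + s * b) ^+ 2 + (c * a' + s * b') ^+ 2 - (a ^+ 2 + a' ^+ 2) =
   ((c * a + s * b) ^+ 2 - a ^+ 2) + ((c * a' + s * b') ^+ 2 - a' ^+ 2) by ring.
apply: le_trans (ler_normD _ _) _; have := key a b; have := key a' b'.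
have : 2 * s * (a ^+ 2 + a' ^+ 2 + (b ^+ 2 + b' ^+ 2)) <= 2 * s * n by rewrite ler_wpM2l // mulr_ge0.
by lra.
Qed.

(* Two nearby rank one perturbations u E + m (1 - E) <= u' Q + m' (1 - Q) with
   m < m' and f m = f m': testing the monotonicity of f on vectors orthogonal to
   the ranges of Q and of E gives f u <= f m <= f u'. *)
Lemma rep_flat m m' u u' : 0 < m -> m < m' -> f m = f m' -> 0 < u -> u < u' ->
  f u <= f m <= f u'.
Proof.
move=> m0 mm fm u0 uu; have m0' : 0 < m' by lra. have u0' : 0 < u' by lra.
pose k := Num.min (u' - u) (m' - m).
have k0 : 0 < k by rewrite lt_min !subr_gt0 uu.
have k1 : k <= u' - u by rewrite ge_min lexx.
have k2 : k <= m' - m by rewrite ge_min lexx orbT.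
pose d := `|u' - m'|; have d0 : 0 <= d := normr_ge0 _.
(* The rotation changes the larger operator by at most 2 s d in the form, which the slack k of u <
   u' and m < m' absorbs. *)
pose s := Num.min (1 / 2) (k / (2 * (d + 1))).
have dd : 0 < 2 * (d + 1) by lra.
have s0 : 0 < s by rewrite lt_min !divr_gt0.
have s1 : s <= 1 / 2 by rewrite ge_min lexx.
have sk : s * (2 * (d + 1)) <= k by rewrite -ler_pdivlMr // ge_min lexx orbT.
pose c := Num.sqrt (1 - s ^+ 2); have c0 : 0 <= c := sqrtr_ge0 _.
have c2 : c ^+ 2 = 1 - s ^+ 2 by rewrite sqr_sqrtr //; nra.
have cs : c ^+ 2 + s ^+ 2 = 1 by lra.
pose q := c%:C *: e + s%:C *: e'.
have q1 : ri q q = 1 by rewrite /q !riE (riC e') e1 e1' ee; nra.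
have pT := rank_one_op_posinv u0 m0 e1; have pS := rank_one_op_posinv u0' m0' q1.
have TS : qle (rank_one_op u m e) (rank_one_op u' m' q).
  move=> x; rewrite !rank_one_op_ri.
  have := rank_one_close x (ltW s0) c0 cs; rewrite -/q.
  have := rank_one_ge0 e x; have := rank_one_le x e1; have := ri_ge0 x.
  move: (ri (rank_one q x) x) (ri (rank_one e x) x) (ri x x) => p a n n0 an a0 hp.
  have h : (u' - m') * (p - a) >= - (k * n).
    have : `|(u' - m') * (p - a)| <= k * n.
      rewrite normrM; apply: le_trans (ler_wpM2l d0 hp) _.
      have -> : d * (2 * s * n) = (2 * d * s) * n by ring.
      by rewrite ler_wpM2r //; lra.
    by rewrite ler_norml => /andP[].
  have : k * (n - a) <= (m' - m) * (n - a) by rewrite ler_wpM2r //; lra.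
  have : k * a <= (u' - u) * a by rewrite ler_wpM2r.
  by lra.
have pId := @positive_id R H.
have G := mean_le ms pId (proj1 pT) pId (proj1 pS) (fun x => lexx _) TS.
have eie' : ri e' ('i *: e) = 0 by rewrite riC ri_i eie oppr0.
have e'e : ri e' e = 0 by rewrite riC.
have iq : 'i *: q = c%:C *: ('i *: e) + s%:C *: ('i *: e').
  by rewrite /q scalerDr !scalerA !(mulrC 'i).
have ss : 0 < s ^+ 2 by rewrite exprn_gt0.
apply/andP; split.
  (* A unit vector orthogonal to q with component s along e: the right side is f m' = f m, the left
     side f m + (f u - f m) s^2. *)
  have := G (s%:C *: e - c%:C *: e'); rewrite !mean_rank_one // !rank_one_ri iq /q.
  rewrite !riE e1 e1' ee eie e'e eie' !ri_xi -fm.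
  set lhs := (X in X <= _ -> _); set rhs := (X in _ <= X -> _).
  have -> : lhs = f m + (f u - f m) * s ^+ 2 by rewrite /lhs; have cE := c2; ring: cE.
  have -> : rhs = f m by rewrite /rhs; ring: c2.
  by nra.
(* Now e' is orthogonal to e and has component s along q, so the left side is f m and the right side
   f m + (f u' - f m) s^2. *)
have := G e'; rewrite !mean_rank_one // !rank_one_ri iq /q.
rewrite !riE e1' e'e eie' !ri_xi -fm.
set lhs := (X in X <= _ -> _); set rhs := (X in _ <= X -> _).
have -> : lhs = f m by rewrite /lhs; ring.
have -> : rhs = f m + (f u' - f m) * s ^+ 2 by rewrite /rhs; ring.
by nra.
Qed.

End TwoVectors.

Hypothesis H_neq0 : exists v : H, v != 0.

(** Congruence by A^(1/2) reduces to I sigma T, which is squeezed between I sigma (a I) = I and I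
    sigma (b I) = I. *)
Lemma posinv_mean_const A B : (forall t, 0 < t -> f t = 1) -> posinv_op A -> posinv_op B ->
  sigma A B = A.
Proof.
move=> f1 pA pB; pose K := power_op A (1 / 2); have pK := power_posinv pA (1 / 2).
pose J := power_op A (- (1 / 2)); have pJ := power_posinv pA (- (1 / 2)).
have pT := posinv_congr pB pJ; set T := J \o B \o J in pT.
have [a [b [a0 ab ha hb]]] := posinv_interval pT; have b0 : 0 < b by lra.
have pId := @positive_id R H.
have sId : sigma id T = id.
  have sG := mean_id_sa ms pT.
  have hTb : qle T (scalar_op b) by move=> x; rewrite riZl.
  have hTa : qle (scalar_op a) T by move=> x; rewrite riZl.
  have h1 := mean_le ms pId (proj1 pT) pId (proj1 (posinv_scalar H b0)) (fun x => lexx _) hTb.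
  have h2 := mean_le ms pId (proj1 (posinv_scalar H a0)) pId (proj1 pT) (fun x => lexx _) hTa.
  move: h1 h2; rewrite !rs // !f1 // scalar_op1 => h1 h2.
  by apply: qle_anti => //; exact: sa_id.
have := mean_congr ms pId (proj1 pT) pK; rewrite sId.
have -> : K \o id \o K = A.
  by apply/funext => x; rewrite /= /K powerD // -[in RHS](power1 pA); congr (power_op A _ x); field.
have -> // : K \o T \o K = B.
by apply/funext => x; rewrite /T /= /K /J powerVK // powerKV.
Qed.

(** [left_trivial] also speaks of non-invertible positive operators; these are approached from above
    by S + eps I, where the downward continuity of the mean applies. *)
Lemma mean_const_left_trivial : (forall t, 0 < t -> f t = 1) -> left_trivial sigma.
Proof.
move=> f1 A B pA pB.
pose eps (k : nat) : R := k.+1%:R^-1; have eps0 k : 0 < eps k by rewrite invr_gt0.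
pose shift (S : op H) k := fun x => S x + (eps k)%:C *: x.
have pshift S k : positive_op S -> posinv_op (shift S k).
  move=> /positive_opP[sS pS]; apply/posinvP; split.
    by apply: sa_add => //; exact: sa_scalar.
  by exists (eps k) => // x; rewrite !riE lerDr; have := pS x; rewrite mul0r.
have eps_small (K r : R) : 0 <= K -> 0 < r -> exists N, forall k, (N <= k)%N -> eps k * K <= r.
  move=> K0 r0; have [N hN] := inv_nat_small K0 r0; exists N => k /hN.
  by rewrite mulrC.
have lim S x : seqlim (fun k => shift S k x) (S x).
  move=> e e0; have [N hN] := eps_small _ _ (nn_ge0 x) e0; exists N => k /hN h.
  by rewrite /shift addrC addKr nnZ gtr0_norm.
have dec S : positive_op S -> decr_to (shift S) S.
  move=> pS; split=> [k|x]; last exact/seqlimP.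
  apply/le_opP; try by apply: posinv_sa; exact: pshift.
  move=> x; rewrite !riE lerD2l ler_wpM2r ?ri_ge0 //.
  by rewrite lef_pV2 ?posrE ?ltr0n // ler_nat.
have [_ h] := mean_continuous ms (fun k => proj1 (pshift A k pA)) (fun k => proj1 (pshift B k pB))
  pA pB (dec A pA) (dec B pB).
apply/funext => x; have /seqlimP hx := h x; apply: seqlim_unique hx _.
by apply: seqlim_eq (lim A x); exists 0 => k _; rewrite posinv_mean_const //; exact: pshift.
Qed.

End Mean.
End Strictness.

(** * Deformed means *)

Section Dimension.
Variables (R : realType) (H : hilbert R).

Lemma normalize_vector (x : H) : x != 0 -> exists2 c : R, 0 < c & ri (c%:C *: x) (c%:C *: x) = 1.
Proof.
move=> x0; have n0 := nn_gt0 x0; exists (nn x)^-1; first by rewrite invr_gt0.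
by rewrite !riE -nn_sqr; field; rewrite gt_eqF.
Qed.

Lemma infinite_dimensional_neq0 : infinite_dimensional H -> exists v : H, v != 0.
Proof.
move=> hd; have [x hx] := hd 0 (fun _ => 0); exists x.
by have := hx (fun _ => 0); rewrite big_ord0.
Qed.

(** The last two equations together express orthogonality for the complex inner product; e' comes
    from one Gram-Schmidt step on a vector outside the line of e. *)
Lemma orthonormal_pair : infinite_dimensional H -> exists e e' : H,
  [/\ ri e e = 1, ri e' e' = 1, ri e e' = 0 & ri e ('i *: e') = 0].
Proof.
move=> hd; have [x x0] := infinite_dimensional_neq0 hd.
have [c _ e1] := normalize_vector x0; set e := c%:C *: x in e1.
have [y hy] := hd 1 (fun _ => e).
have y0 : y - rank_one e y != 0.
  by have := hy (fun _ => inner H y e); rewrite big_ord1 subr_eq0.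
have [d _ e1'] := normalize_vector y0; exists e, (d%:C *: (y - rank_one e y)).
have [[_ sE] EE] := rank_one_projection e1.
have Ee : rank_one e e = e by rewrite /rank_one innerxx e1 scale1r.
have Eie : rank_one e ('i *: e) = 'i *: e.
  by rewrite /rank_one linearZl_LR /= innerxx e1 mulr1.
have orth z : rank_one e z = z -> ri z (y - rank_one e y) = 0.
  by move=> hz; rewrite !riE -sE hz subrr.
split=> //; first by rewrite riZr orth // mulr0.
by rewrite -[LHS]opprK -ri_i riZr orth // mulr0 oppr0.
Qed.

(** A flat piece f s = f t makes f constant by [rep_flat], used with u < 2 u for the upper and u / 2
    < u for the lower estimate. The constant is f 1 = 1, and the mean would be left trivial. *)
Lemma rep_increasing (sigma : op H -> op H -> op H) (f : R -> R) :
  infinite_dimensional H -> operator_mean sigma -> representing sigma f ->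
  ~ left_trivial sigma -> forall s t, 0 < s -> s < t -> f s < f t.
Proof.
move=> hd ms rs nlt s t s0 st; have v0 := infinite_dimensional_neq0 hd.
have [e [e' [e1 e1' ee eie]]] := orthonormal_pair hd.
rewrite lt_def (rep_le ms rs v0 s0 (ltW st)) andbT; apply/negP => /eqP fst; apply: nlt.
have const u : 0 < u -> f u = f s.
  move=> u0; apply/le_anti/andP; split.
    by have /andP[] := rep_flat ms rs e1 e1' ee eie s0 st (esym fst) u0 (ltac:(lra) : u < 2 * u).
  by have /andP[] := rep_flat ms rs e1 e1' ee eie s0 st (esym fst) (ltac:(lra) : 0 < u / 2) (ltac:(lra) : u / 2 < u).
apply: (mean_const_left_trivial ms rs) => u u0.
by rewrite const // -(const 1) // (rep1 ms rs v0).
Qed.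

End Dimension.

Section DeformedMean.
Variables (R : realType) (H : hilbert R) (n : nat) (M : ('I_n -> op H) -> op H).
Hypotheses (mM : nvar_operator_mean M) (H_neq0 : exists v : H, v != 0).
Implicit Types (x y z : H) (c d e t l u p : R) (X Y U V Z : op H) (A B : 'I_n -> op H).

Lemma finite_bound (u : 'I_n -> R) : exists2 k, 1 < k & forall j, u j <= k.
Proof.
have s0 : 0 <= \sum_(i < n) `|u i| by apply: sumr_ge0.
exists (2 + \sum_(i < n) `|u i|) => [|j]; first by lra.
apply: le_trans (ler_norm _) _; rewrite (bigD1 j) //=.
have : 0 <= \sum_(i < n | i != j) `|u i| by apply: sumr_ge0.
by lra.
Qed.

Lemma posinv_common_bounds A : (forall j, posinv_op (A j)) ->
  exists a b, [/\ 0 < a, 0 < b, forall j, lbd (A j) a & forall j, ubd (A j) b].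
Proof.
move=> pA.
have h1 : forall j, exists a, 0 < a /\ lbd (A j) a.
  by move=> j; have /posinvP[_ [d d0 hd]] := pA j; exists d.
have h2 : forall j, exists b, ubd (A j) b.
  by move=> j; have [b _ [hb _]] := sa_bound (posinv_sa (pA j)); exists b.
have [a ha] := choice h1; have [b hb] := choice h2.
have [k k1 hk] := finite_bound (fun j => (a j)^-1); have [l l1 hl] := finite_bound b.
exists k^-1, l; split; [by rewrite invr_gt0; lra | by lra | |] => j x.
  have [a0 haj] := ha j; apply: le_trans (haj x); rewrite ler_wpM2r ?ri_ge0 //.
  by rewrite -[leRHS]invrK lef_pV2 ?posrE ?invr_gt0 //; lra.
by apply: le_trans (hb j x) _; rewrite ler_wpM2r ?ri_ge0.
Qed.

Lemma nmean_le A B : (forall j, posinv_op (A j)) -> (forall j, posinv_op (B j)) ->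
  (forall j, qle (A j) (B j)) -> qle (M A) (M B).
Proof.
move=> pA pB h; apply/le_opP; try by apply: posinv_sa; exact: (nmean_posinv mM).
by apply: (nmean_monotone mM) => // j; apply/le_opP; [exact: posinv_sa | exact: posinv_sa | exact: h].
Qed.

Lemma nmean_scale c A : 0 < c -> (forall j, posinv_op (A j)) ->
  M (fun j x => c%:C *: A j x) = (fun x => c%:C *: M A x).
Proof.
move=> c0 pA; pose s : op H := scalar_op (Num.sqrt c).
have sc : 0 < Num.sqrt c by rewrite sqrtr_gt0.
have key S : bounded_op S -> s \o S \o s = (fun x => c%:C *: S x).
  move=> bS; apply/funext => x; rewrite /s /= /scalar_op (bopZ bS) scalerA -rmorphM.
  by rewrite -expr2 sqr_sqrtr // ltW.
have ps := posinv_scalar H sc.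
have adj : adjoint_of s s.
  move=> x y; rewrite /s /scalar_op linearZl_LR linearZr_LR /=.
  by congr (_ * _); apply/eqP; rewrite eq_complex /= oppr0 !eqxx.
rewrite -(key _ (posinv_bop (nmean_posinv mM pA))).
rewrite (nmean_congruence mM pA (posinv_bop ps) (proj2 ps) (posinv_bop ps) adj).
by congr M; apply/funext => j; rewrite key //; exact: posinv_bop.
Qed.

Lemma nmean_scalar c : 0 < c -> M (fun _ => scalar_op c) = scalar_op c.
Proof.
move=> c0; have pId : forall j : 'I_n, posinv_op (id : op H).
  by move=> _; rewrite -scalar_op1; exact: posinv_scalar.
by have := nmean_scale c0 pId; rewrite (nmean_normalized mM).
Qed.

Section Sigma.
Variables (sigma : op H -> op H -> op H).
Hypothesis ms : operator_mean sigma.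

Lemma mean_scalar_scalar c : 0 < c -> sigma (scalar_op c) (scalar_op c) = scalar_op c.
Proof.
move=> c0; have := mean_scale ms c0 (@positive_id R H) (@positive_id R H).
by rewrite (mean_normalized ms).
Qed.

Lemma mean_lbd X Y d : 0 < d -> posinv_op X -> posinv_op Y -> lbd X d -> lbd Y d ->
  lbd (sigma X Y) d.
Proof.
move=> d0 pX pY hX hY x; have pd := proj1 (posinv_scalar H d0).
have := mean_le ms pd pd (proj1 pX) (proj1 pY) _ _ x.
by rewrite mean_scalar_scalar // riZl; apply=> y; rewrite riZl.
Qed.

Lemma mean_posinv X Y : posinv_op X -> posinv_op Y -> posinv_op (sigma X Y).
Proof.
move=> pX pY; apply/posinvP; split.
  by apply: positive_op_sa; apply: (mean_pos ms); [exact: (proj1 pX) | exact: (proj1 pY)].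
have /posinvP[_ [d d0 hd]] := pX; have /posinvP[_ [e e0 he]] := pY.
have m0 : 0 < Num.min d e by rewrite lt_min d0.
exists (Num.min d e) => //; apply: mean_lbd => // x.
  by apply: le_trans (hd x); rewrite ler_wpM2r ?ri_ge0 // ge_min lexx.
by apply: le_trans (he x); rewrite ler_wpM2r ?ri_ge0 // ge_min lexx orbT.
Qed.

Definition deform A X := M (fun j => sigma X (A j)).

Section FixedA.
Variable A : 'I_n -> op H.
Hypothesis pA : forall j, posinv_op (A j).

Lemma deform_posinv X : posinv_op X -> posinv_op (deform A X).
Proof. by move=> pX; apply: (nmean_posinv mM) => j; exact: mean_posinv. Qed.

Lemma deform_le X Y : posinv_op X -> posinv_op Y -> qle X Y -> qle (deform A X) (deform A Y).
Proof.
move=> pX pY h; apply: nmean_le => j; try exact: mean_posinv.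
by apply: mean_le => //; [exact: (proj1 pX) | exact: (proj1 (pA j)) | exact: (proj1 pY) | exact: (proj1 (pA j))].
Qed.

(* The iterates of deform A from an upper bound b of all the A j decrease and
   stay above a common lower bound. *)
Lemma deform_fixpoint : exists X, posinv_op X /\ X = deform A X.
Proof.
have [a [b [a0 b0 ha hb]]] := posinv_common_bounds pA.
pose X k := iter k (deform A) (scalar_op b).
have pX k : posinv_op (X k).
  by elim: k => [|k IH]; [exact: posinv_scalar | exact: deform_posinv].
(* For n = 0 no A j relates a to b; M then has a single value, which normalization makes the
   identity. *)
have [j0|j0] := pselect (exists j : 'I_n, True); last first.
  have hM A' A'' : M A' = M A''.
    by congr M; apply/funext => j; case: j0; exists j.
  exists (scalar_op 1); split; first exact: posinv_scalar.
  by rewrite -(nmean_scalar ltr01); exact: hM.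
have ab : a <= b.
  have [j _] := j0; apply/(scalar_qle H_neq0) => x; rewrite !riZl.
  exact: le_trans (ha j x) (hb j x).
have lX k : qle (scalar_op a) (X k).
  elim: k => [|k IH]; first by move=> x; rewrite !riZl ler_wpM2r ?ri_ge0.
  have pa := posinv_scalar H a0.
  rewrite -(nmean_scalar a0); apply: nmean_le => // j; first exact: mean_posinv.
  move=> x; rewrite riZl; apply: mean_lbd => // y; by have := IH y; rewrite riZl.
have dX k : qle (X k.+1) (X k).
  elim: k => [|k IH]; last exact: (deform_le (pX k.+1) (pX k) IH).
  have pb := posinv_scalar H b0.
  rewrite /X /= -[X in qle _ X](nmean_scalar b0); apply: nmean_le => // j; first exact: mean_posinv.
  rewrite -[X in qle _ X](mean_scalar_scalar b0).
  apply: (mean_le ms (proj1 pb) (proj1 (pA j)) (proj1 pb) (proj1 pb) (fun x => lexx _)) => x.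
  by rewrite riZl; exact: hb.
have [L [sL _ hL LX]] := monotone_limit (fun k => posinv_sa (pX k)) dX
  (fun k => positive_op_ge0 (proj1 (pX k))).
have pL : posinv_op L.
  apply/posinvP; split=> //; exists a => // x.
  by apply: (seqlim_ri_ge (hL x)) => k; have := lX k x; rewrite riZl.
exists L; split=> //.
have decX : decr_to X L.
  split=> [k|x]; last exact/seqlimP.
  by apply/le_opP; [exact: posinv_sa | exact: posinv_sa | exact: dX].
have decA j : decr_to (fun _ => A j) (A j).
  split=> [k|x]; last by apply/seqlimP; exact: seqlim_cst.
  by apply/le_opP => //; exact: posinv_sa.
have cont := @nmean_continuous _ _ _ _ mM (fun k j => sigma (X k) (A j)) (fun j => sigma L (A j)).
apply/funext => x; apply: seqlim_unique (seqlim_shift (hL x)) _; apply/seqlimP; apply: cont.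
- by move=> k j; exact: mean_posinv.
- by move=> j; exact: mean_posinv.
- left=> j; apply: (mean_continuous ms (fun k => proj1 (pX k)) (fun _ => proj1 (pA j)) (proj1 pL) (proj1 (pA j)) decX (decA j)).
Qed.

Lemma deformed_meanP : posinv_op (deformed_mean M sigma A) /\
  deformed_mean M sigma A = deform A (deformed_mean M sigma A).
Proof. exact: (@xgetPex _ (0 : op H) _ deform_fixpoint). Qed.

End FixedA.
End Sigma.
End DeformedMean.

(** * Comparison of sub- and supersolutions *)

Section Uniqueness.
Variables (R : realType) (H : hilbert R) (n : nat) (M : ('I_n -> op H) -> op H).
Hypotheses (mM : nvar_operator_mean M) (H_neq0 : exists v : H, v != 0).
Implicit Types (x y z : H) (c d e t l u p a k : R) (X Y U V Z S T : op H) (A B : 'I_n -> op H).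
Variables (sigma : op H -> op H -> op H) (f : R -> R).
Hypotheses (ms : operator_mean sigma) (rs : representing sigma f).

Lemma mean_sqrt X S : posinv_op X -> posinv_op S ->
  let K := power_op X (1 / 2) in let J := power_op X (- (1 / 2)) in
  sigma X S = K \o sigma id (J \o S \o J) \o K.
Proof.
move=> pX pS K J; have pK := power_posinv pX (1 / 2); have pJ := power_posinv pX (- (1 / 2)).
rewrite -(mean_congr ms (@positive_id R H) (proj1 (posinv_congr pS pJ)) pK).
congr (sigma _ _); apply/funext => x /=.
  by rewrite (powerD pX) -[LHS](congr1 (fun F => F x) (power1 pX)); congr (power_op X _ x); field.
by rewrite /K /J (powerVK pX) (powerKV pX).
Qed.

Lemma mean_scale_both c X S : 0 < c -> posinv_op X -> posinv_op S ->
  sigma (fun x => c%:C *: X x) S = (fun x => c%:C *: sigma X (fun y => (c^-1)%:C *: S y) x).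
Proof.
move=> c0 pX pS; have ci : 0 < c^-1 by rewrite invr_gt0.
rewrite -(mean_scale ms c0 (proj1 pX) (proj1 (posinv_scale ci pS))).
congr (sigma _ _); apply/funext => x.
by rewrite scalerA -rmorphM divff ?gt_eqF // scale1r.
Qed.

Hypothesis f_incr : forall s t, 0 < s -> s < t -> f s < f t.

(** Since (a X) sigma S = a (X sigma (a^-1 S)), the gap for I sigma T with T = X^(-1/2) S X^(-1/2)
    carries over by congruence with X^(1/2). *)
Lemma mean_gap a X S : 1 < a -> posinv_op X -> posinv_op S ->
  exists2 k, 0 < k < 1 &
    qle (sigma (fun x => a%:C *: X x) S) (fun x => (a * k)%:C *: sigma X S x).
Proof.
move=> a1 pX pS; have a0 : 0 < a by lra. have ai : 0 < a^-1 by rewrite invr_gt0.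
have pJ := power_posinv pX (- (1 / 2)).
have [k k01 hk] := mean_id_gap H_neq0 ms rs f_incr (posinv_congr pS pJ) a1.
exists k => // x; rewrite mean_scale_both // !(mean_sqrt pX) //; last exact: posinv_scale.
rewrite /= !riZl -mulrA ler_pM2l // !(proj2 (power_sa pX (1 / 2))).
have := hk (power_op X (1 / 2) x); set y := power_op X (1 / 2) x.
have -> // : (fun y => (a^-1)%:C *: ((power_op X (- (1 / 2)) \o S) \o power_op X (- (1 / 2))) y) =
  (power_op X (- (1 / 2)) \o (fun y0 => (a^-1)%:C *: S y0)) \o power_op X (- (1 / 2)).
by apply/funext => z /=; rewrite (bopZ (power_bop pX _)).
Qed.

Lemma deform_gap a A V : 1 < a -> (forall j, posinv_op (A j)) -> posinv_op V ->
  exists2 k, 0 < k < 1 &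
    qle (deform M sigma A (fun x => a%:C *: V x)) (fun x => (a * k)%:C *: deform M sigma A V x).
Proof.
move=> a1 pA pV; have a0 : 0 < a by lra.
have [k hk] := choice (fun j => let: ex_intro2 k k01 h := mean_gap a1 pV (pA j) in
  ex_intro (fun k => 0 < k < 1 /\ qle (sigma (fun x => a%:C *: V x) (A j))
     (fun x => (a * k)%:C *: sigma V (A j) x)) k (conj k01 h)).
(* The common factor below 1 is 1 - 1/l, which also makes sense for an empty family. *)
have [l l1 hl] := finite_bound (fun j => (1 - k j)^-1).
have li : 0 < l^-1 < 1 by rewrite invr_gt0 invf_lt1; lra.
have [l0 l2] := andP li.
have kl j : k j <= 1 - l^-1.
  have [/andP[k0 k1] _] := hk j; have := hl j.
  have k2 : 0 < 1 - k j by lra.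
  have -> : (1 - k j)^-1 <= l = (l^-1 <= 1 - k j).
    by rewrite -[l in LHS]invrK lef_pV2 ?posrE.
  by lra.
have m0 : 0 < 1 - l^-1 < 1 by apply/andP; split; lra.
exists (1 - l^-1) => //; have [m1 m2] := andP m0.
have am : 0 < a * (1 - l^-1) by rewrite mulr_gt0.
have pS j := mean_posinv ms pV (pA j).
rewrite /deform -(nmean_scale mM am pS).
apply: (nmean_le mM) => j; [exact: (mean_posinv ms (posinv_scale a0 pV)) | exact: posinv_scale |].
move=> x; have [_ h] := hk j; apply: le_trans (h x) _; rewrite !riZl ler_wpM2r ?ler_pM2l //.
by have := positive_op_ge0 (proj1 (pS j)) x; rewrite mul0r.
Qed.

(* If a > 1 is the least constant with U <= a V, then U <= deform (a V), which is
   at most a k V for some k < 1. *)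
Lemma deform_comparison A U V : (forall j, posinv_op (A j)) ->
  posinv_op U -> posinv_op V -> qle U (deform M sigma A U) ->
  qle (deform M sigma A V) V -> qle U V.
Proof.
move=> pA pU pV hU hV.
have /posinvP[sV [d d0 hd]] := pV; have [b b0 [hb _]] := sa_bound (posinv_sa pU).
pose I := [set a : R | 0 < a /\ qle U (fun x => a%:C *: V x)].
have [v v0] := H_neq0.
have Ilb : has_inf I.
  split; last by exists 0 => a [/ltW].
  exists (b / d); split=> [|x]; first by rewrite divr_gt0.
  rewrite riZl; apply: le_trans (hb x) _; rewrite mulrAC ler_pdivlMr // -mulrA ler_pM2l //.
  by rewrite mulrC.
have V0 x : 0 <= ri (V x) x by have := positive_op_ge0 (proj1 pV) x; rewrite mul0r.
pose a := inf I.
(* The infimum itself satisfies U <= a V; where the form of V vanishes, any member of I shows that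
   the form of U is at most 0. *)
have Ua x : ri (U x) x <= a * ri (V x) x.
  have [Vx|Vx] := eqVneq (ri (V x) x) 0.
    have [i [i0 hi]] := proj1 Ilb; have := hi x; rewrite riZl Vx !mulr0.
    by [].
  have Vp : 0 < ri (V x) x by rewrite lt_def Vx V0.
  rewrite -ler_pdivrMr //; apply: lb_le_inf; first exact: (proj1 Ilb).
  by move=> c [c0 hc]; rewrite ler_pdivrMr //; have := hc x; rewrite riZl.
have [a1|a1] := leP a 1.
  by move=> x; apply: le_trans (Ua x) _; rewrite ler_piMl.
exfalso; have a0 : 0 < a by lra.
have [k /andP[k0 k1] hk] := deform_gap a1 pA pV.
have UaV : qle U (fun x => a%:C *: V x) by move=> x; rewrite riZl.
have h := qle_trans hU (qle_trans (deform_le mM ms pA pU (posinv_scale a0 pV) UaV) hk).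
have : I (a * k).
  split; first exact: mulr_gt0.
  move=> x; apply: le_trans (h x) _; rewrite !riZl ler_pM2l ?mulr_gt0 //; exact: hV.
move=> /(ge_inf (proj2 Ilb)); rewrite -/a leNgt => /negP; apply.
by rewrite gtr_pMr.
Qed.

End Uniqueness.

(** * Estimates for a single argument and the two-sided bound *)

Section Main.
Variables (R : realType) (H : hilbert R).
Implicit Types (x y z : H) (c d e t l u p a k r : R) (X Y U V Z S T : op H).

Lemma lambda_min_lbd X : (exists v : H, v != 0) -> posinv_op X ->
  0 < lambda_min X /\ lbd X (lambda_min X).
Proof.
move=> v0 pX; have sX := posinv_sa pX; have [a [b [a0 ab ha hb]]] := posinv_interval pX.
have [t st] := spectrum_nonempty sX v0.
have lb : lbound [set t : R | spectrum X t%:C] a by move=> s ss; exact: spectrum_ge ss.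
split; first by apply: lt_le_trans a0 _; apply: lb_le_inf => //; exists t.
have h := funcalc_poly sX 'X; have XE : poly_op 'X X = X by apply/funext => x; rewrite poly_opX.
rewrite -{1}XE; apply: (funcalc_ge sX h) => s ss; rewrite hornerX.
by apply: ge_inf => //; exists a.
Qed.

Lemma opnorm_ubd X : (exists v : H, v != 0) -> posinv_op X ->
  0 < opnorm X /\ ubd X (opnorm X).
Proof.
move=> [v v0] pX; have /posinvP[sX [d d0 hd]] := pX.
have h : ubd X (opnorm X).
  move=> x; apply: le_trans (ri_le _ _) _; rewrite -nn_sqr expr2 mulrA.
  by rewrite ler_wpM2r ?nn_ge0 // opnorm_ge //; case: sX.
split=> //; apply: lt_le_trans d0 _.
by have := le_trans (hd v) (h v); rewrite ler_pM2r // -nn_sqr exprn_gt0 // nn_gt0.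
Qed.

Section Hansen.
Variables (X S : op H) (r : R).
Hypotheses (pX : posinv_op X) (pS : posinv_op S) (r1 : 1 <= r).
Let K := power_op X (1 / 2).
Let J := power_op X (- (1 / 2)).
Let T c : op H := (J \o (fun x => ((c `^ (r - 1))^-1)%:C *: power_op S r x) \o J).

Let r0 : 0 < r. Proof. by move: r1; lra. Qed.
Let p01 : 0 <= r^-1 <= 1. Proof. by rewrite invr_ge0 ltW //= invf_le1. Qed.
Let pSr := power_posinv pS r.
Let pK := power_posinv pX (1 / 2).
Let pJ := power_posinv pX (- (1 / 2)).

Let root_S : power_op (power_op S r) r^-1 = S.
Proof. by rewrite powerM // divff ?gt_eqF // power1. Qed.

Let sK : sa K := posinv_sa pK.
Let sJ : sa J := posinv_sa pJ.
Let KJ x : K (J x) = x. Proof. exact: powerVK. Qed.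
Let JK x : J (K x) = x. Proof. exact: powerKV. Qed.
Let XE x : X x = K (K x).
Proof.
rewrite /K powerD // -[LHS](congr1 (fun F => F x) (power1 pX)); congr (power_op X _ x).
by field.
Qed.

(** The 1/r-th power of nu^-1 for nu = c^(r - 1) is c^(1/r - 1), the power of c that Hansen's
    constant at exponent 1/r matches or cancels. *)
Let power_T c : 0 < c ->
  power_op (T c) r^-1 = fun x => (c `^ (r^-1 - 1))%:C *: power_op (J \o power_op S r \o J) r^-1 x.
Proof.
move=> c0; have cp : 0 < (c `^ (r - 1))^-1 by rewrite invr_gt0 powR_gt0.
have -> : T c = fun x => ((c `^ (r - 1))^-1)%:C *: (J \o power_op S r \o J) x.
  by apply/funext => x; rewrite /T /= (bopZ (posinv_bop pJ : bounded_op J)).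
rewrite power_scale //; last exact: posinv_congr.
have -> // : (c `^ (r - 1))^-1 `^ r^-1 = c `^ (r^-1 - 1).
rewrite -powRN -powRrM; congr (c `^ _); field; exact: lt0r_neq0.
Qed.

(** Hansen's inequality for [J], with J^2 = X^-1 <= c^-1, applied to S^r: its constant (c^-1)^(1 -
    1/r) is exactly the factor in [power_T]. *)
Lemma hansen_lower c : 0 < c -> lbd X c ->
  qle (J \o S \o J) (power_op (T c) r^-1).
Proof.
move=> c0 hX x; rewrite power_T // riZl.
have hJ y : ri (J y) (J y) <= c^-1 * ri y y.
  rewrite ler_pdivlMl //; apply: le_trans (hX (J y)) _.
  by rewrite XE KJ (proj2 sK) KJ.
have ci : 0 < c^-1 by rewrite invr_gt0.
have := hansen pSr pJ ci hJ p01 x; rewrite root_S /= -(proj2 sJ).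
have -> // : c^-1 `^ (1 - r^-1) = c `^ (r^-1 - 1).
by rewrite -powR_inv1 ?ltW // -powRrM; congr (c `^ _); ring.
Qed.

(** Hansen's inequality for [K], with K^2 = X <= c, applied to J S^r J at the vector J x: here K (J
    S^r J) K = S^r, and the constant c^(1 - 1/r) cancels the factor in [power_T]. *)
Lemma hansen_upper c : 0 < c -> ubd X c ->
  qle (power_op (T c) r^-1) (J \o S \o J).
Proof.
move=> c0 hX x; rewrite power_T // riZl.
have hK y : ri (K y) (K y) <= c * ri y y.
  by apply: le_trans (hX y); rewrite XE [leRHS](proj2 sK).
have := hansen (posinv_congr pSr pJ) pK c0 hK p01 (J x); rewrite -/K -/J KJ.
have -> : K \o (J \o power_op S r \o J) \o K = power_op S r.
  by apply/funext => y /=; rewrite KJ JK.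
rewrite root_S /= -/(J x) => h.
apply: le_trans (ler_wpM2l (powR_ge0 c (r^-1 - 1)) h) _.
rewrite mulrA -powRD; last by apply/implyP => _; rewrite gt_eqF.
have -> : r^-1 - 1 + (1 - r^-1) = 0 by ring.
by rewrite powRr0 mul1r /= (proj2 sJ).
Qed.

Variables (sigma sigma_r : op H -> op H -> op H) (f : R -> R).
Hypotheses (H_neq0 : exists v : H, v != 0).
Hypotheses (ms : operator_mean sigma) (rs : representing sigma f).
Hypotheses (mr : operator_mean sigma_r) (rr : representing sigma_r (fun t => f (t `^ r^-1))).

Let mean_r c x : 0 < c ->
  ri (sigma_r (fun y => (c `^ (r - 1))%:C *: X y) (power_op S r) x) x =
  c `^ (r - 1) * ri (sigma id (power_op (T c) r^-1) (K x)) (K x).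
Proof.
move=> c0; have cp := powR_gt0 (r - 1) c0.
have ci : 0 < (c `^ (r - 1))^-1 by rewrite invr_gt0.
have pSc := posinv_scale ci pSr.
rewrite (mean_scale_both mr cp pX pSr) riZl (mean_sqrt mr pX pSc).
rewrite (mean_id_power H_neq0 ms rs mr rr) ?invr_gt0 //; last exact: posinv_congr.
by rewrite /= (proj2 (power_sa pX _)).
Qed.

Let mean_1 x : ri (sigma X S x) x = ri (sigma id (J \o S \o J) (K x)) (K x).
Proof. by rewrite (mean_sqrt ms pX pS) /= (proj2 (power_sa pX _)). Qed.

Let posinv_T c : 0 < c -> posinv_op (power_op (T c) r^-1).
Proof.
move=> c0; apply/power_posinv/posinv_congr => //; apply: posinv_scale => //.
by rewrite invr_gt0 powR_gt0.
Qed.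

Lemma mean_r_lower c : 0 < c -> lbd X c ->
  qle (fun x => (c `^ (r - 1))%:C *: sigma X S x)
      (sigma_r (fun y => (c `^ (r - 1))%:C *: X y) (power_op S r)).
Proof.
move=> c0 hX x; rewrite mean_r // riZl mean_1 ler_pM2l ?powR_gt0 //.
apply: (mean_le ms (@positive_id R H) (proj1 (posinv_congr pS pJ)) (@positive_id R H)
  (proj1 (posinv_T c0)) (fun y => lexx _)).
exact: hansen_lower.
Qed.

Lemma mean_r_upper c : 0 < c -> ubd X c ->
  qle (sigma_r (fun y => (c `^ (r - 1))%:C *: X y) (power_op S r))
      (fun x => (c `^ (r - 1))%:C *: sigma X S x).
Proof.
move=> c0 hX x; rewrite mean_r // riZl mean_1 ler_pM2l ?powR_gt0 //.
apply: (mean_le ms (@positive_id R H) (proj1 (posinv_T c0)) (@positive_id R H)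
  (proj1 (posinv_congr pS pJ)) (fun y => lexx _)).
exact: hansen_upper.
Qed.

End Hansen.
End Main.

Theorem theorem4p1 (R : realType) (H : hilbert R)
    (n : nat) (M : ('I_n -> op H) -> op H)
    (sigma : op H -> op H -> op H) (f_sigma : R -> R)
    (r : R) (sigma_r : op H -> op H -> op H) (A : 'I_n -> op H) :
  infinite_dimensional H ->
  nvar_operator_mean M ->
  operator_mean sigma -> ~ left_trivial sigma ->
  representing sigma f_sigma ->
  1 <= r ->
  operator_mean sigma_r ->
  representing sigma_r (fun x => f_sigma (x `^ r^-1)) ->
  (forall j, posinv_op (A j)) ->
  let X := deformed_mean M sigma A in
  let Y := deformed_mean M sigma_r (fun j => power_op (A j) r) in
  le_op (scalar_op (lambda_min X `^ (r - 1)) \o X) Y /\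
  le_op Y (scalar_op (opnorm X `^ (r - 1)) \o X).
Proof.
move=> hd mM ms nlt rs r1 mr rr pA X Y.
have v0 := infinite_dimensional_neq0 hd; have r0 : 0 < r by lra.
have pAr j := power_posinv (pA j) r.
have [pX XE] : posinv_op X /\ X = deform M sigma A X := deformed_meanP mM v0 ms pA.
have [pY YE] := deformed_meanP mM v0 mr pAr; rewrite -/Y in pY YE.
(* The comparison is made for the equation of [sigma_r], whose representing function inherits
   strictness from [f_sigma]. *)
have incr s t : 0 < s -> s < t -> f_sigma (s `^ r^-1) < f_sigma (t `^ r^-1).
  move=> s0 st; apply: (rep_increasing hd ms rs nlt); first exact: powR_gt0.
  by apply: gt0_ltr_powR; rewrite ?invr_gt0 ?nnegrE // ltW //; lra.
have comp := deform_comparison mM v0 mr rr incr pAr.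
have pcX c : 0 < c -> posinv_op (fun x => (c `^ (r - 1))%:C *: X x) by move=> c0; apply: posinv_scale => //; exact: powR_gt0.
(* By the equation of X, nu X equals M (nu (X sigma A_j)), to be compared with M ((nu X) sigma_r
   A_j^r) argument by argument. *)
have scaled c : 0 < c -> (fun x => (c `^ (r - 1))%:C *: X x) =
    M (fun j x => (c `^ (r - 1))%:C *: sigma X (A j) x).
  move=> c0; rewrite (nmean_scale mM (powR_gt0 _ c0)); last by move=> j; exact: mean_posinv.
  by apply/funext => x; rewrite {1}XE.
have qY : qle Y (deform M sigma_r (fun j => power_op (A j) r) Y) by rewrite -YE.
have qY' : qle (deform M sigma_r (fun j => power_op (A j) r) Y) Y by rewrite -YE.
split.
  have [c0 hc] := lambda_min_lbd v0 pX; have pZ := pcX _ c0.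
  apply/le_opP; [exact: posinv_sa pZ | exact: posinv_sa |].
  apply: (comp _ _ pZ pY _ qY').
  rewrite [X in qle X _](scaled _ c0); apply: (nmean_le mM) => j.
  - by apply: posinv_scale; [exact: powR_gt0 | exact: mean_posinv].
  - exact: mean_posinv.
  - exact: (mean_r_lower pX (pA j) r1 v0 ms rs mr rr c0 hc).
have [c0 hc] := opnorm_ubd v0 pX; have pZ := pcX _ c0.
apply/le_opP; [exact: posinv_sa | exact: posinv_sa pZ |].
apply: (comp _ _ pY pZ qY _).
rewrite [X in qle _ X](scaled _ c0); apply: (nmean_le mM) => j.
- exact: mean_posinv.
- by apply: posinv_scale; [exact: powR_gt0 | exact: mean_posinv].
- exact: (mean_r_upper pX (pA j) r1 v0 ms rs mr rr c0 hc).
Qed.
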